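(* Let $d\ge2$, $p\in\mathbb R\setminus\{-d\}$, and let $\overline K\subset\mathbb R^d$ be a convex body; if $p<0$, assume that $\overline K$ is of class $\mathcal C^2_+$. For $\lambda>0$ consider $\mathbb R^d$ as a projective model of an open half-space of $\mathrm{Sp}^d(\lambda)$. Then $$\lim_{\lambda\to0^+}\Omega_p^\lambda(\overline K)=\int_{\partial\overline K}H_{d-1}^e(\overline K,\mathbf x)^{\frac p{d+p}}\,\mathrm{vol}_{\partial\overline K}^e(d\mathbf x).$$
   Context: For $\lambda>0$, $\mathrm{Sp}^d(\lambda)$ is the space form of dimension $d$ and constant curvature $\lambda$, modelled as the sphere $\{\mathbf x\in\mathbb R^{d+1}:\mathbf x\cdot\mathbf x=1/\lambda\}$. The open half-space centered at $\mathbf o\in\mathrm{Sp}^d(\lambda)$ is the open geodesic ball of radius $\frac\pi{2\sqrt\lambda}$ around $\mathbf o$; its projective model is given by the gnomonic projection $g_{\mathbf o}^\lambda$, which maps the point at distance $r<\frac\pi{2\sqrt\lambda}$ from $\mathbf o$ in unit direction $\mathbf u\in\mathbf o^\perp\cong\mathbb R^d$ to $\frac{\tan(\sqrt\lambda r)}{\sqrt\lambda}\,\mathbf u\in\mathbb R^d$. $\Omega_p^\lambda(\overline K)$ means $\Omega_p^\lambda(K)$ for $K=(g_{\mathbf o}^\lambda)^{-1}(\overline K)$, where $$\Omega_p^\lambda(K)=\int_{\partial K}H_{d-1}^\lambda(K,\mathbf u)^{\frac p{d+p}}\,\mathrm{vol}_{\partial K}^\lambda(d\mathbf u),$$ $H_{d-1}^\lambda(K,\cdot)\ge0$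 is the generalized Gauss–Kronecker curvature of $\partial K$ in $\mathrm{Sp}^d(\lambda)$ (existing almost everywhere, in the sense of Aleksandrov) and $\mathrm{vol}_{\partial K}^\lambda$ the $(d-1)$-dimensional Hausdorff measure on $\partial K$. $H_{d-1}^e$ and $\mathrm{vol}_{\partial\overline K}^e$ are the generalized Euclidean Gauss–Kronecker curvature and the Euclidean surface area measure. Convex bodies have non-empty interior. Class $\mathcal C^2_+$: the boundary is a $\mathcal C^2$-smooth embedded hypersurface with everywhere strictly positive Gauss–Kronecker curvature. *)

(* Defs.v *)
From HB Require Import structures.
From mathcomp Require Import all_boot all_order all_algebra.
From mathcomp Require Import all_classical all_reals all_analysis.

Set Implicit Arguments.
Unset Strict Implicit.
Unset Printing Implicit Defensive.

Import Order.TTheory GRing.Theory Num.Theory numFieldNormedType.Exports.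

Local Open Scope classical_set_scope.
Local Open Scope ring_scope.

(* The norm that MathComp puts on 'rV[R]_n is the sup norm (it induces the     *)
(* usual topology); the Euclidean structure is the following one.             *)
Definition dotp (R : realType) (n : nat) (u v : 'rV[R]_n) : R :=
  \sum_(i < n) u 0 i * v 0 i.

Definition enorm (R : realType) (n : nat) (u : 'rV[R]_n) : R :=
  Num.sqrt (dotp u u).

(* kappa_n = 2 pi / n * kappa_(n-2) *)
Fixpoint unit_ball_volume (R : realType) (n : nat) : R :=
  match n with
  | 0 => 1
  | 1 => 2
  | (m.+1 as k).+1 => 2 * pi / k.+1%:R * unit_ball_volume R m
  end.

Section hausdorff.
Context (R : realType) (T : Type) (S : set T) (rho : T -> T -> R).

(* 0 is thrown in so that the empty set has diameter 0 *)
Definition diameter (A : set T) : R :=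
  sup (0 |` [set rho x y | x in A & y in A]).

Definition hausdorff_size (n : nat) (A : set T) : R :=
  if A == set0 then 0
  else unit_ball_volume R n * (diameter A / 2) ^+ n.

Definition hausdorff_cover (delta : R) (A : set T) : set ((set T)^nat) :=
  [set F | [/\ A `&` S `<=` \bigcup_k F k,
               forall k, F k `<=` S &
               forall k x y, F k x -> F k y -> rho x y <= delta]].

Definition hausdorff_delta (n : nat) (delta : R) (A : set T) : \bar R :=
  ereal_inf [set (\sum_(k <oo) (hausdorff_size n (F k))%:E)%E
            | F in hausdorff_cover delta A].

(* The n-dimensional Hausdorff measure of the metric space (S, rho), seen as  *)
(* an outer measure on T carried by S, and normalized so as to agree with     *)
(* Lebesgue measure on R^n.                                                   *)
Definition hausdorff_measure (n : nat) (A : set T) : \bar R :=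
  ereal_sup [set hausdorff_delta n delta A | delta in [set delta | 0 < delta]].

Lemma diameter_ge0 (A : set T) : 0 <= diameter A.
Proof.
rewrite /diameter; set B := (X in sup X).
have B0 : B 0 by left.
have [hB|hB] := pselect (has_ubound B); first exact: ub_le_sup.
by rewrite sup_out// => -[].
Qed.

Lemma unit_ball_volume_ge0 (n : nat) : 0 <= unit_ball_volume R n.
Proof.
suff : 0 <= unit_ball_volume R n /\ 0 <= unit_ball_volume R n.+1 by case.
elim: n => [|n [IH1 IH2]]; first by split => /=.
by split => //; rewrite [unit_ball_volume R n.+2]/= !mulr_ge0// pi_ge0.
Qed.

Lemma hausdorff_size_ge0 (n : nat) (A : set T) : 0 <= hausdorff_size n A.
Proof.
rewrite /hausdorff_size; case: ifPn => // _.
by rewrite mulr_ge0 ?unit_ball_volume_ge0// exprn_ge0// divr_ge0// diameter_ge0.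
Qed.

Local Open Scope ereal_scope.

Lemma hausdorff_delta_ge0 n delta A : 0 <= hausdorff_delta n delta A.
Proof.
apply: le_ereal_inf_tmp => x [F _ <-].
by apply: nneseries_ge0 => k _ _; rewrite lee_fin hausdorff_size_ge0.
Qed.

Lemma le_hausdorff_delta n delta A B : A `<=` B ->
  hausdorff_delta n delta A <= hausdorff_delta n delta B.
Proof.
move=> AB; apply: ereal_inf_le_tmp => x [F [BF FS Fd] <-].
exists F => //; split => //.
by apply: subset_trans BF; exact: setSI.
Qed.

Lemma hausdorff_delta_sigma_subadditive n delta :
  sigma_subadditive (hausdorff_delta n delta).
Proof.
set mu := hausdorff_delta n delta.
have mu_ge0 A : 0 <= mu A by exact: hausdorff_delta_ge0.
pose sz (A : set T) : \bar R := (hausdorff_size n A)%:E.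
have sz_ge0 A : 0 <= sz A by rewrite lee_fin hausdorff_size_ge0.
move=> A; have [[i ioo]|] := pselect (exists i, mu (A i) = +oo).
  rewrite (eseries_pinfty _ _ ioo) ?leey// => k _.
  by rewrite -ltNye (lt_le_trans _ (mu_ge0 _)).
rewrite -forallNE => Aoo.
suff add2e (e : {posnum R}) :
    mu (\bigcup_k A k) <= \sum_(i <oo) mu (A i) + e%:num%:E.
  by apply/lee_addgt0Pr => _/posnumP[].
rewrite (le_trans _ (epsilon_trick _ _ _))//.
pose P k (B : (set T)^nat) := hausdorff_cover delta (A k) B /\
  \sum_(j <oo) sz (B j) <= mu (A k) + (e%:num / (2 ^ k.+1)%:R)%:E.
have [G PG] : {G : ((set T)^nat)^nat & forall k, P k (G k)}.
  apply: (@choice _ _ P) => k; rewrite /P.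
  have e0 : (0 < e%:num / (2 ^ k.+1)%:R)%R by [].
  have fk : mu (A k) \is a fin_num.
    by rewrite ge0_fin_numE// ltey; apply/eqP; exact: Aoo.
  have [x [B cB <-] /ltW xlt] := lb_ereal_inf_adherent e0 fk.
  by exists B.
apply: (@le_trans _ _ (\esum_(i in setT) (sz \o uncurry G) i)).
  apply: ereal_inf_lbound => /=.
  have /card_esym/ppcard_eqP[f] := card_nat2.
  exists (uncurry G \o f).
    split.
    - apply: (@subset_trans _ (\bigcup_k \bigcup_j G k j)) => [t [[i _ Ait] St]|].
        have [+ _ _] := (PG i).1 => /(_ t (conj Ait St))[j _ ?].
        by exists i => //; exists j.
      move=> t [i _ [j _ Bijt]]; exists (f^-1%FUN (i, j)) => //=.
      by rewrite invK ?inE.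
    - move=> k; have [_ + _] := (PG (f k).1).1.
      by rewrite /= /uncurry; case: (f k) => a b; exact.
    - move=> k x y; have [_ _ +] := (PG (f k).1).1.
      by rewrite /= /uncurry; case: (f k) => a b; exact.
  rewrite -(esum_pred_image (sz \o uncurry G) _ xpredT) ?[fun=> _]set_true.
  - by rewrite image_eq.
  - by move=> k _; exact: sz_ge0.
  - by [].
rewrite (_ : esum _ _ = \sum_(i <oo) \sum_(j <oo ) sz (G i j)); last first.
  pose J : nat -> set (nat * nat) := fun i => [set (i, j) | j in setT].
  rewrite (_ : setT = \bigcup_k J k); last first.
    by rewrite predeqE => -[a b]; split => // _; exists a => //; exists b.
  rewrite esum_bigcupT /=; last 2 first.
    - apply/trivIsetP => i j _ _ ij.
      rewrite predeqE => -[k m] /=; split => //= -[] [_] _ [<-{k} _].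
      by move=> [m' _] [] /esym/eqP; rewrite (negbTE ij).
    - by move=> [k m]; exact: sz_ge0.
  rewrite -(image_id [set: nat]) -fun_true esum_pred_image//; last first.
    by move=> k _; exact: esum_ge0.
  apply: eq_eseriesr => /= j _.
  rewrite -(esum_pred_image (sz \o uncurry G) (pair j) predT)//=; last first.
    by move=> ? ? _ _; exact: (@can_inj _ _ _ snd).
  by congr esum; rewrite predeqE => -[a b]; split; move=> [i _ <-]; exists i.
apply: lee_lim.
- apply: is_cvg_nneseries => k *.
  by apply: nneseries_ge0 => m *; exact: sz_ge0.
- by apply: is_cvg_nneseries => k *; apply: adde_ge0.
- by apply: nearW => k; apply: lee_sum => i _; exact: (PG i).2.
Qed.

Lemma hausdorff_delta_le n delta A : (0 < delta)%R ->
  hausdorff_delta n delta A <= hausdorff_measure n A.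
Proof. by move=> d0; apply: ereal_sup_ubound; exists delta. Qed.

Lemma hausdorff_measure_ge0 n A : 0 <= hausdorff_measure n A.
Proof. exact: le_trans (hausdorff_delta_ge0 n 1 A) (hausdorff_delta_le _ _ _). Qed.

Lemma hausdorff_measure0 n : hausdorff_measure n set0 = 0.
Proof.
apply/eqP; rewrite eq_le hausdorff_measure_ge0 andbT.
apply: ge_ereal_sup => _ [delta d0 <-].
apply: ereal_inf_lbound; exists (fun=> set0).
  by split => [|k|k x y] //; rewrite set0I.
by rewrite eseries0// => k _ _; rewrite /hausdorff_size eqxx.
Qed.

Lemma le_hausdorff_measure n :
  {homo hausdorff_measure n : A B / A `<=` B >-> A <= B}.
Proof.
move=> A B AB; apply: ge_ereal_sup => _ [delta d0 <-].
exact: le_trans (le_hausdorff_delta n delta AB) (hausdorff_delta_le _ _ d0).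
Qed.

Lemma hausdorff_measure_sigma_subadditive n :
  sigma_subadditive (hausdorff_measure n).
Proof.
move=> A; apply: ge_ereal_sup => _ [delta d0 <-].
apply: (le_trans (hausdorff_delta_sigma_subadditive n delta A)).
apply: lee_nneseries => [k _ _|k _]; first exact: hausdorff_delta_ge0.
exact: hausdorff_delta_le.
Qed.

HB.instance Definition _ (n : nat) := isOuterMeasure.Build R T
  (hausdorff_measure n) (hausdorff_measure0 n) (@hausdorff_measure_ge0 n)
  (@le_hausdorff_measure n) (@hausdorff_measure_sigma_subadditive n).

End hausdorff.

(* A Riemannian manifold of dimension [mdim] embedded in R^m as a closed set  *)
(* [carrier], given by its tangent spaces (as linear subspaces of R^m), its   *)
(* exponential map and its geodesic distance; the values outside of the       *)
(* carrier are irrelevant.                                                    *)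
Record space_model (R : realType) (m : nat) := SpaceModel {
  mdim : nat ;
  carrier : set 'rV[R]_m ;
  tangent : 'rV[R]_m -> set 'rV[R]_m ;
  expmap : 'rV[R]_m -> 'rV[R]_m -> 'rV[R]_m ;
  geodist : 'rV[R]_m -> 'rV[R]_m -> R }.

Definition euclidean (R : realType) (d : nat) : space_model R d :=
  {| mdim := d ;
     carrier := setT ;
     tangent := fun _ => setT ;
     expmap := fun x v => x + v ;
     geodist := fun x y => enorm (y - x) |}.

(* Sp^d(lambda), for lambda > 0; for v = 0 the quotient is 0 and the          *)
(* exponential of 0 at x is x, as it should be.                               *)
Definition sphere (R : realType) (d : nat) (lambda : R) : space_model R d.+1 :=
  {| mdim := d ;
     carrier := [set x | dotp x x = lambda^-1] ;
     tangent := fun x => [set v | dotp x v = 0] ;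
     expmap := fun x v =>
       let t := Num.sqrt lambda * enorm v in
       cos t *: x + (sin t / t) *: v ;
     geodist := fun x y => acos (lambda * dotp x y) / Num.sqrt lambda |}.

Section hypersurfaces.
Context (R : realType) (m : nat) (M : space_model R m).

(* topological boundary relative to M *)
Definition boundary (K : set 'rV[R]_m) : set 'rV[R]_m :=
  closure K `&` closure (carrier M `\` K).

(* (d-1)-dimensional Hausdorff measure of M, d = dim M *)
Definition vol : set 'rV[R]_m -> \bar R :=
  hausdorff_measure (carrier M) (geodist M) (mdim M).-1.

HB.instance Definition _ := OuterMeasure.on vol.

(* N is the outer unit normal of K at x: K lies on the inner side of the      *)
(* totally geodesic hypersurface through x which is orthogonal to N (in the   *)
(* sphere, dotp N x = 0, so that this reads dotp N y <= 0 on K).              *)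
Definition outer_unit_normal (K : set 'rV[R]_m) (x N : 'rV[R]_m) : Prop :=
  [/\ tangent M x N, dotp N N = 1 & forall y, K y -> dotp N (y - x) <= 0].

(* The rows of B form an orthonormal basis of the tangent hyperplane of K.    *)
Definition tangent_frame (x N : 'rV[R]_m) (B : 'M[R]_((mdim M).-1, m)) : Prop :=
  [/\ B *m B^T = 1%:M, forall i, tangent M x (row i B) &
      forall i, dotp N (row i B) = 0].

(* Second order differentiability of the boundary at x in the sense of        *)
(* Aleksandrov: in normal coordinates of M at x, the points of the boundary   *)
(* of K close to x, at height h(w) over the tangent hyperplane in the         *)
(* direction of the inner normal - N, satisfy                                 *)
(*   h(w) = w A w^T / 2 + o(|w|^2)  as  w --> 0                               *)
(* (that the boundary of a convex body is then a graph is automatic). As the  *)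
(* Christoffel symbols of normal coordinates vanish at x, A is the matrix of  *)
(* the second fundamental form of the boundary at x.                          *)
Definition second_order_expansion (K : set 'rV[R]_m) (x N : 'rV[R]_m)
    (B : 'M[R]_((mdim M).-1, m)) (A : 'M[R]_((mdim M).-1)) : Prop :=
  A^T = A /\
  forall eps : R, 0 < eps -> exists2 delta : R, 0 < delta &
    forall (w : 'rV[R]_((mdim M).-1)) (h : R), enorm w < delta -> `|h| < delta ->
      boundary K (expmap M x (w *m B - h *: N)) ->
      `|h - (w *m A *m w^T) 0 0 / 2| <= eps * enorm w ^+ 2.

Definition is_curvature (K : set 'rV[R]_m) (x : 'rV[R]_m) : set R :=
  [set kappa | exists N B A, [/\ outer_unit_normal K x N, tangent_frame x N B,
     second_order_expansion K x N B A & kappa = \det A]].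

(* Generalized Gauss-Kronecker curvature, with the value 0 on the null set of *)
(* boundary points where it does not exist.                                   *)
Definition curvature (K : set 'rV[R]_m) (x : 'rV[R]_m) : R :=
  xget 0 (is_curvature K x).

(* The integral is taken over the sigma-algebra of Caratheodory measurable    *)
(* sets, which makes [vol] a complete measure; note that 0 `^ 0 = 1.          *)
Definition Omega (p : R) (K : set 'rV[R]_m) : \bar R :=
  (\int[vol : set (caratheodory_type vol) -> \bar R]_(x in boundary K)
     (curvature K x `^ (p / ((mdim M)%:R + p)))%:E)%E.

End hypersurfaces.

Section convex_bodies.
Context (R : realType) (d : nat).

Definition convex_body (K : set 'rV[R]_d) : Prop :=
  [/\ convex_set K, compact K & K° !=set0].

Definition C2_on (U : set 'rV[R]_d) (F : 'rV[R]_d -> R) : Prop :=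
  forall x, U x ->
    [/\ differentiable F x,
        forall v, differentiable ('D_v F) x &
        forall v w, {for x, continuous ('D_w ('D_v F))}].

(* local description of an embedded hypersurface by regular equations *)
Definition C2_hypersurface (S : set 'rV[R]_d) : Prop :=
  forall x, S x -> exists U F,
    [/\ open U, U x, C2_on U F,
        forall y, U y -> exists v, 'D_v F y != 0 &
        forall y, U y -> (S y <-> F y = 0)].

Definition class_C2_plus (K : set 'rV[R]_d) : Prop :=
  C2_hypersurface (boundary (euclidean R d) K) /\
  forall x, boundary (euclidean R d) K x -> 0 < curvature (euclidean R d) K x.

End convex_bodies.

Section projective_model.
Context (R : realType) (d : nat) (lambda : R).

(* o is a point of Sp^d(lambda) and u |-> u *m E is a linear isometry of R^d  *)
(* onto the orthogonal complement of o.                                       *)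
Definition centered_frame (o : 'rV[R]_d.+1) (E : 'M[R]_(d, d.+1)) : Prop :=
  [/\ carrier (sphere d lambda) o, E *m E^T = 1%:M & E *m o^T = 0].

(* Inverse image of Kb under the gnomonic projection centered at o, which     *)
(* maps the point at distance r from o in the direction u to                  *)
(* (tan (sqrt lambda * r) / sqrt lambda) *: u.                                *)
Definition gnomonic_preimage (o : 'rV[R]_d.+1) (E : 'M[R]_(d, d.+1))
    (Kb : set 'rV[R]_d) : set 'rV[R]_d.+1 :=
  [set y | exists r u,
    [/\ 0 <= r < pi / (2 * Num.sqrt lambda), enorm u = 1,
        y = expmap (sphere d lambda) o (r *: (u *m E)) &
        Kb ((tan (Num.sqrt lambda * r) / Num.sqrt lambda) *: u)]].

End projective_model.

(* Main.v *)
(* The gnomonic projection is bilipschitz on a bounded set, with constants     *)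
(* tending to 1 as lambda --> 0, for the geodesic and the Euclidean distances, *)
(* and it maps hypersurfaces with Gauss-Kronecker curvature k to hypersurfaces *)
(* with curvature k times a factor tending to 1 uniformly on the boundary of   *)
(* the body: it maps second order expansions to second order expansions, up to *)
(* a linear change of coordinates in the tangent hyperplane. Hence the two     *)
(* integrals agree up to a factor tending to 1. No measurability of the        *)
(* curvature is needed, as the integral of a nonnegative function is the       *)
(* supremum of the integrals of the simple functions below it, and a           *)
(* bilipschitz map preserves the Caratheodory measurable sets of the Hausdorff *)
(* measures: up to null sets they are countable intersections of countable     *)
(* unions of closed sets.                                                      *)
From HB Require Import structures.
Require Import Defs.
From mathcomp Require Import all_boot all_order all_algebra.
From mathcomp Require Import all_classical all_reals all_analysis.
From mathcomp Require Import ring lra.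

Set Implicit Arguments.
Unset Strict Implicit.
Unset Printing Implicit Defensive.

Import Order.TTheory GRing.Theory Num.Theory numFieldNormedType.Exports.

Local Open Scope classical_set_scope.
Local Open Scope ring_scope.

(** * Hausdorff measures under Lipschitz maps *)

(** Both integrals are read off on one set [D], the boundary of the Euclidean body: the identity is
    a chart of the Euclidean boundary, and the inverse gnomonic projection [gnom_inv] is a chart of
    the spherical one. As soon as [lambda * dotp x x <= eta] on the body, measures and curvatures
    agree up to explicit factors that tend to 1 with [eta].

    Measure: an exact formula for the angle between two points of the sphere shows that [gnom_inv]
    is bilipschitz with constant (1 + eta) / (1 - eta) ([gnom_inv_bilipschitz]), so
    (d-1)-dimensional measures change at most by its (d-1)-st power ([hausdorff_measure_image]).

    Curvature: central projection sends great circles to lines, so in the chart the exponential map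
    at a boundary point is its differential up to a scalar factor tending to 1 ([expmap_near],
    [expmap_inv_near]). Such a change of coordinates carries second order expansions to second order
    expansions and acts on the second fundamental form by a congruence and a scalar
    ([has_expansion_transfer]). Its effect on the determinant is a factor between (1 + eta)^-(d+1)
    and 1 ([det_sphere_to_euclidean]). Since [curvature] selects one admissible value, one also has
    to know that a convex body has at most one at each point ([curvature_unique]);
    [curvature_comparison] combines these facts.

    Integration: integrals of nonnegative functions are suprema over simple functions, so they are
    compared by pulling simple functions back ([le_integral_charts]). This requires the two
    Hausdorff measures on [D] to have the same Caratheodory sets
    ([hausdorff_caratheodory_transfer]), which follows from Caratheodory's criterion for closed sets
    ([closed_caratheodory]) and from hulls built of closed sets ([hausdorff_hull]).

    A compact body is bounded, so for a given ratio C > 1 one fixes [eta] and then takes [lambda]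
    small: the integrals agree up to the factor C ([Omega_comparison]), which gives the limit,
    finite or infinite ([cvge_ratio]). *)

Section diameter_bounds.
Context (R : realType) (T1 T2 : Type).
Variables (rho1 : T1 -> T1 -> R) (rho2 : T2 -> T2 -> R).

(** The [sup] of an unbounded set is the default value 0, hence the bound [delta] on the distances
    in [A]. *)
Lemma le_diameter (A : set T1) (delta : R) (x y : T1) :
  (forall a b, A a -> A b -> rho1 a b <= delta) -> A x -> A y ->
  rho1 x y <= diameter rho1 A.
Proof.
move=> bA Ax Ay; apply: ub_le_sup; last by right; exists x => //; exists y.
exists (Num.max 0 delta) => _ [->|[a Aa [b Ab <-]]].
  by rewrite le_max lexx.
by rewrite le_max bA ?orbT.
Qed.

Lemma diameter_le (A : set T1) (c : R) : 0 <= c ->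
  (forall x y, A x -> A y -> rho1 x y <= c) -> diameter rho1 A <= c.
Proof.
move=> c0 cA; apply: ge_sup; first by exists 0; left.
by move=> _ [->//|[a Aa [b Ab <-]]]; exact: cA.
Qed.

End diameter_bounds.

Section hausdorff_lipschitz.
Context (R : realType) (T1 T2 : Type).
Variables (rho1 : T1 -> T1 -> R) (rho2 : T2 -> T2 -> R).

Lemma hausdorff_size_image (f : T1 -> T2) (L delta : R) (A B : set T1) n :
  0 <= L -> B `<=` A -> (forall x y, A x -> A y -> rho1 x y <= delta) ->
  (forall x y, B x -> B y -> rho2 (f x) (f y) <= L * rho1 x y) ->
  hausdorff_size rho2 n (f @` B) <= L ^+ n * hausdorff_size rho1 n A.
Proof.
move=> L0 BA bA fL.
(* For n = 0 the size jumps from 0 on the empty set to 1 on nonempty sets, so the empty set is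
   treated apart. *)
have [->|/set0P[b Bb]] := eqVneq B set0.
  rewrite image_set0 {1}/hausdorff_size eqxx.
  by rewrite mulr_ge0 ?exprn_ge0 ?hausdorff_size_ge0.
rewrite /hausdorff_size ifF; last by apply/negbTE/set0P; exists (f b); exists b.
rewrite ifF; last by apply/negbTE/set0P; exists b; exact: BA.
rewrite mulrCA -exprMn ler_wpM2l ?unit_ball_volume_ge0//.
have h0 : 0 <= diameter rho2 (f @` B) by exact: diameter_ge0.
apply: lerXn2r; rewrite ?nnegrE ?mulr_ge0 ?divr_ge0 ?diameter_ge0//.
rewrite mulrA ler_pM2r ?invr_gt0//; apply: diameter_le.
  by rewrite mulr_ge0 ?diameter_ge0.
move=> _ _ [x Bx <-] [y By <-]; apply: le_trans (fL _ _ Bx By) _.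
by rewrite ler_wpM2l//; apply: le_diameter bA _ _; exact: BA.
Qed.

(** A cover at scale [delta / L], cut down to [D], is mapped to a cover at scale [delta], and every
    size grows at most by the factor L^n. *)
Lemma hausdorff_measure_image (S1 D : set T1) (S2 : set T2) (f : T1 -> T2)
    (L : R) n (A : set T1) :
  0 < L -> D `<=` S1 -> (forall x, D x -> S2 (f x)) ->
  (forall x y, D x -> D y -> rho2 (f x) (f y) <= L * rho1 x y) ->
  A `<=` D ->
  (hausdorff_measure S2 rho2 n (f @` A) <=
    (L ^+ n)%:E * hausdorff_measure S1 rho1 n A)%E.
Proof.
move=> L0 DS1 fS2 fL AD.
have Ln0 : 0 < L ^+ n by rewrite exprn_gt0.
apply: ge_ereal_sup => _ [delta /= d0 <-].
have dL0 : 0 < delta / L by rewrite divr_gt0.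
apply: (@le_trans _ _ ((L ^+ n)%:E * hausdorff_delta S1 rho1 n (delta / L) A)%E); last first.
  by rewrite lee_pmul2l// hausdorff_delta_le.
rewrite -lee_pdivrMl//; apply: le_ereal_inf_tmp => _ [F [AF FS Fd] <-].
rewrite lee_pdivrMl// -nneseriesZl; last first.
  by move=> k _ ; rewrite lee_fin hausdorff_size_ge0.
apply: (@le_trans _ _ (\sum_(k <oo)
    (hausdorff_size rho2 n (f @` (F k `&` D)))%:E)%E).
  apply: ereal_inf_lbound; exists (fun k => f @` (F k `&` D)) => //; split.
  - move=> _ [[x Ax <-] _]; have [k _ Fkx] := AF x (conj Ax (DS1 _ (AD _ Ax))).
    by exists k => //; exists x => //; split=> //; exact: AD.
  - by move=> k _ [x [_ Dx] <-]; exact: fS2.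
  - move=> k _ _ [x [Fx Dx] <-] [y [Fy Dy] <-].
    by rewrite (le_trans (fL _ _ Dx Dy))// mulrC -ler_pdivlMr//; exact: Fd Fx Fy.
apply: lee_nneseries => [k _ _|k _]; first by rewrite lee_fin hausdorff_size_ge0.
rewrite -EFinM lee_fin; apply: hausdorff_size_image (ltW L0) _ (Fd k) _.
  by move=> x [].
by move=> x y [_ Dx] [_ Dy]; exact: fL.
Qed.

End hausdorff_lipschitz.

Lemma hausdorff_measureIS (R : realType) (T : Type) (S : set T)
    (rho : T -> T -> R) n (A : set T) :
  hausdorff_measure S rho n (A `&` S) = hausdorff_measure S rho n A.
Proof.
rewrite /hausdorff_measure /hausdorff_delta /hausdorff_cover.
by rewrite -setIA setIid.
Qed.

(** * Caratheodory measurability *)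

Section metric_outer_measure.
Context (R : realType) (T : pseudoMetricType R).
Variable mu : {outer_measure set T -> \bar R}.

(* Caratheodory's criterion: the shells between the sets [E k] of points of X *)
(* at distance at least 1 / (k + 1) from C have summable measure, as shells   *)
(* of the same parity are separated.                                          *)
Lemma closed_caratheodory (C : set T) :
  (forall (A B : set T) (e : R), 0 < e ->
     (forall x y, A x -> B y -> ~ ball x e y) ->
     (mu A + mu B <= mu (A `|` B))%E) ->
  closed C -> mu.-caratheodory C.
Proof.
move=> mu_sep cC; apply: le_caratheodory_measurable => X.
have [->|muX] := eqVneq (mu X) +oo%E; first by rewrite leey.
have {}muX : (mu X < +oo)%E by rewrite ltey.
pose E k := [set x | X x /\ forall c, C c -> ~ ball x k.+1%:R^-1 c].
pose S k := E k.+2 `\` E k.+1.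
have EX k : E k `<=` X by move=> x [].
have inv_lt k : k.+2%:R^-1 < k.+1%:R^-1 :> R by rewrite ltf_pV2 ?posrE// ltr_nat.
have ES k : E k `<=` E k.+1.
  by move=> x [Xx Ex]; split => // c Cc /(le_ball (ltW (inv_lt k))); exact: Ex.
have step k : (mu (E k) + mu (S k) <= mu (E k.+2))%E.
  apply: (@le_trans _ _ (mu (E k `|` S k))); last first.
    apply: le_outer_measure => x [Ex|[]//].
    exact/ES/ES.
  apply: (mu_sep _ _ (k.+1%:R^-1 - k.+2%:R^-1)); first by rewrite subr_gt0.
  move=> x y [Xx Ex] [[Xy _] /not_andP[//|]] /existsNP[c /not_implyP[Cc /contrapT yc]] xy.
  apply: (Ex c Cc); rewrite -(subrK k.+2%:R^-1 k.+1%:R^-1).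
  exact: ball_triangle xy yc.
(* Two consecutive sets [E] absorb the shells of the two parities, which makes the induction run. *)
have sumS n : (\sum_(0 <= k < n) mu (S k) <= mu (E n) + mu (E n.+1))%E.
  elim: n => [|n IH]; first by rewrite big_geq// adde_ge0//; exact: outer_measure_ge0.
  rewrite big_nat_recr//= addeC (le_trans (leeD2l _ IH))//.
  by rewrite addeA addeC (addeC (mu (S n))) leeD2l.
have finS : (\sum_(0 <= k <oo) mu (S k) < +oo)%E.
  apply: (@le_lt_trans _ _ (mu X + mu X)%E); last by rewrite lte_add_pinfty.
  apply: lime_le; first by apply: is_cvg_nneseries => n _ _; exact: outer_measure_ge0.
  apply: nearW => n; apply: (le_trans (sumS n)).
  by rewrite leeD// le_outer_measure.
have tail := nneseries_tail_cvg finS (fun k _ => outer_measure_ge0 mu (S k)).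
have XC N : X `&` ~` C `<=` E N.+1 `|` \bigcup_(n in ~` `I_N) S n.
  move=> x [Xx Cx].
  have [m Em] : exists m, E m x.
    have : nbhs x (~` C) by apply: open_nbhs_nbhs; split => //; exact: closed_openC.
    move=> /nbhs_ballP[e /= e0 eC]; have [m _ /(_ m (leqnn m)) /= me] := near_infty_natSinv_lt (PosNum e0).
    exists m; split => // c Cc /(le_ball (ltW me))/eC; exact.
  have [EN|EN] := pselect (E N.+1 x); [by left|right].
  case: (ex_minnP (ex_intro (fun j => `[<E j x>]) m (asboolT Em))) => j /= Ej jmin.
  move/asboolP in Ej.
  have Nj : (N.+1 < j)%N.
    rewrite ltnNge; apply/negP => jN; apply: EN.
    have mono a b : (a <= b)%N -> E a `<=` E b.
      move=> /subnK <-; elim: (b - a)%N => // i IH y /IH; exact: ES.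
    exact: mono Ej.
  case: j Nj Ej jmin => [//|[//|j]] Nj Ej jmin; exists j => /=.
    by apply/negP; rewrite -leqNgt.
  by split => // /asboolT /jmin; rewrite ltnn.
(* [E N.+1] is separated from C, and the rest of X outside C lies in the shells from [N] on, whose
   total measure is the tail of a convergent series. *)
have main N : (mu (X `&` C) + mu (X `&` ~` C) <=
               mu X + \sum_(N <= i <oo) mu (S i))%E.
  apply: (@le_trans _ _ (mu (X `&` C) + (mu (E N.+1) + \sum_(N <= i <oo) mu (S i))))%E.
    rewrite leeD2l// (le_trans (le_outer_measure mu _ _ (XC N)))//.
    rewrite (le_trans (outer_measureU2 _ _ _))// leeD2l//.
    exact: outer_measure_sigma_subadditive_tail.
  rewrite addeA leeD2r// addeC.
  apply: (@le_trans _ _ (mu (E N.+1 `|` X `&` C))).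
    by apply: (mu_sep _ _ N.+2%:R^-1) => // x c [_ Ex] [_]; exact: Ex.
  by apply: le_outer_measure => x [/EX//|[]].
have lim : (mu X + \sum_(N <= i <oo) mu (S i) @[N --> \oo] --> mu X + 0)%E.
  by apply: cvgeD => //; [rewrite fin_num_adde_defl|exact: cvg_cst].
rewrite -[leRHS]adde0 -(cvg_lim _ lim)//.
apply: lime_ge; first by apply/cvg_ex; exists (mu X + 0)%E.
by apply: nearW => N; exact: main.
Qed.

End metric_outer_measure.

Section hausdorff_regularity.
Context (R : realType) (T : Type) (S : set T) (rho : T -> T -> R) (n : nat).
Local Notation Hd := (hausdorff_delta S rho n).
Local Notation H := (hausdorff_measure S rho n).

Lemma le_hausdorff_delta_r (d1 d2 : R) (A : set T) :
  d1 <= d2 -> (Hd d2 A <= Hd d1 A)%E.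
Proof.
move=> d12; apply: ereal_inf_le_tmp => _ [F [AF FS Fd] <-]; exists F => //.
by split => // k x y Fx Fy; rewrite (le_trans (Fd _ _ _ Fx Fy)).
Qed.

(** A covering set of diameter at most [eta] cannot meet both A and B, so every cover splits into
    the sets that meet A and the others. *)
Lemma hausdorff_delta_separated (eta : R) (A B : set T) :
  (forall x y, A x -> B y -> S x -> S y -> eta < rho x y) ->
  (Hd eta A + Hd eta B <= Hd eta (A `|` B))%E.
Proof.
move=> sep; apply: le_ereal_inf_tmp => _ [F [AF FS Fd] <-].
pose FA k := if `[<F k `&` A !=set0>] then F k else set0.
pose FB k := if `[<F k `&` A !=set0>] then set0 else F k.
have -> : (\sum_(k <oo) (hausdorff_size rho n (F k))%:E =
  \sum_(k <oo) (hausdorff_size rho n (FA k))%:E +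
  \sum_(k <oo) (hausdorff_size rho n (FB k))%:E)%E.
  rewrite -nneseriesD; [|by move=> k *; rewrite lee_fin hausdorff_size_ge0..].
  apply: eq_eseriesr => k _; rewrite -EFinD; congr EFin.
  rewrite /FA /FB /hausdorff_size; case: asboolP => _.
    by rewrite eqxx /= addr0.
  by rewrite eqxx /= add0r.
apply: leeD; apply: ereal_inf_lbound.
- exists FA => //; split.
  + move=> x [Ax Sx]; have [k _ Fkx] := AF x (conj (or_introl Ax) Sx).
    exists k => //; rewrite /FA; case: asboolP => // h.
    by exfalso; apply: h; exists x.
  + by move=> k; rewrite /FA; case: asboolP => _ //; exact: FS.
  + by move=> k x y; rewrite /FA; case: asboolP => _ //; exact: Fd.
- exists FB => //; split.
  + move=> x [Bx Sx]; have [k _ Fkx] := AF x (conj (or_intror Bx) Sx).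
    exists k => //; rewrite /FB; case: asboolP => // -[y [Fky Ay]].
    by have := sep _ _ Ay Bx (FS _ _ Fky) Sx; rewrite ltNge (Fd _ _ _ Fky Fkx).
  + by move=> k; rewrite /FB; case: asboolP => _ //; exact: FS.
  + by move=> k x y; rewrite /FB; case: asboolP => _ //; exact: Fd.
Qed.

Lemma hausdorff_measure_separated (eta : R) (A B : set T) : 0 < eta ->
  (forall x y, A x -> B y -> S x -> S y -> eta < rho x y) ->
  (H A + H B <= H (A `|` B))%E.
Proof.
move=> eta0 sep; set M := H (A `|` B).
have [->|Moo] := eqVneq M +oo%E; first by rewrite leey.
have Mfin : M \is a fin_num.
  by rewrite ge0_fin_numE ?ltey// hausdorff_measure_ge0.
(* With two independent scales the suprema over [d1] and [d2] can be taken one after the other. *)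
have H12 d1 d2 : 0 < d1 -> 0 < d2 -> (Hd d1 A + Hd d2 B <= M)%E.
  move=> d10 d20; set d0 := Num.min eta (Num.min d1 d2).
  have d00 : 0 < d0 by rewrite !lt_min eta0 d10 d20.
  apply: (@le_trans _ _ (Hd d0 A + Hd d0 B)%E).
    by apply: leeD; apply: le_hausdorff_delta_r; rewrite !ge_min lexx !orbT.
  apply: (@le_trans _ _ (Hd d0 (A `|` B))); last exact: hausdorff_delta_le.
  apply: hausdorff_delta_separated => x y Ax By Sx Sy.
  by rewrite (le_lt_trans _ (sep _ _ Ax By Sx Sy))// ge_min lexx.
have HdA d1 : 0 < d1 -> Hd d1 A \is a fin_num.
  move=> d10; rewrite ge0_fin_numE ?hausdorff_delta_ge0//.
  rewrite (@le_lt_trans _ _ M) ?ltey// (le_trans _ (H12 d1 d1 d10 d10))//.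
  by rewrite leeDl// hausdorff_delta_ge0.
have HB : H B \is a fin_num.
  rewrite ge0_fin_numE ?hausdorff_measure_ge0// (@le_lt_trans _ _ M) ?ltey//.
  by apply: le_hausdorff_measure => x; right.
rewrite -leeBrDr//; apply: ge_ereal_sup => _ [d1 /= d10 <-].
rewrite leeBrDr// addeC -leeBrDr ?HdA//; apply: ge_ereal_sup => _ [d2 /= d20 <-].
by rewrite leeBrDr ?HdA// addeC H12.
Qed.

End hausdorff_regularity.

(** For each m take a cover at scale 1/(m+1) whose total size exceeds the measure of A by at most
    1/(m+1), and close its sets. By the second hypothesis closing keeps every bound on the diameter,
    so the intersection over m of these unions is still covered just as cheaply. *)
Lemma hausdorff_hull (R : realType) (T : topologicalType) (S : set T)
    (rho : T -> T -> R) (n : nat) (A : set T) :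
  closed S ->
  (forall F c, F `<=` S -> (forall x y, F x -> F y -> rho x y <= c) ->
     forall x y, closure F x -> closure F y -> rho x y <= c) ->
  A `<=` S -> (hausdorff_measure S rho n A < +oo)%E ->
  exists C : nat -> nat -> set T, [/\ forall m k, closed (C m k),
    A `<=` \bigcap_m \bigcup_k C m k, \bigcap_m \bigcup_k C m k `<=` S &
    hausdorff_measure S rho n (\bigcap_m \bigcup_k C m k) =
    hausdorff_measure S rho n A].
Proof.
move=> cS crho AS Aoo.
set H := hausdorff_measure S rho n in Aoo *.
have e0 m : 0 < m.+1%:R^-1 :> R by rewrite invr_gt0.
have /choice[F FP] : forall m, exists F,
    hausdorff_cover S rho m.+1%:R^-1 A F /\
    (\sum_(k <oo) (hausdorff_size rho n (F k))%:E <= H A + m.+1%:R^-1%:E)%E.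
  move=> m.
  have fin : hausdorff_delta S rho n m.+1%:R^-1 A \is a fin_num.
    rewrite ge0_fin_numE ?hausdorff_delta_ge0//.
    by rewrite (le_lt_trans _ Aoo)// hausdorff_delta_le.
  have [_ [F cF <-] /ltW le] := lb_ereal_inf_adherent (e0 m) fin.
  by exists F; split => //; apply: le_trans le _; rewrite leeD2r// hausdorff_delta_le.
exists (fun m k => closure (F m k)).
have FS m k : F m k `<=` S by have [[_ /(_ k)]] := FP m.
have cFS m k : closure (F m k) `<=` S.
  by move=> x /(closure_subset (@FS m k)); rewrite -(closure_id S).1.
have sub : A `<=` \bigcap_m \bigcup_k closure (F m k).
  move=> x Ax m _; have [[AF _ _] _] := FP m.
  by have [k _ Fx] := AF x (conj Ax (AS _ Ax)); exists k => //; exact: subset_closure.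
split => //; first by move=> m k; exact: closed_closure.
  by move=> x /(_ 0%N I)[k _]; exact: cFS.
apply/eqP; rewrite eq_le; apply/andP; split; last exact: le_hausdorff_measure.
apply: ge_ereal_sup => _ [d /= d0 <-]; apply/lee_addgt0Pr => e e0'.
have [m [me md]] : exists m : nat, m.+1%:R^-1 <= e /\ m.+1%:R^-1 <= d.
  have p0 : 0 < Num.min e d by rewrite lt_min e0'.
  have [m _ /(_ m (leqnn m)) /= /ltW] := near_infty_natSinv_lt (PosNum p0).
  by rewrite le_min => /andP[? ?]; exists m.
have [[_ _ Fd] Fle] := FP m.
apply: (@le_trans _ _ (H A + m.+1%:R^-1%:E)%E); last by rewrite leeD2l// lee_fin.
apply: le_trans Fle.
apply: (@le_trans _ _ (\sum_(k <oo) (hausdorff_size rho n (closure (F m k)))%:E)%E).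
  apply: ereal_inf_lbound; exists (fun k => closure (F m k)) => //; split.
  - by move=> x [/(_ m I)].
  - by move=> k; exact: cFS.
  - move=> k x y cx cy; apply: le_trans md.
    exact: (crho (F m k) _ (@FS m k) (Fd k)).
apply: lee_nneseries => [k _ _|k _]; first by rewrite lee_fin hausdorff_size_ge0.
rewrite lee_fin /hausdorff_size.
have [->|/set0P[z Fz]] := eqVneq (F m k) set0; first by rewrite closure0 eqxx.
rewrite ifF; last by apply/negbTE/set0P; exists z; exact: subset_closure.
rewrite ler_wpM2l ?unit_ball_volume_ge0// lerXn2r ?nnegrE ?divr_ge0 ?diameter_ge0//.
rewrite ler_pM2r ?invr_gt0//; apply: diameter_le; first exact: diameter_ge0.
apply: crho (@FS m k) _ => x y Fx Fy; exact: le_diameter (Fd k) _ _.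
Qed.

Lemma adde_id_eq0 (R : numDomainType) (x y : \bar R) :
  x \is a fin_num -> x = (x + y)%E -> y = 0%E.
Proof.
case: x y => [x| |] [y| |] //= _ [] /eqP.
by rewrite -[X in X == _]addr0 (inj_eq (addrI x)) => /eqP <-.
Qed.

Lemma caratheodory_null (R : realType) (T : Type)
    (mu : {outer_measure set T -> \bar R}) (A : set T) :
  mu A = 0%E -> mu.-caratheodory A.
Proof.
move=> A0; apply: le_caratheodory_measurable => X.
have -> : mu (X `&` A) = 0%E.
  apply/eqP; rewrite eq_le outer_measure_ge0 andbT -A0.
  by apply: le_outer_measure => x [].
by rewrite add0e; apply: le_outer_measure => x [].
Qed.

Lemma caratheodory_bigcap_bigcup (R : realType) (T : Type)
    (mu : {outer_measure set T -> \bar R}) (C : nat -> nat -> set T) :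
  (forall m k, mu.-caratheodory (C m k)) ->
  mu.-caratheodory (\bigcap_m \bigcup_k C m k).
Proof.
move=> mC; rewrite -[X in caratheodory_measurable _ X]setCK setC_bigcap.
apply: caratheodory_measurable_setC; apply: caratheodory_measurable_bigcup => m.
apply: caratheodory_measurable_setC; exact: caratheodory_measurable_bigcup.
Qed.

(* A weak form of: S is closed and rho is a metric on S inducing its topology. *)
Definition tame_metric (R : realType) (T : pseudoMetricType R) (S : set T)
    (rho : T -> T -> R) : Prop :=
  [/\ closed S,
      forall F c, F `<=` S -> (forall x y, F x -> F y -> rho x y <= c) ->
        forall x y, closure F x -> closure F y -> rho x y <= c &
      forall e : R, 0 < e -> exists2 eta : R, 0 < eta &
        forall x y, S x -> S y -> ~ ball x e y -> eta < rho x y].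

Lemma hausdorff_closed_caratheodory (R : realType) (T : pseudoMetricType R)
    (S : set T) (rho : T -> T -> R) (n : nat) (C : set T) :
  tame_metric S rho -> closed C ->
  (hausdorff_measure S rho n).-caratheodory C.
Proof.
move=> [_ _ sep] cC; apply: closed_caratheodory cC => A B e e0 AB.
have [eta eta0 Heta] := sep _ e0.
apply: hausdorff_measure_separated eta0 _ => x y Ax By Sx Sy.
by apply: Heta => //; exact: AB.
Qed.

(* Test sets X can be replaced by a hull Y which is a countable intersection of *)
(* countable unions of closed sets; then A `&` Y is such a set up to a null set. *)
Lemma hausdorff_caratheodory_transfer (R : realType) (T : pseudoMetricType R)
    (S : set T) (rho1 rho2 : T -> T -> R) (L : R) (n : nat) (A : set T) :
  tame_metric S rho1 -> tame_metric S rho2 -> 0 < L ->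
  (forall x y, S x -> S y -> rho1 x y <= L * rho2 x y) ->
  (forall x y, S x -> S y -> rho2 x y <= L * rho1 x y) ->
  A `<=` S ->
  (hausdorff_measure S rho1 n).-caratheodory A ->
  (hausdorff_measure S rho2 n).-caratheodory A.
Proof.
move=> t1 t2 L0 L12 L21 AS.
set mu := hausdorff_measure S rho1 n; set nu := hausdorff_measure S rho2 n.
move=> mA; apply: le_caratheodory_measurable => X.
change (nu (X `&` A) + nu (X `&` ~` A) <= nu X)%E.
have [->|nuX] := eqVneq (nu X) +oo%E; first by rewrite leey.
have nuXS : nu (X `&` S) = nu X by exact: hausdorff_measureIS.
have {}nuX : (nu (X `&` S) < +oo)%E by rewrite nuXS ltey.
have [cS cl1 _] := t1; have [_ cl2 _] := t2.
have Ln0 : 0 < L ^+ n by rewrite exprn_gt0.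
have munu B : B `<=` S -> (mu B <= (L ^+ n)%:E * nu B)%E.
  by move=> BS; rewrite -{1}(image_id B); apply: hausdorff_measure_image BS.
have numu B : B `<=` S -> (nu B <= (L ^+ n)%:E * mu B)%E.
  by move=> BS; rewrite -{1}(image_id B); apply: hausdorff_measure_image BS.
have XS : X `&` S `<=` S by move=> x [].
have [C [cC XC CS muC]] := hausdorff_hull cS cl2 XS nuX.
set Y := \bigcap_m _ in XC CS muC; rewrite -/nu in muC.
have mY : mu.-caratheodory Y.
  by apply: caratheodory_bigcap_bigcup => m k; exact: hausdorff_closed_caratheodory.
have mAY := caratheodory_measurable_setI mA mY.
have muY : (mu Y < +oo)%E.
  by rewrite (le_lt_trans (munu _ CS))// muC lte_mul_pinfty// ?lee_fin ?ltW.
have AYS : A `&` Y `<=` S by move=> x [/AS].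
have muAY : (mu (A `&` Y) < +oo)%E.
  by rewrite (le_lt_trans _ muY)//; apply: le_outer_measure => x [].
have [C' [cC' AYC' C'S muC']] := hausdorff_hull cS cl1 AYS muAY.
set B := \bigcap_m _ in AYC' C'S muC'; rewrite -/mu in muC'.
have nB : nu.-caratheodory B.
  by apply: caratheodory_bigcap_bigcup => m k; exact: hausdorff_closed_caratheodory.
(* [B] and [A & Y] have the same finite [mu]-measure, and the measurability of [A & Y] allows
   subtraction. The Lipschitz bound then makes the difference [nu]-null, hence [nu]-measurable. *)
have N0 : mu (B `&` ~` (A `&` Y)) = 0%E.
  have : mu B = (mu (B `&` (A `&` Y)) + mu (B `&` ~` (A `&` Y)))%E by exact: mAY.
  rewrite muC' (setIidr AYC').
  have fin : mu (A `&` Y) \is a fin_num.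
    by rewrite ge0_fin_numE// outer_measure_ge0.
  exact: adde_id_eq0.
have nN : nu.-caratheodory (B `&` ~` (A `&` Y)).
  apply: caratheodory_null; apply/eqP.
  rewrite eq_le outer_measure_ge0 andbT (le_trans (numu _ _))//.
    by move=> x [/C'S].
  by rewrite N0 mule0.
have nAY : nu.-caratheodory (A `&` Y).
  have -> : A `&` Y = B `\` (B `&` ~` (A `&` Y)).
    apply/seteqP; split=> x; first by move=> AYx; split; [exact: AYC'|case].
    by move=> [Bx nx]; apply: contrapT => nAY; exact: nx.
  exact: caratheodory_measurable_setD.
(* The test set X is replaced by its hull Y of equal [nu]-measure, which [A & Y] splits
   additively. *)
rewrite -nuXS -muC.
have -> : nu Y = (nu (Y `&` (A `&` Y)) + nu (Y `&` ~` (A `&` Y)))%E by exact: nAY.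
apply: leeD.
  rewrite /nu -(hausdorff_measureIS S rho2 n (X `&` A)); apply: le_hausdorff_measure.
  by move=> x [[Xx Ax] Sx]; have Yx := XC x (conj Xx Sx).
rewrite /nu -(hausdorff_measureIS S rho2 n (X `&` ~` A)); apply: le_hausdorff_measure.
by move=> x [[Xx Ax] Sx]; split; [exact: XC|case].
Qed.

(** * Isometric charts of Hausdorff measures *)

Section hausdorff_chart.
Context (R : realType) (T1 T2 : Type) (S : set T2) (rho : T2 -> T2 -> R).
Variables (D : set T1) (f : T1 -> T2) (g : T2 -> T1) (n : nat).
Hypothesis fS : forall x, D x -> S (f x).
Hypothesis fK : forall x, D x -> g (f x) = x.
Local Notation H1 := (hausdorff_measure D (fun x y => rho (f x) (f y)) n).
Local Notation H2 := (hausdorff_measure S rho n).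

Lemma hausdorff_measure_chart (A : set T1) : A `<=` D -> H2 (f @` A) = H1 A.
Proof.
move=> AD; apply/eqP; rewrite eq_le; apply/andP; split.
  rewrite -[leRHS]mul1e -[1%E]/(1%:E) -(expr1n _ n).
  by apply: hausdorff_measure_image AD => // x y; rewrite mul1r.
have {1}<- : g @` (f @` A) = A.
  rewrite image_comp; apply/seteqP; split=> [_ [x Ax <-] /=|x Ax].
    by rewrite fK//; exact: AD.
  by exists x => //=; rewrite fK//; exact: AD.
rewrite -[leRHS]mul1e -[1%E]/(1%:E) -(expr1n _ n).
apply: (@hausdorff_measure_image _ _ _ _ _ _ (f @` D)) => //.
- by move=> _ [x Dx <-]; exact: fS.
- by move=> _ [x Dx <-]; rewrite fK.
- by move=> _ _ [x Dx <-] [y Dy <-]; rewrite !fK// mul1r.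
- exact: image_subset.
Qed.

(** Splitting X in the chart is splitting the test set [f @ (X & D)] by A. *)
Lemma caratheodory_chart (A : set T2) :
  H2.-caratheodory A -> H1.-caratheodory (D `&` f @^-1` A).
Proof.
move=> mA; apply: le_caratheodory_measurable => X.
change (H1 (X `&` (D `&` f @^-1` A)) + H1 (X `&` ~` (D `&` f @^-1` A)) <= H1 X)%E.
have HI Y : H1 (Y `&` D) = H1 Y by exact: hausdorff_measureIS.
rewrite -(HI X).
have XD : X `&` D `<=` D by move=> x [].
rewrite -(hausdorff_measure_chart XD) (mA (f @` (X `&` D))).
have s1 : X `&` (D `&` f @^-1` A) `<=` D by move=> x [_ []].
rewrite -(hausdorff_measure_chart s1) -(HI (X `&` ~` _)).
have s2 : X `&` ~` (D `&` f @^-1` A) `&` D `<=` D by move=> x [].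
rewrite -(hausdorff_measure_chart s2); apply: leeD; apply: le_hausdorff_measure.
  by move=> _ [x [Xx [Dx Ax]] <-]; split => //; exists x.
by move=> _ [x [[Xx nA] Dx] <-]; split; [exists x|move=> Afx; exact: nA].
Qed.

(** A test set is first cut along the measurable set [f @ D]. The part inside is split in the chart;
    the part outside does not meet the image of A. *)
Lemma chart_caratheodory (A : set T1) : H2.-caratheodory (f @` D) -> A `<=` D ->
  H1.-caratheodory A -> H2.-caratheodory (f @` A).
Proof.
move=> mD AD mA; apply: le_caratheodory_measurable => X.
change (H2 (X `&` f @` A) + H2 (X `&` ~` (f @` A)) <= H2 X)%E.
rewrite (mD X).
have -> : X `&` f @` D = f @` (D `&` f @^-1` X).
  apply/seteqP; split=> [z [+ [x Dx E]]|_ [x [Dx Xx] <-]]; first by rewrite -E => Xx; exists x.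
  by split => //; exists x.
set Y := D `&` _; have YD : Y `<=` D by move=> x [].
rewrite (hausdorff_measure_chart YD) (mA Y).
have YA : Y `&` A `<=` D by move=> x [] /YD.
have YAC : Y `&` ~` A `<=` D by move=> x [] /YD.
rewrite -(hausdorff_measure_chart YA) -(hausdorff_measure_chart YAC).
rewrite -addeA; apply: leeD.
  apply: le_hausdorff_measure => z [+ [x Ax E]]; rewrite -E => Xx.
  by exists x => //; do !split => //; exact: AD.
apply: (le_trans _ (outer_measureU2 H2 _ _)); apply: le_hausdorff_measure.
move=> z [Xz Az]; have [[x Dx fxz]|Dz] := pselect ((f @` D) z); [left|by right].
move: Xz Az; rewrite -fxz => Xz Az; exists x => //; split; first by split.
by move=> Ax; apply: Az; exists x.
Qed.

End hausdorff_chart.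

(** * Lower integrals under bilipschitz charts *)

Section pullback.
Import HBNNSimple.
Context (R : realType) (T1 T2 : pointedType).
Variables (mu1 : {outer_measure set T1 -> \bar R}).
Variables (mu2 : {outer_measure set T2 -> \bar R}).
Local Notation U1 := (caratheodory_type mu1).
Local Notation U2 := (caratheodory_type mu2).
Local Notation m1 := (mu1 : set U1 -> \bar R).
Local Notation m2 := (mu2 : set U2 -> \bar R).
Variables (E1 : set T1) (E2 : set T2) (g : T1 -> T2).
Hypothesis mg : forall A, mu2.-caratheodory A ->
  mu1.-caratheodory (E1 `&` g @^-1` A).

Section pullback_nnsfun.
Variable h : {nnsfun U2 >-> R}.

Definition pullback : U1 -> R := (fun x : T1 => h (g x)) \_ E1.

Lemma measurable_pullback : measurable_fun setT pullback.
Proof.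
move=> _ B mB; rewrite setTI.
have mE1 : mu1.-caratheodory E1.
  have := mg (measurableT : measurable (setT : set U2)).
  by rewrite preimage_setT setIT.
have mhB : mu2.-caratheodory (h @^-1` B).
  have := measurable_funPT h; move=> /(_ measurableT _ mB); by rewrite setTI.
have -> : pullback @^-1` B =
    (E1 `&` g @^-1` (h @^-1` B)) `|` (if 0 \in B then ~` E1 else set0).
  apply/seteqP; split=> x; rewrite /pullback /= /patch.
    case: ifPn; rewrite ?inE ?notin_setE => Ex Bx; first by left.
    by right; rewrite ifT ?inE.
  move=> [[Ex Bx]|]; first by rewrite ifT ?inE.
  case: ifPn; rewrite ?inE ?notin_setE// => B0 Ex.
  by rewrite ifF//; apply/negbTE; rewrite notin_setE.
apply: caratheodory_measurable_setU; first exact: mg.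
case: ifP => _; last exact: caratheodory_measurable_set0.
exact: caratheodory_measurable_setC.
Qed.

Lemma pullback_range : range pullback `<=` 0 |` range h.
Proof.
move=> _ [x _ <-]; rewrite /pullback /patch; case: ifP => _; last by left.
by right; exists (g x).
Qed.

Lemma finite_pullback : finite_set (range pullback).
Proof.
apply: sub_finite_set pullback_range _.
by rewrite finite_setU; split => //; exact: fimfunP.
Qed.

Lemma pullback_ge0 x : 0 <= pullback x.
Proof. by rewrite /pullback /patch; case: ifP => // _; exact: fun_ge0. Qed.

HB.instance Definition _ :=
  isMeasurableFun.Build _ _ U1 R pullback measurable_pullback.
HB.instance Definition _ := FiniteImage.Build U1 R pullback finite_pullback.
HB.instance Definition _ := isNonNegFun.Build U1 R pullback pullback_ge0.

Definition pullback_nnsfun : {nnsfun U1 >-> R} := pullback.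

Variable c : R.
Hypothesis mu21 : forall A, A `<=` E2 -> mu2.-caratheodory A ->
  (mu2 A <= c%:E * mu1 (E1 `&` g @^-1` A))%E.

(** Compared level set by level set over the common finite set [Z] of values. A level set of a
    positive value lies in [E2], where [mu21] applies; the value 0 contributes nothing. *)
Lemma le_sintegral_pullback : (forall x, ~ E2 x -> h x = 0) ->
  (sintegral m2 h <= c%:E * sintegral m1 pullback_nnsfun)%E.
Proof.
move=> hE2; pose Z : set R := 0 |` range h.
have Zfin : finite_set Z by rewrite /Z finite_setU; split => //; exact: fimfunP.
rewrite !sintegralET -!(@fsbig_widen _ _ _ _ Z setT)//=; last 2 first.
  move=> x [_ /= Zx].
  rewrite preimage10 ?outer_measure0 ?mule0// => Rx; apply: Zx; exact: pullback_range.
  move=> x [_ /= Zx].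
  by rewrite preimage10 ?outer_measure0 ?mule0// => Rx; apply: Zx; right.
rewrite ge0_mule_fsumr; last first.
  move=> x; have [x0|x0] := leP 0 x; first by rewrite mule_ge0 ?lee_fin ?outer_measure_ge0.
  rewrite preimage10 ?outer_measure0 ?mule0// => -[y _ yx].
  by have := pullback_ge0 y; rewrite [pullback y]yx leNgt x0.
apply: lee_fsum => // x Zx.
have [x0|x0] : x = 0 \/ 0 < x.
  case: Zx => [->|[y _ <-]]; first by left.
  have : 0 <= h y by exact: fun_ge0.
  rewrite le_eqVlt => /predU1P[<-|]; [by left|by right].
  by rewrite x0 !mul0e mule0.
rewrite muleCA lee_pmul2l//.
have -> : pullback @^-1` [set x] = E1 `&` g @^-1` (h @^-1` [set x]).
  apply/seteqP; split=> y; rewrite /pullback /= /patch.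
    case: ifPn; rewrite ?inE ?notin_setE//= => _ xE.
    by move: x0; rewrite -xE ltxx.
  by move=> [Ey hy]; rewrite ifT ?inE.
apply: mu21.
  move=> y /= hy; apply: contrapT => /hE2; rewrite hy => xE.
  by move: x0; rewrite xE ltxx.
have := measurable_funPT h; move=> /(_ measurableT [set x] (measurable_set1 x)).
by rewrite setTI.
Qed.

End pullback_nnsfun.

(** If a simple function lies below [f2] on [E2], its pullback divided by [C] lies below [f1] on
    [E1]; take the supremum over such functions. *)
Lemma le_integral_pullback (f1 : T1 -> R) (f2 : T2 -> R) (c C : R) :
  0 <= c -> 0 < C ->
  (forall A, A `<=` E2 -> mu2.-caratheodory A ->
    (mu2 A <= c%:E * mu1 (E1 `&` g @^-1` A))%E) ->
  (forall x, 0 <= f1 x) -> (forall x, 0 <= f2 x) ->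
  (forall x, E1 x -> E2 (g x)) ->
  (forall x, E1 x -> f2 (g x) <= C * f1 x) ->
  (\int[m2]_(x in E2) (f2 x)%:E <= (C * c)%:E * \int[m1]_(x in E1) (f1 x)%:E)%E.
Proof.
move=> c0 C0 mu21 f10 f20 gE f21.
rewrite [leLHS]ge0_integralE; last by move=> x _; rewrite lee_fin.
apply: ge_ereal_sup => _ [h /= hf <-].
have hE2 x : ~ E2 x -> h x = 0.
  move=> Ex; apply/eqP; rewrite eq_le fun_ge0 andbT -lee_fin.
  by rewrite (le_trans (hf x))// /patch memNset.
apply: (le_trans (le_sintegral_pullback mu21 hE2)).
rewrite mulrC EFinM -muleA lee_pmul//.
- exact: sintegral_ge0.
have C1 : 0 <= C^-1 by rewrite invr_ge0 ltW.
rewrite -lee_pdivrMl//.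
have <- : sintegral m1 (scale_nnsfun (pullback_nnsfun h) C1) =
    ((C^-1)%:E * sintegral m1 (pullback_nnsfun h))%E.
  exact: sintegralrM.
rewrite ge0_integralE; last by move=> x _; rewrite lee_fin.
apply: ereal_sup_ubound => /=; exists (scale_nnsfun (pullback_nnsfun h) C1) => //= x.
rewrite /pullback /patch; case: ifPn; rewrite ?inE ?notin_setE => Ex; last by rewrite mulr0.
rewrite lee_fin ler_pdivrMl// (le_trans _ (f21 x Ex))//.
by have := hf (g x); rewrite /patch mem_set ?lee_fin//; exact: gE.
Qed.

End pullback.

(** The comparison map is [f2 \o g1]. A measurable set of the second space travels to [D] with the
    distance of the second space, then to [D] with that of the first by the bilipschitz bounds, then
    to the first space. The factor [C] comes from the integrands, [L ^+ n] from the measures. *)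
Lemma le_integral_charts (R : realType) (T : pseudoMetricType R)
    (T1 T2 : pointedType) (S1 : set T1) (S2 : set T2)
    (rho1 : T1 -> T1 -> R) (rho2 : T2 -> T2 -> R) (D : set T)
    (f1 : T -> T1) (g1 : T1 -> T) (f2 : T -> T2) (g2 : T2 -> T)
    (n : nat) (L C : R) (phi1 : T1 -> R) (phi2 : T2 -> R) :
  (forall x, D x -> S1 (f1 x)) -> (forall x, D x -> g1 (f1 x) = x) ->
  (forall x, D x -> S2 (f2 x)) -> (forall x, D x -> g2 (f2 x) = x) ->
  tame_metric D (fun x y => rho1 (f1 x) (f1 y)) ->
  tame_metric D (fun x y => rho2 (f2 x) (f2 y)) ->
  (hausdorff_measure S1 rho1 n).-caratheodory (f1 @` D) ->
  0 < L ->
  (forall x y, D x -> D y -> rho1 (f1 x) (f1 y) <= L * rho2 (f2 x) (f2 y)) ->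
  (forall x y, D x -> D y -> rho2 (f2 x) (f2 y) <= L * rho1 (f1 x) (f1 y)) ->
  0 < C -> (forall x, 0 <= phi1 x) -> (forall x, 0 <= phi2 x) ->
  (forall x, D x -> phi2 (f2 x) <= C * phi1 (f1 x)) ->
  (\int[hausdorff_measure S2 rho2 n :
        set (caratheodory_type (hausdorff_measure S2 rho2 n)) -> \bar R
     ]_(x in f2 @` D) (phi2 x)%:E <=
   (C * L ^+ n)%:E *
   \int[hausdorff_measure S1 rho1 n :
        set (caratheodory_type (hausdorff_measure S1 rho1 n)) -> \bar R
     ]_(x in f1 @` D) (phi1 x)%:E)%E.
Proof.
move=> fS1 fK1 fS2 fK2 t1 t2 mD L0 L12 L21 C0 p1 p2 p12.
have pre (A : set T2) : (f1 @` D) `&` (f2 \o g1) @^-1` A =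
    f1 @` (D `&` f2 @^-1` A).
  apply/seteqP; split=> [z [[x Dx <-]]|_ [x [Dx Ax] <-]].
    by rewrite /preimage /= fK1// => Ax; exists x.
  by split; [exists x|rewrite /preimage /= fK1].
have DA (A : set T2) : D `&` f2 @^-1` A `<=` D by move=> x [].
apply: (@le_integral_pullback R T1 T2 (hausdorff_measure S1 rho1 n)
  (hausdorff_measure S2 rho2 n) (f1 @` D) (f2 @` D) (f2 \o g1)) => //.
- move=> A mA; rewrite pre; apply: (chart_caratheodory fS1 fK1) => //.
  apply: (hausdorff_caratheodory_transfer t2 t1 L0) => //.
  exact: (caratheodory_chart fS2 fK2).
- exact: exprn_ge0 (ltW L0).
- move=> A AD2 _; rewrite pre.
  have AE : f2 @` (D `&` f2 @^-1` A) = A.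
    apply/seteqP; split=> [_ [x [_ Ax] <-]//|z Az].
    by have [x Dx xz] := AD2 _ Az; exists x => //; split; rewrite // /preimage /= xz.
  have := @hausdorff_measure_image _ _ _ (fun x y => rho1 (f1 x) (f1 y))
    (fun x y => rho2 (f2 x) (f2 y)) D D D id L n (D `&` f2 @^-1` A) L0
    (@subset_refl _ D) (fun x Dx => Dx) L21 (DA A).
  by rewrite image_id -(hausdorff_measure_chart rho2 n fS2 fK2 (DA A))
    -(hausdorff_measure_chart rho1 n fS1 fK1 (DA A)) AE.
- by move=> _ [x Dx <-] /=; rewrite fK1//; exists x.
- by move=> _ [x Dx <-] /=; rewrite fK1//; exact: p12.
Qed.

(** * Euclidean linear algebra *)

Section dotp_theory.
Context {R : realType}.

Lemma dotpE n (u v : 'rV[R]_n) : dotp u v = (u *m v^T) 0 0.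
Proof. by rewrite !mxE; apply: eq_bigr => i _; rewrite mxE. Qed.

Lemma dotpC n (u v : 'rV[R]_n) : dotp u v = dotp v u.
Proof. by apply: eq_bigr => i _; rewrite mulrC. Qed.

Lemma dotpDl n (u v w : 'rV[R]_n) : dotp (u + v) w = dotp u w + dotp v w.
Proof. by rewrite !dotpE mulmxDl mxE. Qed.

Lemma dotpNl n (u v : 'rV[R]_n) : dotp (- u) v = - dotp u v.
Proof. by rewrite !dotpE mulNmx mxE. Qed.

Lemma dotpZl n a (u v : 'rV[R]_n) : dotp (a *: u) v = a * dotp u v.
Proof. by rewrite !dotpE -scalemxAl mxE. Qed.

Lemma dotpBl n (u v w : 'rV[R]_n) : dotp (u - v) w = dotp u w - dotp v w.
Proof. by rewrite dotpDl dotpNl. Qed.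

Lemma dotpDr n (u v w : 'rV[R]_n) : dotp w (u + v) = dotp w u + dotp w v.
Proof. by rewrite !(dotpC w) dotpDl. Qed.

Lemma dotpNr n (u v : 'rV[R]_n) : dotp v (- u) = - dotp v u.
Proof. by rewrite !(dotpC v) dotpNl. Qed.

Lemma dotpZr n a (u v : 'rV[R]_n) : dotp v (a *: u) = a * dotp v u.
Proof. by rewrite !(dotpC v) dotpZl. Qed.

Lemma dotpBr n (u v w : 'rV[R]_n) : dotp w (u - v) = dotp w u - dotp w v.
Proof. by rewrite dotpDr dotpNr. Qed.

Lemma dotp0l n (v : 'rV[R]_n) : dotp 0 v = 0.
Proof. by rewrite dotpE mul0mx mxE. Qed.

Lemma dotp0r n (v : 'rV[R]_n) : dotp v 0 = 0.
Proof. by rewrite dotpC dotp0l. Qed.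

Definition dotp_linE := (dotpDl, dotpDr, dotpNl, dotpNr, dotpZl, dotpZr).

Lemma dotp_mull m n (u : 'rV[R]_m) (A : 'M[R]_(m, n)) v :
  dotp (u *m A) v = dotp u (v *m A^T).
Proof. by rewrite !dotpE trmx_mul trmxK mulmxA. Qed.

Lemma dotp_mulr m n (u : 'rV[R]_m) (A : 'M[R]_(m, n)) v :
  dotp v (u *m A) = dotp (v *m A^T) u.
Proof. by rewrite dotpC dotp_mull dotpC. Qed.

Lemma dotp_ge0 n (u : 'rV[R]_n) : 0 <= dotp u u.
Proof. by apply: sumr_ge0 => i _; rewrite -expr2 sqr_ge0. Qed.

Lemma dotp_eq0 n (u : 'rV[R]_n) : (dotp u u == 0) = (u == 0).
Proof.
apply/idP/eqP => [|->]; last by rewrite dotp0l.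
rewrite psumr_eq0 => [/allP u0|i _]; last by rewrite -expr2 sqr_ge0.
apply/rowP => i; rewrite mxE; have := u0 i (mem_index_enum i).
by rewrite mulf_eq0 orbb => /eqP.
Qed.

Lemma dotp_gt0 n (u : 'rV[R]_n) : (0 < dotp u u) = (u != 0).
Proof. by rewrite lt_def dotp_ge0 andbT dotp_eq0. Qed.

Lemma enorm_ge0 n (u : 'rV[R]_n) : 0 <= enorm u.
Proof. exact: sqrtr_ge0. Qed.

Lemma enorm_sqr n (u : 'rV[R]_n) : enorm u ^+ 2 = dotp u u.
Proof. by rewrite sqr_sqrtr// dotp_ge0. Qed.

Lemma enorm_eq0 n (u : 'rV[R]_n) : (enorm u == 0) = (u == 0).
Proof. by rewrite -dotp_eq0 -enorm_sqr sqrf_eq0. Qed.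

Lemma enorm0 n : enorm (0 : 'rV[R]_n) = 0.
Proof. by apply/eqP; rewrite enorm_eq0. Qed.

Lemma enormZ n a (u : 'rV[R]_n) : enorm (a *: u) = `|a| * enorm u.
Proof.
by rewrite /enorm dotpZl dotpZr mulrA -expr2 sqrtrM ?sqr_ge0// sqrtr_sqr.
Qed.

Lemma enormN n (u : 'rV[R]_n) : enorm (- u) = enorm u.
Proof. by rewrite -scaleN1r enormZ normrN1 mul1r. Qed.

Lemma enorm_le n (u : 'rV[R]_n) a : 0 <= a -> (enorm u <= a) = (dotp u u <= a ^+ 2).
Proof. by move=> a0; rewrite -enorm_sqr ler_sqr ?nnegrE// enorm_ge0. Qed.

(** Cauchy-Schwarz: (v.v) u - (u.v) v has squared length (v.v) ((u.u)(v.v) - (u.v)^2). *)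
Lemma dotp_sqr_le n (u v : 'rV[R]_n) : dotp u v ^+ 2 <= dotp u u * dotp v v.
Proof.
have [->|v0] := eqVneq v 0; first by rewrite !dotp0r expr0n mulr0.
have vv : 0 < dotp v v by rewrite dotp_gt0.
have := dotp_ge0 (dotp v v *: u - dotp u v *: v).
rewrite !dotp_linE (dotpC v u) => h.
rewrite -subr_ge0 -(pmulr_rge0 _ vv); apply: le_trans h _.
by rewrite le_eqVlt; apply/orP; left; apply/eqP; ring.
Qed.

Lemma normr_dotp_le n (u v : 'rV[R]_n) : `|dotp u v| <= enorm u * enorm v.
Proof.
rewrite -ler_sqr ?nnegrE ?mulr_ge0 ?enorm_ge0// exprMn !enorm_sqr.
by rewrite real_normK ?num_real// dotp_sqr_le.
Qed.

Lemma enormD n (u v : 'rV[R]_n) : enorm (u + v) <= enorm u + enorm v.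
Proof.
rewrite enorm_le ?addr_ge0 ?enorm_ge0// !dotp_linE sqrrD !enorm_sqr.
rewrite (dotpC v u); have := le_trans (ler_norm _) (normr_dotp_le u v).
by move: (_ * _) => p; lra.
Qed.

Lemma coord_le_enorm n (u : 'rV[R]_n) i : `|u 0 i| <= enorm u.
Proof.
rewrite -ler_sqr ?nnegrE ?enorm_ge0// enorm_sqr real_normK ?num_real//.
rewrite /dotp (bigD1 i)//= -expr2 lerDl sumr_ge0// => j _.
by rewrite -expr2 sqr_ge0.
Qed.

Lemma mx_norm_le_enorm n (u : 'rV[R]_n) : `|u| <= enorm u.
Proof.
rewrite [`|u|]mx_normrE; apply: bigmax_le; first exact: enorm_ge0.
by move=> [i j] _ /=; rewrite ord1 coord_le_enorm.
Qed.

(* Stated over an abstract space T, as unification unfolds the neighborhood   *)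
(* filters of matrices.                                                       *)
Lemma continuous_addf (T : topologicalType) (V : normedModType R) (f g : T -> V)
    (t : T) : {for t, continuous f} -> {for t, continuous g} ->
  {for t, continuous (fun x => f x + g x)}.
Proof. by move=> cf cg; exact: cvgD. Qed.

Lemma continuous_scalef (T : topologicalType) (V : normedModType R) (f : T -> R)
    (g : T -> V) (t : T) : {for t, continuous f} -> {for t, continuous g} ->
  {for t, continuous (fun x => f x *: g x)}.
Proof. by move=> cf cg; exact: cvgZ. Qed.

Lemma continuous_mulf (T : topologicalType) (f g : T -> R) (t : T) :
  {for t, continuous f} -> {for t, continuous g} ->
  {for t, continuous (fun x => f x * g x)}.
Proof. by move=> cf cg; exact: cvgM. Qed.

Lemma continuous_invf (T : topologicalType) (f : T -> R) (t : T) : f t != 0 ->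
  {for t, continuous f} -> {for t, continuous (fun x => (f x)^-1)}.
Proof. by move=> f0 cf; exact: cvgV. Qed.

Lemma dotp_continuous (T : topologicalType) n (f g : T -> 'rV[R]_n) (t : T) :
  {for t, continuous f} -> {for t, continuous g} ->
  {for t, continuous (fun x => dotp (f x) (g x))}.
Proof.
move=> cf cg; rewrite /dotp.
have coo (h : T -> 'rV[R]_n) i : {for t, continuous h} ->
    {for t, continuous (fun x => h x 0 i)}.
  move=> ch; apply: (@continuous_comp _ _ _ h (fun M : 'rV[R]_n => M 0 i)) => //.
  exact: coord_continuous.
apply: cvg_big => [|i _]; first exact: add_continuous.
by apply: cvgM; exact: coo.
Qed.

Lemma cV_row_continuous (T : topologicalType) n (f : T -> 'rV[R]_n) (t : T) :
  (forall i, {for t, continuous (fun x => f x 0 i)}) -> {for t, continuous f}.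
Proof.
move=> cf; apply/cvgrPdist_lt => e e0.
have : \forall x \near t, forall i : 'I_n, `|f t 0 i - f x 0 i| < e.
  apply: filter_forall => i.
  by have /cvgrPdist_lt := cf i; apply.
apply: filterS => x hx; rewrite [`|_|]mx_normrE; apply: bigmax_lt => //.
by move=> [i j] _ /=; rewrite ord1 !mxE.
Qed.

Lemma mulmx_continuous m n (A : 'M[R]_(m, n)) :
  continuous (fun u : 'rV[R]_m => u *m A).
Proof.
move=> u; apply: cV_row_continuous => i.
rewrite (_ : (fun _ => _) = (fun x => dotp x (col i A)^T)).
  by apply: dotp_continuous; [exact: cvg_id|exact: cst_continuous].
apply/funext => x; rewrite dotpE trmxK.
by rewrite !mxE; apply: eq_bigr => j _; rewrite mxE.
Qed.

(** Bessel's inequality for the orthonormal rows of B. *)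
Lemma dotp_orthonormal_le m n (B : 'M[R]_(m, n)) (v : 'rV[R]_n) :
  B *m B^T = 1%:M -> dotp (v *m B^T) (v *m B^T) <= dotp v v.
Proof.
move=> BB; set w := v *m B^T.
have vw : dotp v (w *m B) = dotp w w by rewrite dotp_mulr.
have ww : dotp (w *m B) (w *m B) = dotp w w.
  by rewrite dotp_mulr -mulmxA BB mulmx1.
have := dotp_ge0 (v - w *m B).
by rewrite !dotp_linE (dotpC (w *m B) v) vw ww; lra.
Qed.

End dotp_theory.

Section orthonormal.
Context {R : realType}.

(** N and the rows of B form a square matrix Q with Q Q^T = 1, hence Q^T Q = 1, and v = v Q^T Q. *)
Lemma orthonormal_decomposition n (N : 'rV[R]_n.+1) (B : 'M[R]_(n, n.+1)) v :
  dotp N N = 1 -> B *m B^T = 1%:M -> B *m N^T = 0 ->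
  v = dotp v N *: N + v *m B^T *m B.
Proof.
move=> NN BB BN; pose Q : 'M[R]_(1 + n, n.+1) := col_mx N B.
have NB : N *m B^T = 0 by rewrite -[LHS]trmxK trmx_mul trmxK BN trmx0.
have QQ : Q *m Q^T = 1%:M.
  rewrite tr_col_mx mul_col_row BB BN NB [N *m N^T]mx11_scalar -dotpE NN.
  by rewrite -scalar_mx_block.
have := mulmx1C QQ; rewrite tr_col_mx mul_row_col => QQ1.
rewrite -{1}[v]mulmx1 -QQ1 mulmxDr !mulmxA; congr (_ + _).
by rewrite [v *m N^T]mx11_scalar -dotpE mul_scalar_mx.
Qed.

(** The remaining rows of an orthogonal matrix whose first row is N. *)
Lemma orthonormal_complement n (N : 'rV[R]_n.+1) : dotp N N = 1 ->
  exists B : 'M[R]_(n, n.+1), B *m B^T = 1%:M /\ B *m N^T = 0.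
Proof.
move=> NN; pose e : 'rV[R]_(1 + n) := row_mx 1%:M 0.
have ee : dotp e e = 1.
  by rewrite dotpE tr_row_mx mul_row_col trmx0 mulmx0 addr0 mul1mx trmx1 mxE.
suff [H [HH eH]] : exists H : 'M[R]_(1 + n, n.+1), H *m H^T = 1%:M /\ e *m H = N.
  exists (dsubmx H); rewrite -[H]vsubmxK tr_col_mx mul_col_row in HH.
  rewrite [1%:M]scalar_mx_block in HH; have [_ _ HdHu HdHd] := eq_block_mx HH.
  split => //; rewrite -eH -[in X in _ *m X^T](vsubmxK H) mul_row_col mul0mx addr0.
  by rewrite mul1mx.
have [->|eN] := eqVneq N e.
  exists (1%:M : 'M[R]_n.+1); split; last exact: mulmx1.
  by rewrite [X in _ *m X](@trmx1 R n.+1) mulmx1.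
(* Householder reflection exchanging e and N *)
have [v vE] : exists v : 'rV[R]_n.+1, v = e - N by eexists.
have vv : dotp v v != 0 by rewrite vE dotp_eq0 subr_eq0 eq_sym.
have vTv : v *m v^T = (dotp v v)%:M by rewrite [LHS]mx11_scalar dotpE.
pose H : 'M[R]_n.+1 := 1%:M - (2 / dotp v v) *: (v^T *m v).
exists H; split.
  have -> : H^T = H by rewrite /H linearB/= linearZ/= trmx_mul trmxK trmx1.
  rewrite /H mulmxBl mul1mx mulmxBr mulmx1 -scalemxAl -scalemxAr.
  rewrite -mulmxA (mulmxA v) vTv mul_scalar_mx -scalemxAr !scalerA.
  rewrite (_ : 2 / _ * (2 / _ * _) = 2 / dotp v v + 2 / dotp v v); last by field.
  by rewrite scalerDl opprB addrK subrK.
have ev : 2 * dotp e v = dotp v v.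
  by rewrite vE !dotp_linE ee NN (dotpC N e); ring.
rewrite /H mulmxBr mulmx1 -scalemxAr mulmxA [e *m v^T]mx11_scalar -dotpE.
rewrite mul_scalar_mx scalerA (_ : 2 / _ * _ = 1); last by rewrite mulrAC ev divff.
by rewrite scale1r vE opprB addrC subrK.
Qed.

(** Matrix determinant lemma: compare two block triangular factorizations of one matrix of size n +
    1. *)
Lemma det_rank1 n (a : R) (b : 'rV[R]_n) :
  \det (1%:M - a *: (b^T *m b)) = 1 - a * dotp b b.
Proof.
pose M : 'M[R]_(1 + n) := block_mx 1%:M b (a *: b^T) 1%:M.
have E1 : M = block_mx 1%:M 0 (a *: b^T) 1%:M *m
              block_mx 1%:M b 0 (1%:M - a *: (b^T *m b)).
  rewrite mulmx_block !mulmx0 !mul0mx !mul1mx !mulmx1 !addr0.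
  by rewrite -scalemxAl addrC subrK.
have E2 : M = block_mx (1%:M - a *: (b *m b^T)) b 0 1%:M *m
              block_mx 1%:M 0 (a *: b^T) 1%:M.
  rewrite mulmx_block !mulmx0 !mul0mx !mul1mx !mulmx1 !add0r.
  by rewrite -scalemxAr subrK.
have := congr1 determinant E1; rewrite {1}E2 !det_mulmx !det_lblock !det_ublock.
rewrite !det1 !mul1r !mulr1 => <-.
by rewrite det_mx11 !mxE dotpE !mxE.
Qed.

End orthonormal.

(** * The gnomonic projection *)

Section trigonometric_bounds.
Context {R : realType}.

Lemma ge0_derive_ge0 (f df : R -> R) (b : R) :
  (forall x : R, is_derive x (1 : R) f (df x)) -> 0 <= f 0 ->
  (forall x, 0 < x < b -> 0 <= df x) -> 0 <= b -> 0 <= f b.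
Proof.
move=> fdf f0 df0; rewrite le_eqVlt => /predU1P[<-//|b0].
have fc : {within `[0, b], continuous f}.
  apply: continuous_subspaceT => x; apply: differentiable_continuous.
  by apply/derivable1_diffP; have [] := fdf x.
have [c c0b /eqP] := MVT b0 (fun x _ => fdf x) fc.
rewrite subr_eq subr0 => /eqP ->; rewrite addr_ge0// mulr_ge0 ?(ltW b0)//.
by apply: df0; move: c0b; rewrite in_itv.
Qed.

Lemma sin_le (s : R) : 0 <= s -> sin s <= s.
Proof.
move=> s0; rewrite -subr_ge0.
apply: (@ge0_derive_ge0 (fun x => x - sin x) (fun x => 1 - cos x)) => //.
by rewrite sin0 subr0.
Qed.

Lemma cos_ge_quad (s : R) : 0 <= s -> 1 - s ^+ 2 / 2 <= cos s.
Proof.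
move=> s0; rewrite -subr_ge0.
apply: (@ge0_derive_ge0 (fun x => cos x - (1 - x ^+ 2 / 2))
  (fun x => x - sin x)) => //.
- move=> x; apply: is_derive_eq; rewrite /GRing.scale /=; lra.
- by rewrite cos0 expr0n/= mul0r subr0 subrr.
- by move=> x /andP[x0 _]; rewrite subr_ge0 sin_le// ltW.
Qed.

Lemma mul_cos_le_sin (s : R) : 0 <= s <= pi -> s * cos s <= sin s.
Proof.
move=> /andP[s0 spi]; rewrite -subr_ge0.
apply: (@ge0_derive_ge0 (fun x => sin x - x * cos x)
  (fun x => x * sin x)) => //.
- move=> x; apply: is_derive_eq; rewrite /GRing.scale /=; lra.
- by rewrite sin0 mul0r subr0.
- move=> x /andP[x0 xs]; rewrite mulr_ge0 ?ltW// sin_gt0_pi// x0.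
  exact: lt_le_trans xs spi.
Qed.

End trigonometric_bounds.

Section gnomonic.
Context {R : realType} {d : nat} (lam : R) (o : 'rV[R]_d.+1) (E : 'M[R]_(d, d.+1)).
Hypothesis lam0 : 0 < lam.
Hypothesis frame_oE : centered_frame lam o E.

Let osq : dotp o o = lam^-1. Proof. by case: frame_oE. Qed.
Let EE : E *m E^T = 1%:M. Proof. by case: frame_oE. Qed.
Let Eo : E *m o^T = 0. Proof. by case: frame_oE. Qed.
Let oE : o *m E^T = 0.
Proof. by rewrite -[LHS]trmxK trmx_mul trmxK Eo trmx0. Qed.
Let lamN0 : lam != 0. Proof. by rewrite gt_eqF. Qed.

Lemma dotp_frame_l v : dotp o (v *m E) = 0.
Proof. by rewrite dotp_mulr oE dotp0l. Qed.

Lemma dotp_frame u v : dotp (u *m E) (v *m E) = dotp u v.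
Proof. by rewrite dotp_mull -mulmxA EE mulmx1. Qed.

Lemma frame_decomposition (V : 'rV[R]_d.+1) :
  V = (lam * dotp o V) *: o + V *m E^T *m E.
Proof.
have osq1 : dotp (Num.sqrt lam *: o) (Num.sqrt lam *: o) = 1.
  by rewrite dotpZl dotpZr mulrA -expr2 sqr_sqrtr ?(ltW lam0)// osq divff.
have Eo1 : E *m (Num.sqrt lam *: o)^T = 0 by rewrite linearZ/= -scalemxAr Eo scaler0.
rewrite {1}(orthonormal_decomposition V osq1 EE Eo1); congr (_ + _).
by rewrite dotpZr scalerA mulrAC -expr2 sqr_sqrtr ?(ltW lam0)// dotpC.
Qed.

Lemma dotp_decomposition V W :
  dotp V W = lam * dotp o V * dotp o W + dotp (V *m E^T) (W *m E^T).
Proof.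
rewrite {1}(frame_decomposition V) dotpDl dotpZl dotp_mull.
by rewrite dotpC (dotpC o W) dotpC.
Qed.

(** The reciprocal of cos (sqrt lam * r), where r is the distance from [o] of the point of the
    sphere above x. *)
Definition gsigma (x : 'rV[R]_d) : R := Num.sqrt (1 + lam * dotp x x).

Lemma gsigma_sqr x : gsigma x ^+ 2 = 1 + lam * dotp x x.
Proof. by rewrite sqr_sqrtr// addr_ge0// mulr_ge0 ?dotp_ge0// ltW. Qed.

Lemma gsigma_ge1 x : 1 <= gsigma x.
Proof.
rewrite -[1]sqrtr1 ler_sqrt ?lerDl ?mulr_ge0 ?dotp_ge0 ?(ltW lam0)//.
by rewrite addr_ge0// mulr_ge0 ?dotp_ge0 ?(ltW lam0).
Qed.

Lemma gsigma_gt0 x : 0 < gsigma x.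
Proof. exact: lt_le_trans (gsigma_ge1 x). Qed.

(** Central projection of the point o + xE of the tangent hyperplane at [o], whose squared length is
    [gsigma x ^+ 2 / lam]. *)
Definition gnom_inv (x : 'rV[R]_d) : 'rV[R]_d.+1 := (gsigma x)^-1 *: (o + x *m E).

Definition gnom (y : 'rV[R]_d.+1) : 'rV[R]_d := (lam * dotp o y)^-1 *: (y *m E^T).

Lemma dotp_gnom_inv x y :
  dotp (gnom_inv x) (gnom_inv y) =
  (gsigma x)^-1 * (gsigma y)^-1 * (lam^-1 + dotp x y).
Proof.
rewrite /gnom_inv dotpZl dotpZr mulrA dotpDl !dotpDr osq dotp_frame_l.
by rewrite (dotpC (x *m E) o) dotp_frame_l dotp_frame addr0 add0r.
Qed.

Lemma dotp_o_gnom_inv x : dotp o (gnom_inv x) = (gsigma x)^-1 / lam.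
Proof. by rewrite /gnom_inv dotpZr dotpDr osq dotp_frame_l addr0. Qed.

Lemma gnom_inv_carrier x : carrier (sphere d lam) (gnom_inv x).
Proof.
rewrite /= dotp_gnom_inv -invfM -expr2 gsigma_sqr.
have h : 1 + lam * dotp x x != 0 by rewrite -gsigma_sqr sqrf_eq0 gt_eqF ?gsigma_gt0.
by apply: (mulfI h); rewrite mulVKf//; field.
Qed.

Lemma gnom_invK x : gnom (gnom_inv x) = x.
Proof.
have s0 : gsigma x != 0 by rewrite gt_eqF// gsigma_gt0.
rewrite /gnom dotp_o_gnom_inv /gnom_inv -scalemxAl scalerA mulmxDl oE add0r.
rewrite -mulmxA EE mulmx1 (_ : _ * _ = 1) ?scale1r//.
by field; rewrite ?lamN0 ?s0 ?oy0.
Qed.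

Lemma gnomK y : carrier (sphere d lam) y -> 0 < dotp o y -> gnom_inv (gnom y) = y.
Proof.
rewrite /= => yy oy; have oy0 : dotp o y != 0 by rewrite gt_eqF.
have -> : gnom_inv (gnom y) = (gsigma (gnom y))^-1 *: ((lam * dotp o y)^-1 *: y).
  congr (_ *: _); rewrite [X in _ = _ *: X](frame_decomposition y) scalerDr scalerA.
  by rewrite mulVf ?mulf_neq0// scale1r /gnom -scalemxAl.
have -> : gsigma (gnom y) = (lam * dotp o y)^-1.
  rewrite /gsigma /gnom dotpZl dotpZr.
  have -> : dotp (y *m E^T) (y *m E^T) = lam^-1 - lam * dotp o y ^+ 2.
    by rewrite -yy (dotp_decomposition y y) expr2 mulrA addrAC subrr add0r.
  rewrite -[RHS]ger0_norm; last by rewrite invr_ge0 mulr_ge0// ltW.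
  by rewrite -sqrtr_sqr; congr Num.sqrt; field; rewrite ?lamN0 ?oy0.
by rewrite scalerA mulVf ?scale1r// invr_neq0// mulf_neq0.
Qed.

Lemma gsigma_continuous : continuous gsigma.
Proof.
move=> x; apply: (@continuous_comp _ _ _ (fun x => 1 + lam * dotp x x) Num.sqrt);
  last exact: sqrt_continuous.
apply: continuous_addf; first exact: cst_continuous.
apply: continuous_mulf; first exact: cst_continuous.
by apply: dotp_continuous; exact: cvg_id.
Qed.

Lemma gnom_inv_continuous : continuous gnom_inv.
Proof.
move=> x.
apply: (@continuous_scalef _ _ _ (fun x => (gsigma x)^-1) (fun x => o + x *m E)).
  apply: continuous_invf; first by rewrite gt_eqF ?gsigma_gt0.
  exact: gsigma_continuous.
apply: continuous_addf; first exact: cst_continuous.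
exact: mulmx_continuous.
Qed.

Lemma gnom_continuous y : dotp o y != 0 -> {for y, continuous gnom}.
Proof.
move=> oy.
apply: (@continuous_scalef _ _ _ (fun y => (lam * dotp o y)^-1)
  (fun y => y *m E^T)); last exact: mulmx_continuous.
apply: continuous_invf; first by rewrite mulf_neq0.
apply: continuous_mulf; first exact: cst_continuous.
by apply: dotp_continuous; [exact: cst_continuous|exact: cvg_id].
Qed.

Lemma gnom_inv_inj x y : gnom_inv x = gnom_inv y -> x = y.
Proof. by move=> xy; rewrite -(gnom_invK x) xy gnom_invK. Qed.

(** [gnom_inv] is a homeomorphism onto the open hemisphere [0 < dotp o y], which is a neighborhood
    in the sphere of each of its points. Compactness makes K and its image closed, so that only the
    closures of the complements have to be matched. *)
Lemma gnom_inv_boundary (K : set 'rV[R]_d) : compact K ->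
  boundary (sphere d lam) (gnom_inv @` K) = gnom_inv @` boundary (euclidean R d) K.
Proof.
move=> cK; have clK : closed K by apply: compact_closed => //; exact: norm_hausdorff.
have clgK : closed (gnom_inv @` K).
  apply: compact_closed; first exact: norm_hausdorff.
  apply: continuous_compact => //; apply: continuous_subspaceT.
  exact: gnom_inv_continuous.
rewrite /boundary -((closure_id _).1 clgK) -((closure_id _).1 clK).
apply/seteqP; split=> [_ [[x Kx <-] cx]|_ [x [Kx cx] <-]].
  exists x => //; split => // U Ux.
  have ox : 0 < dotp o (gnom_inv x).
    by rewrite dotp_o_gnom_inv divr_gt0// invr_gt0 gsigma_gt0.
  have : nbhs (gnom_inv x) (gnom @^-1` U `&` [set y | 0 < dotp o y]).
    apply: filterI.
      by apply: gnom_continuous; rewrite ?gt_eqF// gnom_invK.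
    have /cvgrPdist_lt /(_ _ ox) : {for gnom_inv x, continuous (dotp o)}.
      by apply: dotp_continuous; [exact: cst_continuous|exact: cvg_id].
    apply: filterS => y; rewrite ltr_norml => /andP[_].
    by rewrite ltrBlDr ltrDl.
  move=> /cx [z [[Sz Kz] [Uz oz]]]; exists (gnom z); split => //; split => // Kgz.
  by apply: Kz; exists (gnom z) => //; exact: gnomK.
split; first by exists x.
move=> V Vx; have [z [[_ Kz] Vz]] := cx _ (gnom_inv_continuous Vx).
exists (gnom_inv z); split => //; split; first exact: gnom_inv_carrier.
by move=> [w Kw /gnom_inv_inj wz]; apply: Kz; rewrite -wz.
Qed.

(** At the image of the point at distance r the factor [gsigma] is 1 / cos (sqrt lam * r), so polar
    coordinates turn into central projection. The condition on d provides a unit direction for x =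
    0. *)
Lemma gnomonic_preimageE (K : set 'rV[R]_d) : (0 < d)%N ->
  gnomonic_preimage lam o E K = gnom_inv @` K.
Proof.
move=> d0; have sl0 : 0 < Num.sqrt lam by rewrite sqrtr_gt0.
have key r u : 0 <= r < pi / (2 * Num.sqrt lam) -> enorm u = 1 ->
    expmap (sphere d lam) o (r *: (u *m E)) =
    gnom_inv ((tan (Num.sqrt lam * r) / Num.sqrt lam) *: u).
  move=> /andP[r0 rpi] u1.
  have uu : dotp u u = 1 by rewrite -enorm_sqr u1 expr1n.
  have nr : enorm (r *: (u *m E)) = r.
    by rewrite enormZ /enorm dotp_frame uu sqrtr1 mulr1 ger0_norm.
  rewrite /= nr; set t := Num.sqrt lam * r.
  have t0 : 0 <= t by rewrite mulr_ge0// ltW.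
  have tpi : t < pi / 2.
    rewrite /t mulrC -ltr_pdivlMr//; apply: (lt_le_trans rpi).
    by rewrite invfM mulrA.
  have cost : 0 < cos t.
    apply: cos_gt0_pihalf; rewrite tpi andbT; apply: lt_le_trans t0.
    by rewrite oppr_lt0 divr_gt0 ?pi_gt0.
  have sE : gsigma ((tan t / Num.sqrt lam) *: u) = (cos t)^-1.
    rewrite /gsigma dotpZl dotpZr uu mulr1 mulrA.
    rewrite -[RHS]ger0_norm ?invr_ge0 ?ltW// -sqrtr_sqr; congr Num.sqrt.
    rewrite exprVn cos2_tan2 ?gt_eqF//.
    rewrite (_ : lam = Num.sqrt lam ^+ 2); last by rewrite sqr_sqrtr// ltW.
    by rewrite sqrtr_sqr ger0_norm ?ltW//; field; rewrite gt_eqF.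
  rewrite /gnom_inv sE invrK scalerDr; congr (_ + _).
  rewrite -scalemxAl !scalerA; congr (_ *: _).
  have [r00|rN0] := eqVneq r 0; first by rewrite /t r00 !mulr0 tan0 !mul0r mulr0.
  have tN0 : t != 0 by rewrite mulf_neq0// gt_eqF.
  have rE : r = t / Num.sqrt lam by rewrite /t mulrC mulKf// gt_eqF.
  rewrite [X in _ * X = _]rE /tan; move: (t) tN0 cost => s sN0 coss.
  by field; rewrite sN0 !gt_eqF.
apply/seteqP; split=> [_ [r [u [rr u1 -> Ku]]]|_ [x Kx <-]].
  by rewrite (key r u rr u1); exists ((tan (Num.sqrt lam * r) / Num.sqrt lam) *: u).
have [u [u1 xu]] : exists u, enorm u = 1 /\ x = enorm x *: u.
  have [->|x0] := eqVneq x 0.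
    pose i := Ordinal d0; exists (delta_mx 0 i); split; last by rewrite enorm0 scale0r.
    rewrite /enorm /dotp (bigD1 i)//= big1 ?addr0 ?mxE ?eqxx ?mulr1 ?sqrtr1// => j ji.
    by rewrite !mxE (negbTE ji) andbF mul0r.
  exists ((enorm x)^-1 *: x).
  have nx : enorm x != 0 by rewrite enorm_eq0.
  by rewrite enormZ ger0_norm ?invr_ge0 ?enorm_ge0// mulVf// scalerA divff// scale1r.
pose t := atan (Num.sqrt lam * enorm x).
have lt0 : Num.sqrt lam != 0 by rewrite gt_eqF.
have tE : Num.sqrt lam * (t / Num.sqrt lam) = t by field.
have rr : 0 <= t / Num.sqrt lam < pi / (2 * Num.sqrt lam).
  apply/andP; split.
    rewrite divr_ge0 ?(ltW sl0)// /t -atan0 le_atan//.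
    by rewrite mulr_ge0 ?enorm_ge0// ltW.
  by rewrite ltr_pdivrMr// invfM mulrA mulfVK// atan_ltpi2.
have xE : x = (tan (Num.sqrt lam * (t / Num.sqrt lam)) / Num.sqrt lam) *: u.
  by rewrite tE /t atanK mulrC mulKf.
exists (t / Num.sqrt lam), u; split => //; first by rewrite key// -xE.
by rewrite -xE.
Qed.

End gnomonic.

(** * Geodesic distance against Euclidean distance *)

Section metric_comparison.
Context {R : realType}.

Lemma sphere_dotp_bounds d (lam : R) (x y : 'rV[R]_d.+1) : 0 < lam ->
  carrier (sphere d lam) x -> carrier (sphere d lam) y ->
  -1 <= lam * dotp x y <= 1.
Proof.
move=> l0 /= xx yy; rewrite -ler_norml -(@ler_sqr _ _ 1) ?nnegrE// expr1n.
rewrite real_normK ?num_real// exprMn -ler_pdivlMl ?exprn_gt0// mulr1.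
by apply: le_trans (dotp_sqr_le x y) _; rewrite xx yy -expr2 exprVn.
Qed.

(** A chord is at most its arc: the squared chord is (2 - 2 cos s) / lam, and 1 - s^2 / 2 <= cos
    s. *)
Lemma enorm_le_sphere_dist d (lam : R) (x y : 'rV[R]_d.+1) : 0 < lam ->
  carrier (sphere d lam) x -> carrier (sphere d lam) y ->
  enorm (y - x) <= geodist (sphere d lam) x y.
Proof.
move=> l0 Sx Sy; have cb := sphere_dotp_bounds l0 Sx Sy; move: Sx Sy => /= xx yy.
set c := lam * dotp x y in cb *.
have sl0 : 0 < Num.sqrt lam by rewrite sqrtr_gt0.
have s0 : 0 <= acos c by exact: acos_ge0.
rewrite enorm_le ?divr_ge0 ?(ltW sl0)// expr_div_n sqr_sqrtr ?(ltW l0)//.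
rewrite ler_pdivlMr// mulrC !dotp_linE xx yy.
have := cos_ge_quad s0; rewrite acosK ?in_itv//=.
have -> : lam * (lam^-1 + - dotp y x + (- dotp x y + - - lam^-1)) = 2 - 2 * c.
  by rewrite /c (dotpC y x); field; rewrite gt_eqF.
by lra.
Qed.

(** Let s be the angle between the image points, c = cos s and k the product of the two [gsigma].
    Then k c = 1 + lam (x.y) >= 1 - eta and k <= 1 + eta, while k sin s is close to sqrt lam * |y -
    x| by [N1]. The claim follows from s c <= sin s <= s. *)
Lemma gnom_inv_bilipschitz d (lam eta : R) (o : 'rV[R]_d.+1)
    (E : 'M[R]_(d, d.+1)) (x y : 'rV[R]_d) :
  0 < lam -> centered_frame lam o E -> 0 <= eta < 1 ->
  lam * dotp x x <= eta -> lam * dotp y y <= eta ->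
  let L := (1 + eta) / (1 - eta) in
  let geo := geodist (sphere d lam) (gnom_inv lam o E x) (gnom_inv lam o E y) in
  geo <= L * enorm (y - x) /\ enorm (y - x) <= L * geo.
Proof.
move=> l0 fr /andP[e0 e1] xe ye L geo.
have := sphere_dotp_bounds l0 (gnom_inv_carrier l0 fr x) (gnom_inv_carrier l0 fr y).
rewrite /geo /=; set c := lam * _ => cb.
have sl0 : 0 < Num.sqrt lam by rewrite sqrtr_gt0.
have s0 : 0 <= acos c by exact: acos_ge0.
have spi : acos c <= pi by exact: acos_lepi.
have cosE : cos (acos c) = c by rewrite acosK ?in_itv.
have sinE : sin (acos c) ^+ 2 = 1 - c ^+ 2 by rewrite sin2cos2 cosE.
have sin0 : 0 <= sin (acos c) by rewrite sin_ge0_pi// s0.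
have h1 := sin_le s0; have h2 : acos c * c <= sin (acos c).
  by rewrite -{2}cosE mul_cos_le_sin// s0.
move: (acos c) s0 spi cosE sinE sin0 h1 h2 => s s0 spi cosE sinE sin0 h1 h2.
set k := gsigma lam x * gsigma lam y.
have k0 : 0 < k by rewrite mulr_gt0// gsigma_gt0.
have kE : k ^+ 2 = (1 + lam * dotp x x) * (1 + lam * dotp y y).
  by rewrite exprMn !gsigma_sqr.
have ck : c * k = 1 + lam * dotp x y.
  rewrite /c (dotp_gnom_inv fr) /k; field.
  by rewrite !gt_eqF ?gsigma_gt0.
have D2 : enorm (y - x) ^+ 2 = dotp y y - 2 * dotp x y + dotp x x.
  by rewrite enorm_sqr !dotp_linE (dotpC y x); ring.
have D0 := enorm_ge0 (y - x).
have cs := dotp_sqr_le x y.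
move: (dotp x x) (dotp_ge0 x) (dotp y y) (dotp_ge0 y) (dotp x y) (enorm (y - x))
  xe ye kE ck D2 D0 cs => a a0 b b0 g D xe ye kE ck D2 D0 cs.
(* The last term is the squared area spanned by x and y, which lies between 0 and a D^2. *)
have N1 : k ^+ 2 * (1 - c ^+ 2) = lam * D ^+ 2 + lam ^+ 2 * (a * b - g ^+ 2).
  by rewrite mulrBr mulr1 -exprMn (mulrC k) ck kE D2; ring.
have gab : 0 <= a * b - g ^+ 2 by rewrite subr_ge0.
have gaD : a * b - g ^+ 2 <= a * D ^+ 2.
  by rewrite D2 -subr_ge0 [leRHS](_ : _ = (a - g) ^+ 2) ?sqr_ge0//; ring.
have ge : -eta <= lam * g.
  suff : `|lam * g| <= eta by rewrite ler_norml => /andP[].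
  rewrite -ler_sqr ?nnegrE// real_normK ?num_real//.
  apply: (@le_trans _ _ ((lam * a) * (lam * b))).
    by rewrite exprMn [leRHS]mulrACA -(expr2 lam) ler_wpM2l ?sqr_ge0.
  by rewrite expr2 ler_pM// mulr_ge0// ltW.
have e10 : 0 < 1 - eta by rewrite subr_gt0.
have sD0 : 0 <= Num.sqrt lam * D by rewrite mulr_ge0 ?(ltW sl0).
have sq : Num.sqrt lam ^+ 2 = lam by rewrite sqr_sqrtr// ltW.
have k2le : k ^+ 2 <= (1 + eta) ^+ 2.
  by rewrite kE expr2 ler_pM ?addr_ge0 ?mulr_ge0 ?(ltW l0)// lerD2l.
split.
  suff h : s * (1 - eta) <= (1 + eta) * (Num.sqrt lam * D).
    rewrite ler_pdivrMr// (_ : L * D * _ = (1 + eta) * (Num.sqrt lam * D) / (1 - eta)).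
      by rewrite ler_pdivlMr.
    by rewrite /L; field; rewrite gt_eqF.
  rewrite -ler_sqr ?nnegrE ?mulr_ge0 ?(ltW e10) ?addr_ge0 ?(ltW sl0)//.
  apply: (@le_trans _ _ (k ^+ 2 * (1 - c ^+ 2))).
    rewrite -sinE; apply: (@le_trans _ _ (k ^+ 2 * (s * c) ^+ 2)).
      rewrite (_ : k ^+ 2 * _ = s ^+ 2 * (1 + lam * g) ^+ 2); last by rewrite -ck; ring.
      rewrite exprMn ler_wpM2l ?sqr_ge0// ler_sqr ?nnegrE ?(ltW e10)//; first by lra.
      by apply: le_trans (ltW e10) _; lra.
    rewrite ler_wpM2l ?sqr_ge0// ler_sqr ?nnegrE// mulr_ge0//.
    rewrite -(pmulr_lge0 _ k0) ck; lra.
  rewrite N1 [leRHS](_ : _ = lam * D ^+ 2 * (1 + eta) ^+ 2); last first.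
    by rewrite -[in RHS]sq; ring.
  apply: (@le_trans _ _ ((lam * D ^+ 2) * (1 + eta))).
    rewrite [leRHS](_ : _ = lam * D ^+ 2 + lam * (D ^+ 2 * eta)); last by ring.
    rewrite lerD2l expr2 -mulrA ler_wpM2l ?(ltW l0)//.
    apply: (@le_trans _ _ (lam * (a * D ^+ 2))).
      by rewrite ler_wpM2l ?(ltW l0).
    by rewrite mulrA mulrC ler_wpM2l ?sqr_ge0.
  rewrite ler_wpM2l ?mulr_ge0 ?sqr_ge0 ?(ltW l0)//.
  by rewrite expr2 ler_peMr ?addr_ge0// lerDl.
have h3 : Num.sqrt lam * D <= (1 + eta) * s.
  rewrite -ler_sqr ?nnegrE ?mulr_ge0 ?addr_ge0// exprMn sq.
  apply: (@le_trans _ _ (k ^+ 2 * (1 - c ^+ 2))).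
    by rewrite N1 lerDl mulr_ge0 ?sqr_ge0.
  have s2 : sin s ^+ 2 <= s ^+ 2 by rewrite ler_sqr ?nnegrE.
  by rewrite -sinE [leRHS]exprMn ler_pM ?sqr_ge0.
rewrite (_ : L * _ = (1 + eta) * s / (1 - eta) / Num.sqrt lam); last first.
  by rewrite /L; field; rewrite !gt_eqF.
rewrite !ler_pdivlMr//; apply: le_trans h3.
by rewrite (mulrC D) ler_piMr//; lra.
Qed.

End metric_comparison.

(** * The distances on the boundary are tame *)

Section tameness.
Context {R : realType}.

Lemma closure_le (T : topologicalType) (F : set T) (g : T -> R) (c : R) y :
  {for y, continuous g} -> (forall x, F x -> g x <= c) -> closure F y -> g y <= c.
Proof.
move=> cg gc Fy; rewrite leNgt; apply/negP => cgy.
have [x [/gc gx]] := Fy _ (cvgr_gt _ cg _ cgy).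
by rewrite /= ltNge gx.
Qed.

Lemma separated_enorm n (S : set 'rV[R]_n) (rho : 'rV[R]_n -> 'rV[R]_n -> R) (M : R) :
  0 < M -> (forall x y, S x -> S y -> enorm (y - x) <= M * rho x y) ->
  forall e : R, 0 < e -> exists2 eta : R, 0 < eta &
    forall x y, S x -> S y -> ~ ball x e y -> eta < rho x y.
Proof.
move=> M0 SM e e0; exists (e / 2 / M); first by rewrite !divr_gt0.
move=> x y Sx Sy nb; rewrite ltr_pdivrMr// (mulrC (rho x y)) (lt_le_trans _ (SM x y Sx Sy))//.
rewrite (@lt_le_trans _ _ e) ?(le_trans _ (mx_norm_le_enorm _))//.
  by rewrite ltr_pdivrMr//; lra.
by rewrite leNgt; apply/negP => h; apply: nb; rewrite -ball_normE /= distrC.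
Qed.

Lemma enorm_tame n (D : set 'rV[R]_n) : closed D ->
  tame_metric D (fun x y => enorm (y - x)).
Proof.
move=> cD; split => //; last first.
  by apply: (@separated_enorm _ _ _ 1) => // x y _ _; rewrite mul1r.
have cen x : continuous (fun y : 'rV[R]_n => enorm (y - x)).
  move=> y; rewrite /enorm; apply: (@continuous_comp _ _ _ (fun y : 'rV[R]_n => dotp (y - x) (y - x)) Num.sqrt);
    last exact: sqrt_continuous.
  apply: dotp_continuous; apply: continuous_addf;
    [exact: cvg_id|exact: cst_continuous|exact: cvg_id|exact: cst_continuous].
move=> F c FD Fc x y cx cy.
apply: (closure_le (cen x y)) cy => z Fz.
rewrite -opprB enormN; apply: (closure_le (cen z x)) cx => w Fw.
exact: Fc.
Qed.

(** For 0 <= k < pi, acos c <= k means cos k <= c. A bound on the diameter is thus a closed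
    condition on dot products, which passes to the closure one variable at a time. *)
Lemma sphere_tame n d (lam : R) (D : set 'rV[R]_n) (f : 'rV[R]_n -> 'rV[R]_d.+1)
    (M : R) :
  0 < lam -> closed D -> continuous f ->
  (forall x, D x -> carrier (sphere d lam) (f x)) -> 0 < M ->
  (forall x y, D x -> D y ->
    enorm (y - x) <= M * geodist (sphere d lam) (f x) (f y)) ->
  tame_metric D (fun x y => geodist (sphere d lam) (f x) (f y)).
Proof.
move=> l0 cD cf fS M0 DM; split => //; last exact: separated_enorm M0 DM.
move=> F c FD Fc x y cx cy.
have sl0 : 0 < Num.sqrt lam by rewrite sqrtr_gt0.
have DF z : closure F z -> D z.
  by move=> /(closure_subset FD); rewrite -((closure_id D).1 cD).
have cb z w : D z -> D w -> -1 <= lam * dotp (f z) (f w) <= 1.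
  by move=> Dz Dw; apply: sphere_dotp_bounds => //; exact: fS.
rewrite /= ler_pdivrMr//; set k := c * Num.sqrt lam.
have [kpi|kpi] := leP pi k.
  by rewrite (le_trans _ kpi)// acos_lepi// cb//; exact: DF.
(* The closure of F has a point, so F has one, and its distance to itself is nonnegative. *)
have k0 : 0 <= k.
  have [z [Fz _]] := cx _ filterT; have := Fc _ _ Fz Fz.
  rewrite /= ler_pdivrMr//; apply: le_trans; apply: acos_ge0.
  by apply: cb; exact: FD.
have equ z w : D z -> D w ->
    (acos (lam * dotp (f z) (f w)) <= k) = (- (lam * dotp (f z) (f w)) <= - cos k).
  move=> Dz Dw; have h := cb _ _ Dz Dw.
  rewrite lerN2 leNgt [RHS]leNgt; congr (~~ _).
  rewrite -[X in _ = (X < _)]acosK ?in_itv//= ltr_cos// in_itv/=.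
    by rewrite k0 ltW.
  by rewrite acos_ge0// acos_lepi.
have cdot z : continuous (fun w => - (lam * dotp (f z) (f w))).
  under eq_fun do rewrite -mulNr.
  move=> w.
  apply: (@continuous_mulf _ _ (fun=> - lam) (fun w => dotp (f z) (f w))); first exact: cst_continuous.
  by apply: dotp_continuous; [exact: cst_continuous|exact: cf].
rewrite equ; [|exact: DF..]; apply: (closure_le (cdot x y)) cy => z Fz.
rewrite dotpC; apply: (closure_le (cdot z x)) cx => w Fw.
rewrite -equ; [|exact: FD..]; rewrite -ler_pdivrMr//; exact: Fc.
Qed.

End tameness.

(** * Change of the second fundamental form *)

Section expansion.
Context {R : realType}.

(** The constant is the Frobenius norm. *)
Lemma mulmx_enorm_bound m n (L : 'M[R]_(m, n)) :
  exists2 a : R, 0 <= a & forall u, enorm (u *m L) <= a * enorm u.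
Proof.
pose S := \sum_(j < n) dotp (col j L)^T (col j L)^T.
have S0 : 0 <= S by apply: sumr_ge0 => j _; exact: dotp_ge0.
exists (Num.sqrt S) => [|u]; first exact: sqrtr_ge0.
rewrite enorm_le ?mulr_ge0 ?sqrtr_ge0 ?enorm_ge0// exprMn sqr_sqrtr// enorm_sqr.
rewrite {1}/dotp mulr_suml; apply: ler_sum => j _.
rewrite -expr2 mulrC (_ : (u *m L) 0 j = dotp u (col j L)^T) ?dotp_sqr_le//.
by rewrite !mxE; apply: eq_bigr => i _; rewrite !mxE.
Qed.

Definition has_expansion n (Q : 'rV[R]_n -> R -> Prop) (A : 'M[R]_n) : Prop :=
  forall eps : R, 0 < eps -> exists2 delta : R, 0 < delta &
    forall w h, enorm w < delta -> `|h| < delta -> Q w h ->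
      `|h - (w *m A *m w^T) 0 0 / 2| <= eps * enorm w ^+ 2.

(* Changes of coordinates that are, up to a scalar factor tending to 1,       *)
(* linear and preserve the hyperplane h = 0; the term h l is negligible as    *)
(* h = O(|w|^2).                                                              *)
Lemma has_expansion_transfer n (Q Q' : 'rV[R]_n -> R -> Prop) (A L : 'M[R]_n)
    (l : 'rV[R]_n) (kappa : R) :
  0 < kappa ->
  (forall eta : R, 0 < eta -> exists2 delta : R, 0 < delta &
    forall w h, enorm w < delta -> `|h| < delta -> Q' w h ->
      exists zeta, `|zeta - 1| <= eta /\
        Q (zeta *: (w *m L + h *: l)) (zeta * (kappa * h))) ->
  has_expansion Q A ->
  has_expansion Q' (kappa^-1 *: (L *m A *m L^T)).
Proof.
move=> k0 QQ' QA eps eps0.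
have [a a0 aL] := mulmx_enorm_bound L.
have [b b0 bA] := mulmx_enorm_bound A.
have [c [c0 cl]] : exists c, 0 <= c /\ enorm l = c by exists (enorm l); rewrite enorm_ge0.
(* [C1] gives kappa |h| <= C1 (|w|^2 + h^2), [C2] gives |h| <= C2 |w|^2, [C3] bounds the terms of
   the quadratic form that contain h, and [C4] gives |W|^2 <= C4 |w|^2. Then [e], [eta] and [d] make
   the three errors at most a third, a quarter and a third of kappa eps |w|^2. *)
have [C1 C1E] : exists x, x = 2 * (b + 2) * (a ^+ 2 + c ^+ 2) by eexists.
have [C2 C2E] : exists x, x = 2 * C1 / kappa by eexists.
have [C3 C3E] : exists x, x = 2 * b * a * c * C2 + b * c ^+ 2 * C2 by eexists.
have [C4 C4E] : exists x, x = 2 * a ^+ 2 + 2 * c ^+ 2 * C2 by eexists.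
have C10 : 0 <= C1 by rewrite C1E !mulr_ge0// addr_ge0 ?sqr_ge0.
have C20 : 0 <= C2 by rewrite C2E divr_ge0 ?mulr_ge0// ltW.
have C30 : 0 <= C3 by rewrite C3E addr_ge0// !mulr_ge0 ?sqr_ge0.
have C40 : 0 <= C4 by rewrite C4E addr_ge0// !mulr_ge0 ?sqr_ge0.
have [e eE] : exists x, x = Num.min 1 (kappa * eps / (6 * (C4 + 1))) by eexists.
have ke0 : 0 < kappa * eps by rewrite mulr_gt0.
have C410 : 0 < C4 + 1 by lra.
have e0 : 0 < e by rewrite eE lt_min ltr01/= divr_gt0// mulr_gt0.
have e1 : e <= 1 by rewrite eE ge_min lexx.
have eC4 : 6 * e * C4 <= kappa * eps.
  apply: (@le_trans _ _ (6 * e * (C4 + 1))).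
    by rewrite ler_wpM2l ?mulr_ge0 ?(ltW e0)//; lra.
  rewrite mulrAC -ler_pdivlMl ?mulr_gt0// mulrC; by rewrite eE ge_min lexx orbT.
have [eta etaE] : exists x, x = Num.min (1 / 2) (kappa * eps / (2 * (b * C4 + 1))) by eexists.
have bC4 : 0 < b * C4 + 1 by rewrite ltr_wpDl// mulr_ge0.
have eta0 : 0 < eta by rewrite etaE lt_min !divr_gt0// mulr_gt0.
have eta1 : eta <= 1 / 2 by rewrite etaE ge_min lexx.
have etaC : 2 * eta * (b * C4) <= kappa * eps.
  apply: (@le_trans _ _ (2 * eta * (b * C4 + 1))).
    by rewrite ler_wpM2l ?mulr_ge0 ?(ltW eta0)//; lra.
  rewrite mulrAC -ler_pdivlMl ?mulr_gt0// mulrC; by rewrite etaE ge_min lexx orbT.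
have [d1 d10 Hd1] := QQ' _ eta0.
have [d2 d20 Hd2] := QA _ e0.
have [d [d0 [dd1 [d_1 [dC1 [dC3 [dw dh]]]]]]] : exists d : R, 0 < d /\ d <= d1 /\
    d <= 1 /\ C1 * d <= kappa / 2 /\ 3 * (C3 * d) <= 2 * (kappa * eps) /\
    2 * (a + c) * d < d2 /\ 2 * kappa * d < d2.
  have [M ME] : exists x, x = Num.min d1 (Num.min 1 (Num.min (kappa / 2 / (C1 + 1))
    (Num.min (kappa * eps / 3 / (C3 + 1)) (Num.min (d2 / (2 * (a + c) + 1) / 2)
      (d2 / (2 * kappa) / 2)))))
    by eexists.
  have M0 : 0 < M.
    rewrite ME !lt_min d10 ltr01/= !divr_gt0 ?mulr_gt0//=; try lra.
  have : M <= M by [].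
  rewrite {2}ME !le_min => /andP[? /andP[? /andP[m1 /andP[m2 /andP[m3 m4]]]]]; exists M; do !split => //.
  - move: m1; rewrite ler_pdivlMr; last by lra.
    by move: M0; nra.
  - move: m2; rewrite ler_pdivlMr; last by lra.
    by move: M0; nra.
  - move: m3; rewrite ler_pdivlMr// ler_pdivlMr; last by lra.
    by move: M0; nra.
  - move: m4; rewrite ler_pdivlMr// ler_pdivlMr; last by lra.
    by move: M0; nra.
exists d => // w h wd hd Qwh.
have [zeta [z1 QW]] := Hd1 _ _ (lt_le_trans wd dd1) (lt_le_trans hd dd1) Qwh.
set W := w *m L + h *: l in QW.
pose q u v := dotp (u *m A) v.
have qb u v : `|q u v| <= b * enorm u * enorm v.
  apply: le_trans (normr_dotp_le _ _) _.
  by rewrite ler_wpM2r ?enorm_ge0.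
have z_gt : 1 / 2 <= zeta by move: z1; rewrite ler_norml; lra.
have z_lt : zeta <= 2 by move: z1; rewrite ler_norml; lra.
have z0 : 0 < zeta by lra.
have x0 := enorm_ge0 w; have y0 := normr_ge0 h.
have Wb : enorm W <= a * enorm w + c * `|h|.
  apply: le_trans (enormD _ _) _; rewrite enormZ cl lerD// mulrC//.
have W0 := enorm_ge0 W.
have := Hd2 (zeta *: W) (zeta * (kappa * h)).
rewrite enormZ !normrM (gtr0_norm z0) (gtr0_norm k0).
have wd2 : zeta * enorm W < d2.
  apply: le_lt_trans dw.
  apply: (@le_trans _ _ (2 * (a * enorm w + c * `|h|))).
    by apply: ler_pM => //; exact: ltW.
  by move: wd hd x0 y0; move: (enorm w) (`|h|) => x y; nra.
have hd2 : zeta * (kappa * `|h|) < d2.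
  apply: le_lt_trans dh; rewrite -[leRHS]mulrA.
  by rewrite ler_pM ?mulr_ge0 ?(ltW z0) ?(ltW k0)// ler_wpM2l ?(ltW k0)// ltW.
move=> /(_ wd2 hd2 QW); rewrite -dotpE -scalemxAl dotpZl dotpZr -/(q W W).
have -> : zeta * (kappa * h) - zeta * (zeta * q W W) / 2 =
    zeta * (kappa * h - zeta * q W W / 2) by ring.
rewrite normrM (gtr0_norm z0) (_ : e * (zeta * enorm W) ^+ 2 =
  zeta * (zeta * (e * enorm W ^+ 2))); last by ring.
rewrite ler_pM2l// => main.
have main2 : `|kappa * h - zeta * q W W / 2| <= 2 * e * enorm W ^+ 2.
  apply: le_trans main _; rewrite -mulrA.
  by apply: ler_wpM2r => //; rewrite mulr_ge0 ?sqr_ge0// ltW.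
have qW : `|q W W| <= b * enorm W ^+ 2 by rewrite expr2 mulrA.
have W2 : enorm W ^+ 2 <= 2 * a ^+ 2 * enorm w ^+ 2 + 2 * c ^+ 2 * `|h| ^+ 2.
  apply: (@le_trans _ _ ((a * enorm w + c * `|h|) ^+ 2)).
    by rewrite ler_sqr ?nnegrE// addr_ge0// mulr_ge0.
  rewrite -subr_ge0 [leRHS](_ : _ = (a * enorm w - c * `|h|) ^+ 2) ?sqr_ge0//.
  by ring.
(* For |h| < d the quadratic term C1 h^2 is at most kappa |h| / 2 and is absorbed on the left. *)
have hC2 : `|h| <= C2 * enorm w ^+ 2.
  have h1 : kappa * `|h| <= (b + 2) * enorm W ^+ 2.
    rewrite -[kappa in leLHS](gtr0_norm k0) -normrM.
    rewrite -[kappa * h](subrK (zeta * q W W / 2)).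
    apply: le_trans (ler_normD _ _) _; rewrite addrC mulrDl; apply: lerD.
      rewrite !normrM (gtr0_norm z0) (gtr0_norm (_ : 0 < 2^-1)) ?invr_gt0//.
      by rewrite ler_pdivrMr// mulrC; apply: ler_pM => //; exact: ltW.
    apply: le_trans main2 _; rewrite ler_wpM2r ?sqr_ge0//; lra.
  have h2 : kappa * `|h| <= C1 * (enorm w ^+ 2 + `|h| ^+ 2).
    apply: (le_trans h1); apply: (@le_trans _ _ ((b + 2) *
      (2 * a ^+ 2 * enorm w ^+ 2 + 2 * c ^+ 2 * `|h| ^+ 2))).
      by rewrite ler_wpM2l//; lra.
    rewrite -subr_ge0 [leRHS](_ : _ = 2 * (b + 2) *
      (a ^+ 2 * `|h| ^+ 2 + c ^+ 2 * enorm w ^+ 2)); last by rewrite C1E; ring.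
    by rewrite !mulr_ge0 ?addr_ge0 ?mulr_ge0 ?sqr_ge0.
  rewrite C2E mulrAC ler_pdivlMr//.
  have h3 : C1 * `|h| ^+ 2 <= kappa / 2 * `|h|.
    rewrite expr2 mulrA ler_wpM2r//; apply: le_trans dC1.
    by rewrite ler_wpM2l// ltW.
  by move: h2 h3; rewrite mulrDr; move: (`|h|) (_ ^+ 2) (_ ^+ 2) => ???; lra.
have WC4 : enorm W ^+ 2 <= C4 * enorm w ^+ 2.
  apply: (le_trans W2); rewrite C4E [leRHS](_ : _ = 2 * a ^+ 2 * enorm w ^+ 2 +
    2 * c ^+ 2 * (C2 * enorm w ^+ 2)); last by ring.
  rewrite lerD2l ler_wpM2l ?mulr_ge0 ?sqr_ge0//.
  apply: le_trans hC2; rewrite expr2 ler_piMl//.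
  by apply: le_trans (ltW hd) _.
have wLb := aL w.
have qd : q W W - q (w *m L) (w *m L) =
    h * (q (w *m L) l + q l (w *m L)) + h ^+ 2 * q l l.
  rewrite /q /W !mulmxDl -!scalemxAl !dotp_linE; ring.
have qdb : `|q W W - q (w *m L) (w *m L)| <= C3 * d * enorm w ^+ 2.
  rewrite qd; apply: le_trans (ler_normD _ _) _.
  rewrite C3E mulrDl mulrDl !normrM -expr2 !real_normK ?num_real//.
  have t1 : `|q (w *m L) l + q l (w *m L)| <= 2 * b * a * c * enorm w.
    apply: le_trans (ler_normD _ _) _.
    have := qb (w *m L) l; have := qb l (w *m L); rewrite cl.
    have : b * c * enorm (w *m L) <= b * c * (a * enorm w).
      by rewrite ler_wpM2l// mulr_ge0.
    by rewrite (mulrAC b); lra.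
  have t2 : `|q l l| <= b * c ^+ 2 by rewrite (le_trans (qb _ _))// cl expr2 mulrA.
  apply: lerD.
    apply: (@le_trans _ _ ((C2 * enorm w ^+ 2) * (2 * b * a * c * enorm w))).
      by apply: ler_pM.
    rewrite [leLHS](_ : _ = 2 * b * a * c * C2 * enorm w ^+ 2 * enorm w); last by ring.
    rewrite [leRHS]mulrAC ler_wpM2l ?(ltW wd)// !mulr_ge0 ?sqr_ge0//.
  rewrite -(real_normK (num_real h)).
  apply: (@le_trans _ _ ((d * (C2 * enorm w ^+ 2)) * (b * c ^+ 2))).
    apply: ler_pM; rewrite ?sqr_ge0// expr2 ler_pM//; exact: ltW.
  by rewrite le_eqVlt; apply/orP; left; apply/eqP; ring.
have -> : h - (w *m (kappa^-1 *: (L *m A *m L^T)) *m w^T) 0 0 / 2 =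
    kappa^-1 * (kappa * h - q (w *m L) (w *m L) / 2).
  rewrite -dotpE -scalemxAr dotpZl !mulmxA dotp_mull trmxK /q.
  by field; rewrite gt_eqF.
rewrite normrM gtr0_norm ?invr_gt0// ler_pdivrMl//.
have -> : kappa * h - q (w *m L) (w *m L) / 2 = (kappa * h - zeta * q W W / 2) +
   ((zeta - 1) * q W W / 2 + (q W W - q (w *m L) (w *m L)) / 2) by ring.
apply: le_trans (ler_normD _ _) _.
have f2 : `|(zeta - 1) * q W W / 2| <= eta * (b * C4 * enorm w ^+ 2) / 2.
  rewrite normrM (gtr0_norm (_ : 0 < 2^-1)) ?invr_gt0// ler_pM2r ?invr_gt0//.
  rewrite normrM; apply: ler_pM; [exact: normr_ge0|exact: normr_ge0|exact: z1|].
  by apply: (le_trans qW); rewrite -mulrA ler_wpM2l.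
have f3 : `|(q W W - q (w *m L) (w *m L)) / 2| <= C3 * d * enorm w ^+ 2 / 2.
  by rewrite normrM (gtr0_norm (_ : 0 < 2^-1)) ?invr_gt0// ler_wpM2r ?invr_ge0.
have f23 := le_trans (ler_normD _ _) (lerD f2 f3).
apply: (le_trans (lerD main2 f23)).
have g1 : 2 * e * enorm W ^+ 2 <= 2 * e * C4 * enorm w ^+ 2.
  by rewrite -[leRHS]mulrA ler_wpM2l// mulr_ge0// ltW.
have := sqr_ge0 (enorm w); move: g1; move: (enorm w ^+ 2) (enorm W ^+ 2) => X Y g1 X0.
rewrite -!mulrA in eC4 etaC.
have g4 : (6 * (e * C4)) * X <= kappa * eps * X by rewrite ler_wpM2r.
have g5 : (2 * (eta * (b * C4))) * X <= kappa * eps * X by rewrite ler_wpM2r.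
have g6 : (3 * (C3 * d)) * X <= 2 * (kappa * eps) * X by rewrite ler_wpM2r.
have K0 : 0 <= kappa * eps * X by rewrite mulr_ge0// ltW.
have u0 : 2 * e * Y <= 2 * (e * C4 * X) by apply: le_trans g1 _; rewrite !mulrA.
have u1 : 6 * (e * C4 * X) <= kappa * (eps * X) by move: g4; rewrite !mulrA.
have u2 : 2 * (eta * (b * C4 * X)) <= kappa * (eps * X) by move: g5; rewrite !mulrA.
have u3 : 3 * (C3 * d * X) <= 2 * (kappa * (eps * X)) by move: g6; rewrite !mulrA.
rewrite -(mulrA kappa) in K0; clear -u0 u1 u2 u3 K0.
move: (e * C4 * X) (eta * (b * C4 * X)) (C3 * d * X) (kappa * (eps * X)) (2 * e * Y)
  u0 u1 u2 u3 K0 => *; lra.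
Qed.

End expansion.

(** * Differential of the gnomonic projection and correspondence of normals *)

Section gnomonic_differential.
Context {R : realType} {d : nat} (lam : R) (o : 'rV[R]_d.+1) (E : 'M[R]_(d, d.+1)).
Hypothesis lam0 : 0 < lam.
Hypothesis frame_oE : centered_frame lam o E.
Variable x : 'rV[R]_d.
Local Notation sig := (gsigma lam x).
Local Notation X := (gnom_inv lam o E x).

Let osq : dotp o o = lam^-1. Proof. by case: frame_oE. Qed.
Let EE : E *m E^T = 1%:M. Proof. by case: frame_oE. Qed.
Let oE : o *m E^T = 0.
Proof.
by case: frame_oE => _ _ Eo; rewrite -[LHS]trmxK trmx_mul trmxK Eo trmx0.
Qed.
Let lamN0 : lam != 0. Proof. by rewrite gt_eqF. Qed.
Let sigN0 : sig != 0. Proof. by rewrite gt_eqF// gsigma_gt0. Qed.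
Let sl0 : 0 < Num.sqrt lam. Proof. by rewrite sqrtr_gt0. Qed.

(* The differential of the gnomonic projection at X, and its inverse. *)
Definition gnom_diff (V : 'rV[R]_d.+1) : 'rV[R]_d :=
  sig *: (V *m E^T - (lam * dotp o V) *: x).

Definition gnom_diff_inv (u : 'rV[R]_d) : 'rV[R]_d.+1 :=
  sig^-1 *: (u *m E) - (lam * dotp x u / sig ^+ 3) *: (o + x *m E).

Lemma dotp_o_gnom_diff_inv u : dotp o (gnom_diff_inv u) = - (dotp x u / sig ^+ 3).
Proof.
rewrite /gnom_diff_inv !dotp_linE osq !(dotp_frame_l frame_oE); field.
by rewrite lamN0 sigN0.
Qed.

Lemma gnom_diff_invK u : gnom_diff (gnom_diff_inv u) = u.
Proof.
rewrite /gnom_diff dotp_o_gnom_diff_inv /gnom_diff_inv mulmxBl -!scalemxAl mulmxDl oE add0r.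
rewrite -!mulmxA EE !mulmx1 mulrN scaleNr opprK mulrA subrK.
by rewrite scalerA divff// scale1r.
Qed.

(** The round metric in the gnomonic chart, the spherical analogue of the Beltrami-Klein metric. *)
Lemma dotp_gnom_diff_inv u v : dotp (gnom_diff_inv u) (gnom_diff_inv v) =
  sig ^- 2 * (dotp u v - lam / sig ^+ 2 * (dotp x u * dotp x v)).
Proof.
have := gsigma_sqr lam0 x => s2.
rewrite (dotp_decomposition lam0 frame_oE) !dotp_o_gnom_diff_inv.
rewrite /gnom_diff_inv !mulmxBl -!scalemxAl !mulmxDl oE !add0r.
rewrite -!mulmxA EE !mulmx1 !dotp_linE (dotpC u x).
have -> : dotp x x = (sig ^+ 2 - 1) / lam by rewrite s2; field.
by field; rewrite lamN0 sigN0.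
Qed.

Lemma gnom_diff_inv_tangent u : dotp X (gnom_diff_inv u) = 0.
Proof.
rewrite /gnom_inv dotpZl dotpDl dotp_o_gnom_diff_inv dotp_mull.
rewrite /gnom_diff_inv mulmxBl -!scalemxAl !mulmxDl oE !add0r -!mulmxA EE !mulmx1.
rewrite !dotp_linE (_ : dotp x x = (sig ^+ 2 - 1) / lam).
  by field; rewrite lamN0 sigN0.
by rewrite gsigma_sqr//; field.
Qed.

Lemma enorm_gnom_diff_inv u : enorm (gnom_diff_inv u) <= enorm u.
Proof.
rewrite enorm_le ?enorm_ge0// enorm_sqr dotp_gnom_diff_inv.
have s1 : sig ^- 2 <= 1.
  by rewrite invf_le1 ?exprn_gt0 ?gsigma_gt0// exprn_ege1// gsigma_ge1.
apply: (@le_trans _ _ (sig ^- 2 * dotp u u)).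
  rewrite ler_wpM2l ?invr_ge0 ?exprn_ge0 ?(ltW (gsigma_gt0 lam0 x))//.
  by rewrite gerBl mulr_ge0 ?divr_ge0 ?exprn_ge0 ?(ltW lam0) ?(ltW (gsigma_gt0 lam0 x))// -expr2 sqr_ge0.
by rewrite ler_piMl ?dotp_ge0.
Qed.

(* the length of the normal vector N E - lam (x.N) o of the great hypersphere *)
(* through X that corresponds to the hyperplane orthogonal to N through x      *)
Definition gnu (N : 'rV[R]_d) : R := Num.sqrt (1 + lam * dotp x N ^+ 2).

Definition sphere_normal (N : 'rV[R]_d) : 'rV[R]_d.+1 :=
  (gnu N)^-1 *: (N *m E - (lam * dotp x N) *: o).

Lemma gnu_sqr N : gnu N ^+ 2 = 1 + lam * dotp x N ^+ 2.
Proof. by rewrite sqr_sqrtr// addr_ge0// mulr_ge0 ?sqr_ge0// ltW. Qed.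

Lemma gnu_ge1 N : 1 <= gnu N.
Proof.
have h : 0 <= lam * dotp x N ^+ 2 by rewrite mulr_ge0 ?sqr_ge0 ?(ltW lam0).
by rewrite -[1]sqrtr1 ler_sqrt ?lerDl ?addr_ge0.
Qed.

Lemma gnu_gt0 N : 0 < gnu N. Proof. exact: lt_le_trans (gnu_ge1 N). Qed.

Lemma gnu_le_gsigma N : dotp N N = 1 -> gnu N <= sig.
Proof.
move=> NN; rewrite ler_sqrt ?addr_ge0 ?mulr_ge0 ?dotp_ge0 ?(ltW lam0)//.
by rewrite lerD2l ler_wpM2l ?(ltW lam0)// (le_trans (dotp_sqr_le x N))// NN mulr1.
Qed.

(** The differential matches the two tangent hyperplanes of the boundary and multiplies heights over
    them by [sig * gnu N]. *)
Lemma dotp_sphere_normal N V :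
  dotp V (sphere_normal N) = (sig * gnu N)^-1 * dotp (gnom_diff V) N.
Proof.
rewrite /gnom_diff /sphere_normal !dotp_linE dotp_mulr (dotpC V o).
by field; rewrite sigN0 gt_eqF ?gnu_gt0.
Qed.

Lemma sphere_normal_unit N : dotp N N = 1 -> dotp (sphere_normal N) (sphere_normal N) = 1.
Proof.
move=> NN; have n2 := gnu_sqr N.
have nN0 : gnu N != 0 by rewrite gt_eqF ?gnu_gt0.
rewrite /sphere_normal !dotp_linE osq (dotp_frame frame_oE) NN.
rewrite (dotp_frame_l frame_oE) (dotpC (N *m E)) (dotp_frame_l frame_oE).
rewrite [LHS](_ : _ = gnu N ^- 2 * (1 + lam * dotp x N ^+ 2)).
  by rewrite -n2 mulVf ?sqrf_eq0.
by field; rewrite nN0 lamN0.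
Qed.

Lemma dotp_sphere_normal_gnom_inv N y :
  dotp (sphere_normal N) (gnom_inv lam o E y) =
  (gnu N)^-1 * (gsigma lam y)^-1 * dotp N (y - x).
Proof.
rewrite /sphere_normal /gnom_inv !dotp_linE osq (dotp_frame frame_oE).
rewrite (dotp_frame_l frame_oE) (dotpC (N *m E)) (dotp_frame_l frame_oE) (dotpC N x).
by field; rewrite lamN0 !gt_eqF ?gnu_gt0 ?gsigma_gt0.
Qed.

(** Supporting half-spaces at x correspond to supporting hemispheres at X, since the two dot
    products differ by a positive factor. Conversely N is the normalized component n of N' along the
    rows of E; n is nonzero because orthogonality to X fixes the component of N' along [o] in terms
    of n. *)
Lemma sphere_normalP (K : set 'rV[R]_d) (N' : 'rV[R]_d.+1) :
  outer_unit_normal (sphere d lam) (gnom_inv lam o E @` K) X N' <->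
  exists2 N, N' = sphere_normal N & outer_unit_normal (euclidean R d) K x N.
Proof.
split=> [[/= XN NN NK]|[N -> [_ NN NK]]]; last first.
  split => /=; last 1 first.
  - move=> _ [y Ky <-]; rewrite dotpBr !dotp_sphere_normal_gnom_inv subrr dotp0r mulr0 subr0.
    by rewrite mulr_ge0_le0 ?NK// mulr_ge0// invr_ge0 ltW ?gnu_gt0 ?gsigma_gt0.
  - by rewrite dotpC dotp_sphere_normal_gnom_inv subrr dotp0r mulr0.
  - exact: sphere_normal_unit.
pose n := N' *m E^T.
have on : dotp o N' = - dotp x n.
  move: XN; rewrite /gnom_inv dotpZl dotpDl dotp_mull => /eqP.
  by rewrite mulf_eq0 invr_eq0 (negbTE sigN0)/= addr_eq0 => /eqP.
have nn : dotp n n = 1 - lam * dotp x n ^+ 2.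
  have := dotp_decomposition lam0 frame_oE N' N'.
  by rewrite NN on -/n => ->; ring.
have n0 : n != 0.
  by apply/eqP => n0; move: nn; rewrite n0 !dotp0r expr0n mulr0 subr0 => /eqP; rewrite eq_sym oner_eq0.
have en0 : 0 < enorm n by rewrite lt_def enorm_ge0 enorm_eq0 n0.
have en2 := enorm_sqr n.
pose N := (enorm n)^-1 *: n.
have nuE : gnu N = (enorm n)^-1.
  rewrite /gnu /N dotpZr -[RHS]ger0_norm ?invr_ge0 ?(ltW en0)// -sqrtr_sqr.
  congr Num.sqrt; apply: (mulIf (_ : enorm n ^+ 2 != 0)); first by rewrite sqrf_eq0 gt_eqF.
  rewrite -exprMn mulVf ?gt_eqF// expr1n.
  transitivity (enorm n ^+ 2 + lam * dotp x n ^+ 2); last by rewrite en2 nn subrK.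
  by field; rewrite gt_eqF.
exists N.
  rewrite /sphere_normal nuE invrK /N dotpZr -scalemxAl scalerBr !scalerA.
  rewrite divff ?gt_eqF// scale1r (_ : enorm n * _ = lam * dotp x n); last first.
    by field; rewrite gt_eqF.
  by rewrite {1}(frame_decomposition lam0 frame_oE N') on mulrN scaleNr addrC.
split => //; first by rewrite /N dotpZl dotpZr -en2; field; rewrite gt_eqF.
move=> y Ky; have := NK _ (ex_intro2 _ _ y Ky erefl).
rewrite dotpBr (dotpC N' X) XN subr0 /gnom_inv dotpZr dotpDr dotp_mulr -/n (dotpC N') on.
rewrite pmulr_rle0 ?invr_gt0 ?gsigma_gt0// => h.
rewrite /N dotpZl pmulr_rle0 ?invr_gt0// dotpBr (dotpC n x).
by rewrite addrC.
Qed.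

End gnomonic_differential.

(** * The exponential map of the sphere in the gnomonic chart *)

Section gnomonic_exponential.
Context {R : realType} {d : nat} (lam : R) (o : 'rV[R]_d.+1) (E : 'M[R]_(d, d.+1)).
Hypothesis lam0 : 0 < lam.
Hypothesis frame_oE : centered_frame lam o E.
Variable x : 'rV[R]_d.
Local Notation sig := (gsigma lam x).
Local Notation X := (gnom_inv lam o E x).
Local Notation dg := (gnom_diff lam o E x).
Local Notation dgi := (gnom_diff_inv lam o E x).

Let osq : dotp o o = lam^-1. Proof. by case: frame_oE. Qed.
Let lamN0 : lam != 0. Proof. by rewrite gt_eqF. Qed.
Let sig0 : 0 < sig. Proof. exact: gsigma_gt0. Qed.
Let sigN0 : sig != 0. Proof. by rewrite gt_eqF. Qed.
Let sl0 : 0 < Num.sqrt lam. Proof. by rewrite sqrtr_gt0. Qed.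

Lemma normr_dotp_o V : `|lam * sig * dotp o V| <= sig * Num.sqrt lam * enorm V.
Proof.
rewrite !normrM (gtr0_norm lam0) (gtr0_norm sig0).
have := normr_dotp_le o V; rewrite {1}/enorm osq sqrtrV ?(ltW lam0)// => h.
rewrite (mulrC lam) -!mulrA ler_wpM2l ?(ltW sig0)//.
apply: (@le_trans _ _ (lam * ((Num.sqrt lam)^-1 * enorm V))).
  by rewrite ler_wpM2l ?(ltW lam0).
rewrite mulrA -{1}[lam]sqr_sqrtr ?(ltW lam0)//.
by rewrite expr2 mulfK ?gt_eqF.
Qed.

(** The endpoint is cos t (X + tau V) with tau = tan t / t, so central projection only sees the
    affine point X + tau V: the great circle becomes the line through x in the direction of the
    differential. The positivity hypothesis keeps the endpoint in the open hemisphere, and the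
    product form of the condition on tau includes V = 0. *)
Lemma expmap_gnom_inv V (tau : R) : dotp X V = 0 ->
  let t := Num.sqrt lam * enorm V in
  t < pi / 2 -> tau * t = tan t -> 0 < 1 + lam * sig * tau * dotp o V ->
  expmap (sphere d lam) X V =
  gnom_inv lam o E (x + (tau / (1 + lam * sig * tau * dotp o V)) *: dg V).
Proof.
move=> XV t tpi tauE pos.
have t0 : 0 <= t by rewrite mulr_ge0 ?enorm_ge0// ltW.
have cost : 0 < cos t.
  apply: cos_gt0_pihalf; rewrite tpi andbT; apply: lt_le_trans t0.
  by rewrite oppr_lt0 divr_gt0 ?pi_gt0.
have YE : expmap (sphere d lam) X V = cos t *: (X + tau *: V).
  rewrite /= -/t scalerDr; congr (_ + _).
  have [V0|V0] := eqVneq V 0; first by rewrite V0 !scaler0.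
  have tN0 : t != 0 by rewrite mulf_neq0 ?enorm_eq0// gt_eqF.
  rewrite scalerA; congr (_ *: _).
  have -> : tau = tan t / t by rewrite -tauE mulfK.
  by rewrite /tan; move: (t) tN0 cost => s sN0 coss; field; rewrite sN0 gt_eqF.
have oX : dotp o X = sig^-1 / lam by exact: dotp_o_gnom_inv.
have oY : dotp o (X + tau *: V) =
    (lam * sig)^-1 * (1 + lam * sig * tau * dotp o V).
  by rewrite dotpDr dotpZr oX; field; rewrite lamN0 sigN0.
have XX : dotp X X = lam^-1 by exact: gnom_inv_carrier.
have SY : carrier (sphere d lam) (cos t *: (X + tau *: V)).
  move: (gnom_inv lam o E x) XX XV => Y YY YV.
  rewrite /= dotpZl dotpZr dotpDl !dotpDr dotpZl !dotpZr (dotpC V Y) dotpZl YV.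
  rewrite !mulr0 addr0 add0r YY.
  have -> : tau * (tau * dotp V V) = tan t ^+ 2 / lam.
    rewrite -tauE /t !exprMn sqr_sqrtr ?(ltW lam0)// enorm_sqr.
    by field; rewrite lamN0.
  have := cos2_tan2 (_ : cos t != 0); rewrite gt_eqF// => /(_ isT) c2.
  rewrite (_ : _ * _ = cos t ^+ 2 * (1 + tan t ^+ 2) / lam); last by field; rewrite lamN0.
  by rewrite -c2 divff ?sqrf_eq0 ?gt_eqF// mul1r.
rewrite YE -[LHS](gnomK lam0 frame_oE SY); last first.
  by rewrite dotpZr oY !mulr_gt0 ?invr_gt0 ?mulr_gt0.
congr (gnom_inv _ _ _ _).
have XE : X *m E^T = sig^-1 *: x.
  have := gnom_invK lam0 frame_oE x; rewrite {1}/gnom oX => /(congr1 (fun v => sig^-1 *: v)) <-.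
  by rewrite scalerA (_ : _ * _ = 1) ?scale1r//; field; rewrite lamN0 sigN0.
rewrite /gnom -scalemxAl scalerA dotpZr.
rewrite (_ : _ * cos t = sig / (1 + lam * sig * tau * dotp o V)); last first.
  by rewrite oY; field; rewrite (gt_eqF pos) lamN0 sigN0 gt_eqF.
rewrite mulmxDl XE -scalemxAl /gnom_diff; move: (V *m E^T) (dotp o V) pos => w s pos.
by apply/rowP => i; rewrite !mxE; field; rewrite (gt_eqF pos) sigN0.
Qed.

(** The factor is tau / (1 + s) with 1 <= tau <= 1 + t, where both t and s are O(|V|). *)
Lemma expmap_near (eta : R) : 0 < eta -> exists2 delta : R, 0 < delta &
  forall V, dotp X V = 0 -> enorm V < delta -> exists zeta, `|zeta - 1| <= eta /\
    expmap (sphere d lam) X V = gnom_inv lam o E (x + zeta *: dg V).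
Proof.
move=> eta0; pose k := 2 * (sig * Num.sqrt lam).
have k0 : 0 < k by rewrite !mulr_gt0.
pose m0 := Num.min (1 / 2) (eta / 4).
have m00 : 0 < m0 by rewrite lt_min !divr_gt0.
exists (m0 / k); first by rewrite divr_gt0.
move=> V XV; rewrite ltr_pdivlMr// => Vm.
set t := Num.sqrt lam * enorm V.
have t0 : 0 <= t by rewrite mulr_ge0 ?enorm_ge0// ltW.
have tm : 2 * t <= enorm V * k.
  rewrite /t /k (_ : enorm V * _ = 2 * (sig * (Num.sqrt lam * enorm V))); last by ring.
  by rewrite ler_pM2l// ler_peMl ?gsigma_ge1.
have : enorm V * k < m0 by [].
rewrite lt_min => /andP[m1 m2].
have t1' : t < 1 by lra.
have t1 := ltW t1'.
have tpi : t < pi / 2 by apply: lt_le_trans t1' _; exact: pihalf_ge1.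
have cost : 1 - t / 2 <= cos t.
  apply: le_trans (cos_ge_quad t0); rewrite lerD2l lerN2 ler_wpM2r ?invr_ge0//.
  by rewrite expr2 ler_piMl.
have cost0 : 0 < cos t by apply: lt_le_trans cost; lra.
have [tau [tauE tau1 tau2]] : exists tau, [/\ tau * t = tan t, 1 <= tau & tau <= 1 + t].
  have [tz|tN0] := eqVneq t 0; first by exists 1; split; rewrite ?tz ?mulr0 ?tan0 ?addr0.
  have tp : 0 < t by rewrite lt_def tN0.
  have tpi' : t <= pi by apply: le_trans (ltW tpi) _; rewrite ler_pdivrMr// ler_peMr ?pi_ge0//; lra.
  exists (tan t / t); split; first by rewrite divfK.
    by rewrite ler_pdivlMr// mul1r /tan ler_pdivlMr// mul_cos_le_sin// t0.
  rewrite ler_pdivrMr// /tan ler_pdivrMr//; apply: (le_trans (sin_le t0)).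
  rewrite mulrC mulrA ler_peMl//; apply: (@le_trans _ _ ((1 - t / 2) * (1 + t))).
    by nra.
  by rewrite ler_wpM2r//; lra.
have so := normr_dotp_o V.
set s := lam * sig * tau * dotp o V.
have sm : `|s| <= enorm V * k.
  have -> : s = tau * (lam * sig * dotp o V) by rewrite /s; ring.
  rewrite normrM [`|tau|]ger0_norm; last by lra.
  rewrite [leRHS](_ : _ = 2 * (sig * Num.sqrt lam * enorm V)); last by rewrite /k; ring.
  by apply: ler_pM => //; lra.
have := sm; rewrite ler_norml => /andP[s1 s2].
have s0 : 1 / 2 <= 1 + s by lra.
exists (tau / (1 + s)); split; last by apply: expmap_gnom_inv => //; rewrite -/s; lra.
have sp : 0 < 1 + s by lra.
rewrite (_ : _ - 1 = (tau - 1 - s) / (1 + s)); last by field; rewrite gt_eqF.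
rewrite normrM normfV (gtr0_norm sp) ler_pdivrMr//.
apply: (@le_trans _ _ (2 * (enorm V * k))).
  by rewrite ler_norml; apply/andP; split; lra.
by nra.
Qed.

(** The factor of [expmap_gnom_inv] is inverted along the line: the parameter c is found by an
    arctangent. *)
Lemma expmap_inv_near (eta : R) : 0 < eta -> exists2 delta : R, 0 < delta &
  forall u, enorm u < delta -> exists c, `|c - 1| <= eta /\
    expmap (sphere d lam) X (c *: dgi u) = gnom_inv lam o E (x + u).
Proof.
move=> eta0; pose k := sig * Num.sqrt lam.
have k0 : 0 < k by rewrite !mulr_gt0.
pose m0 := Num.min (1 / 2) (eta / 2).
have m00 : 0 < m0 by rewrite lt_min !divr_gt0.
exists (m0 / k); first by rewrite divr_gt0.
move=> u; rewrite ltr_pdivlMr// => um.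
set U := dgi u.
have XU : dotp X U = 0 by exact: gnom_diff_inv_tangent.
have Uu : enorm U <= enorm u by exact: enorm_gnom_diff_inv.
have dU : dg U = u by exact: gnom_diff_invK.
have [U0|U0] := eqVneq U 0.
  exists 1; rewrite subrr normr0 ltW//; split => //.
  rewrite scale1r (@expmap_gnom_inv U 1) ?U0 ?enorm0 ?dotp0r ?mulr0 ?tan0 ?addr0 ?divr1 ?divr_gt0 ?pi_gt0//.
  by rewrite scale1r -U0 dU.
pose a := Num.sqrt lam * enorm U.
have a0 : 0 < a by rewrite mulr_gt0// lt_def enorm_ge0 enorm_eq0 U0.
pose m := enorm u * k.
have am : a <= m.
  rewrite /a /m /k mulrC; apply: ler_pM; rewrite ?enorm_ge0 ?(ltW sl0)//.
  by rewrite ler_peMl ?(ltW sl0)// gsigma_ge1.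
have : m < m0 by [].
rewrite lt_min => /andP[m1 m2].
set s := lam * sig * dotp o U.
have sm : `|s| <= m.
  apply: le_trans (normr_dotp_o U) _; rewrite /m mulrC ler_wpM2r//; exact: ltW.
have := sm; rewrite ler_norml => /andP[s1 s2].
have sp : 0 < 1 - s by lra.
(* Hitting x + u requires tau c = 1 + s (tau c), that is tau c = M. With angle theta = a c and tau =
   tan theta / theta this reads tan theta = a M. *)
pose M := (1 - s)^-1.
have M0 : 0 < M by rewrite invr_gt0.
have MsE : M * (1 - s) = 1 by rewrite mulVf// gt_eqF.
have M1 : 1 - m <= M by nra.
have M2 : M <= 1 + 2 * m by nra.
pose b := a * M; have b0 : 0 < b by rewrite mulr_gt0.
pose theta := atan b.
have tanE : tan theta = b by rewrite atanK.
have th0 : 0 < theta by rewrite -[X in X < _](atan0 R) lt_atan.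
have thpi : theta < pi / 2 by exact: atan_ltpi2.
have thpi' : theta <= pi by apply: le_trans (ltW thpi) _; rewrite ler_pdivrMr// ler_peMr ?pi_ge0//; lra.
have cth : 0 < cos theta.
  by apply: cos_gt0_pihalf; rewrite thpi andbT; apply: lt_trans th0; rewrite oppr_lt0 divr_gt0 ?pi_gt0.
have sinE : sin theta = b * cos theta by rewrite -tanE /tan mulfVK// gt_eqF.
have thb : theta <= b.
  have := @mul_cos_le_sin R theta; rewrite (ltW th0) thpi' => /(_ isT).
  by rewrite sinE ler_pM2r.
have bth : b * cos theta <= theta by rewrite -sinE sin_le// ltW.
have cth2 : 1 - b ^+ 2 / 2 <= cos theta.
  apply: le_trans (cos_ge_quad (ltW th0)); rewrite lerD2l lerN2 ler_wpM2r ?invr_ge0//.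
  by rewrite ler_sqr ?nnegrE ?(ltW th0) ?(ltW b0).
pose c := theta / a.
have cM : c <= M by rewrite ler_pdivrMr// mulrC.
have Mc : M * (1 - b ^+ 2 / 2) <= c.
  rewrite ler_pdivlMr//; apply: le_trans bth; rewrite mulrC mulrA ler_wpM2l//; exact: ltW.
have c0 : 0 < c by rewrite divr_gt0.
exists c; split.
  have b2m : b <= 2 * m by rewrite /b mulrC; apply: ler_pM; rewrite ?(ltW M0) ?(ltW a0)//; lra.
  have m_ge0 : 0 <= m by apply: le_trans am; exact: ltW.
  have b22 : b ^+ 2 <= 4 * m ^+ 2.
    by move: b2m m_ge0 b0; move: (b) (m) => b' m' *; rewrite !expr2; nra.
  have lo : (1 - m) * (1 - 2 * m ^+ 2) <= c.
    apply: le_trans Mc; apply: ler_pM => //; [lra| |lra].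
    by rewrite expr2; nra.
  rewrite ler_norml; apply/andP; split; last by lra.
  have : 1 - 2 * m <= (1 - m) * (1 - 2 * m ^+ 2) by rewrite expr2; nra.
  lra.
have tE : Num.sqrt lam * enorm (c *: U) = theta.
  by rewrite enormZ gtr0_norm// mulrCA -/a /c divfK// gt_eqF.
have tcE : b / theta * c = M.
  by rewrite /c /b; field; rewrite (gt_eqF th0) (gt_eqF a0).
have M1E : 1 + lam * sig * (b / theta) * dotp o (c *: U) = M.
  rewrite dotpZr (_ : _ * _ * _ * _ = (b / theta * c) * s); last by rewrite /s; ring.
  by rewrite tcE; move: MsE; rewrite mulrBr mulr1; lra.
rewrite (@expmap_gnom_inv _ (b / theta)) ?tE//.
- rewrite M1E; congr (gnom_inv _ _ _ (x + _)).
  rewrite -[RHS]dU /gnom_diff dotpZr -scalemxAl -{1}tcE.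
  move: (U *m E^T) (dotp o U) => w r.
  by apply/rowP => i; rewrite !mxE; field; rewrite (gt_eqF th0) (gt_eqF c0) (gt_eqF b0).
- by rewrite dotpZr XU mulr0.
- by rewrite tanE divfK// gt_eqF.
- by rewrite M1E.
Qed.

End gnomonic_exponential.

(** * Change of second order expansions and of their determinants *)

Section curvature_transfer.
Context {R : realType} {n : nat} (lam : R) (o : 'rV[R]_n.+2) (E : 'M[R]_(n.+1, n.+2)).
Hypothesis lam0 : 0 < lam.
Hypothesis frame_oE : centered_frame lam o E.
Variables (K : set 'rV[R]_n.+1) (x : 'rV[R]_n.+1).
Hypothesis compactK : compact K.
Local Notation sig := (gsigma lam x).
Local Notation X := (gnom_inv lam o E x).
Local Notation dg := (gnom_diff lam o E x).
Local Notation dgi := (gnom_diff_inv lam o E x).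
Local Notation SK := (gnom_inv lam o E @` K).
Local Notation eucl := (euclidean R n.+1).
Local Notation sph := (sphere n.+1 lam).

Let lamN0 : lam != 0. Proof. by rewrite gt_eqF. Qed.
Let sig0 : 0 < sig. Proof. exact: gsigma_gt0. Qed.
Let sigN0 : sig != 0. Proof. by rewrite gt_eqF. Qed.

Definition gnom_diff_mx m (B : 'M[R]_(m, n.+2)) : 'M[R]_(m, n.+1) :=
  sig *: (B *m E^T - lam *: (B *m o^T *m x)).

Definition gnom_diff_inv_mx m (B : 'M[R]_(m, n.+1)) : 'M[R]_(m, n.+2) :=
  sig^-1 *: (B *m E) - (lam / sig ^+ 3) *: (B *m x^T *m (o + x *m E)).

Lemma gnom_diff_mxE m (w : 'rV_m) B : dg (w *m B) = w *m gnom_diff_mx B.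
Proof.
rewrite /gnom_diff_mx -scalemxAr mulmxBr -scalemxAr !mulmxA.
rewrite [w *m B *m o^T]mx11_scalar -dotpE mul_scalar_mx scalerA.
by rewrite /gnom_diff (dotpC o).
Qed.

Lemma gnom_diff_inv_mxE m (w : 'rV_m) B : dgi (w *m B) = w *m gnom_diff_inv_mx B.
Proof.
rewrite /gnom_diff_inv_mx mulmxBr -!scalemxAr !mulmxA.
rewrite [w *m B *m x^T]mx11_scalar -dotpE mul_scalar_mx scalerA.
by rewrite /gnom_diff_inv (dotpC x) mulrAC.
Qed.

Lemma boundary_gnom_inv y : boundary sph SK (gnom_inv lam o E y) <-> boundary eucl K y.
Proof.
rewrite gnom_inv_boundary//; split=> [[z Kz /(gnom_inv_inj lam0 frame_oE) <-]//|Ky].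
by exists y.
Qed.

Section frames.
Variables (N : 'rV[R]_n.+1) (B : 'M[R]_(n, n.+1)) (B' : 'M[R]_(n, n.+2)).
Local Notation nu := (gnu lam x N).
Local Notation N' := (sphere_normal lam o E x N).
Hypothesis NN : dotp N N = 1.
Hypothesis BB : B *m B^T = 1%:M.
Hypothesis BN : B *m N^T = 0.
Hypothesis BB' : B' *m B'^T = 1%:M.
Hypothesis BN' : B' *m N'^T = 0.
Hypothesis BX : B' *m X^T = 0.

Let nu0 : 0 < nu. Proof. exact: gnu_gt0. Qed.
Let nuN0 : nu != 0. Proof. by rewrite gt_eqF. Qed.

Lemma dotp_frame_normal w : dotp (w *m B) N = 0.
Proof. by rewrite dotpE -mulmxA BN mulmx0 mxE. Qed.

Lemma dotp_frame_normal' w : dotp (w *m B') N' = 0.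
Proof. by rewrite dotpE -mulmxA BN' mulmx0 mxE. Qed.

Lemma dotp_frame_X w : dotp X (w *m B') = 0.
Proof. by rewrite dotpC dotpE -mulmxA BX mulmx0 mxE. Qed.

Lemma dotp_X_normal : dotp X N' = 0.
Proof. by rewrite dotpC dotp_sphere_normal_gnom_inv// subrr dotp0r mulr0. Qed.

Lemma tangent_decomposition V : dotp X V = 0 ->
  V = dotp V N' *: N' + V *m B'^T *m B'.
Proof.
move=> XV; pose X1 := Num.sqrt lam *: X.
have NN' := sphere_normal_unit lam0 frame_oE x NN.
have X11 : dotp X1 X1 = 1.
  rewrite dotpZl dotpZr mulrA -expr2 sqr_sqrtr ?(ltW lam0)//.
  by have -> := gnom_inv_carrier lam0 frame_oE x; rewrite mulfV.
pose B2 : 'M[R]_(1 + n, n.+2) := col_mx N' B'.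
have NB' : N' *m B'^T = 0 by rewrite -[LHS]trmxK trmx_mul trmxK BN' trmx0.
have B22 : B2 *m B2^T = 1%:M.
  rewrite tr_col_mx mul_col_row BB' BN' NB' [N' *m N'^T]mx11_scalar -dotpE NN'.
  by rewrite -scalar_mx_block.
have B2X : B2 *m X1^T = 0.
  rewrite mul_col_mx linearZ/= -!scalemxAr BX scaler0.
  by rewrite [N' *m X^T]mx11_scalar -dotpE dotpC dotp_X_normal raddf0 scaler0 col_mx0.
have B2E : B2^T *m B2 = N'^T *m N' + B'^T *m B' by rewrite /B2 tr_col_mx mul_row_col.
rewrite {1}(@orthonormal_decomposition R n.+1 X1 B2 V X11 B22 B2X).
rewrite /X1 dotpZr dotpC XV mulr0 scale0r add0r -mulmxA.
rewrite [X in V *m X](_ : _ = N'^T *m N' + B'^T *m B'); last exact: B2E.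
rewrite mulmxDr !mulmxA.
by rewrite [V *m N'^T]mx11_scalar -dotpE mul_scalar_mx.
Qed.

Lemma enorm_frame m k (C : 'M[R]_(m, k)) w : C *m C^T = 1%:M -> enorm (w *m C) = enorm w.
Proof. by move=> CC; rewrite /enorm dotp_mull -mulmxA CC mulmx1. Qed.

Lemma enorm_coordinates m k (C : 'M[R]_(m, k)) (M : 'rV_k) w h :
  C *m C^T = 1%:M -> dotp M M = 1 -> enorm (w *m C - h *: M) <= enorm w + `|h|.
Proof.
move=> CC MM; apply: le_trans (enormD _ _) _.
by rewrite enormN enormZ enorm_frame// {2}/enorm MM sqrtr1 mulr1.
Qed.

(** By [expmap_inv_near], x + u corresponds to the normal coordinates of c dgi(u). Their height is c
    h / (sig nu), and their tangential part is c times a linear function of w plus a multiple of h,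
    as [has_expansion_transfer] demands. *)
Lemma expansion_sphere_to_euclidean A :
  has_expansion (fun w h => boundary sph SK (expmap sph X (w *m B' - h *: N'))) A ->
  has_expansion (fun w h => boundary eucl K (expmap eucl x (w *m B - h *: N)))
    ((sig * nu)^-1^-1 *: (gnom_diff_inv_mx B *m B'^T *m A *m (gnom_diff_inv_mx B *m B'^T)^T)).
Proof.
apply: (@has_expansion_transfer _ _ _ _ _ _ (- (dgi N *m B'^T))).
  by rewrite invr_gt0 mulr_gt0.
move=> eta eta0; have [delta d0 H] := expmap_inv_near lam0 frame_oE x eta0.
exists (delta / 2) => [|w h wd hd]; first by rewrite divr_gt0.
set u := w *m B - h *: N => Ku.
have [|c [c1 cE]] := H u.
  by apply: le_lt_trans (enorm_coordinates _ _ BB NN) _; lra.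
exists c; split => //.
have XU := gnom_diff_inv_tangent lam0 frame_oE x u.
have UN : dotp (dgi u) N' = - ((sig * nu)^-1 * h).
  rewrite dotp_sphere_normal// gnom_diff_invK// /u dotpBl dotpZl NN dotp_frame_normal.
  by rewrite sub0r mulr1 mulrN.
rewrite (_ : _ - _ = c *: dgi u); last first.
  have -> : c *: dgi u = (c *: (dgi u *m B'^T)) *m B' -
      (c * ((sig * nu)^-1 * h)) *: N'.
    rewrite {1}(tangent_decomposition XU) UN scalerDr scalerA mulrN scaleNr addrC.
    by rewrite -scalemxAl.
  congr ((c *: _) *m _ - _).
  have -> : dgi u = w *m gnom_diff_inv_mx B - h *: dgi N.
    rewrite -gnom_diff_inv_mxE /u.
    rewrite -(mul1mx N) -[h *: _]mul_scalar_mx mul1mx.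
    have lin (a b : 'rV[R]_n.+1) (k : R) : dgi (a - k *: b) = dgi a - k *: dgi b.
      rewrite /gnom_diff_inv !mulmxBl -!scalemxAl !dotp_linE.
      by apply/rowP => i; rewrite !mxE; ring.
    by rewrite mul_scalar_mx lin.
  by rewrite mulmxA [RHS]mulmxBl -(scalemxAl h) scalerN.
by rewrite cE; apply/boundary_gnom_inv.
Qed.

(** The reverse passage, by [expmap_near]; it ensures that a spherical curvature exists wherever a
    Euclidean one does. *)
Lemma expansion_euclidean_to_sphere A :
  has_expansion (fun w h => boundary eucl K (expmap eucl x (w *m B - h *: N))) A ->
  has_expansion (fun w h => boundary sph SK (expmap sph X (w *m B' - h *: N')))
    ((sig * nu)^-1 *: (gnom_diff_mx B' *m B^T *m A *m (gnom_diff_mx B' *m B^T)^T)).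
Proof.
have NN' := sphere_normal_unit lam0 frame_oE x NN.
apply: (@has_expansion_transfer _ _ _ _ _ _ (- (dg N' *m B^T))).
  by rewrite mulr_gt0.
move=> eta eta0; have [delta d0 H] := expmap_near lam0 frame_oE x eta0.
exists (delta / 2) => [|w h wd hd]; first by rewrite divr_gt0.
set V := w *m B' - h *: N' => Kv.
have XV : dotp X V = 0 by rewrite dotpBr dotpZr dotp_frame_X dotp_X_normal mulr0 subrr.
have [|zeta [z1 zE]] := H V XV.
  by apply: le_lt_trans (enorm_coordinates _ _ BB' NN') _; lra.
exists zeta; split => //.
have VN : dotp (dg V) N = - (sig * nu * h).
  have : dotp V N' = (sig * nu)^-1 * dotp (dg V) N by exact: dotp_sphere_normal.
  rewrite {1}/V dotpBl dotpZl NN' dotp_frame_normal' sub0r mulr1 => hE.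
  by rewrite -mulrN hE mulrA divff ?mul1r// mulf_neq0.
rewrite [expmap eucl _ _](_ : _ = x + zeta *: dg V); last first.
  rewrite /=; congr (x + _).
  have -> : zeta *: dg V = (zeta *: (dg V *m B^T)) *m B -
      (zeta * (sig * nu * h)) *: N.
    rewrite {1}(orthonormal_decomposition (dg V) NN BB BN) VN.
    by rewrite scalerDr scalerA mulrN scaleNr addrC -scalemxAl.
  congr ((zeta *: _) *m _ - _).
  have -> : dg V = w *m gnom_diff_mx B' - h *: dg N'.
    rewrite -gnom_diff_mxE /V.
    have lin (a b : 'rV[R]_n.+2) (k : R) : dg (a - k *: b) = dg a - k *: dg b.
      rewrite /gnom_diff !mulmxBl -!scalemxAl !dotp_linE.
      by apply/rowP => i; rewrite !mxE; ring.
    by rewrite lin.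
  by rewrite mulmxA [RHS]mulmxBl -(scalemxAl h) scalerN.
by apply/boundary_gnom_inv; rewrite -zE.
Qed.

(** The inverse differential maps the tangent hyperplane of K into the span of the rows of B', so
    projecting to that span loses nothing. *)
Lemma gnom_diff_inv_mx_frame : gnom_diff_inv_mx B *m B'^T *m B' = gnom_diff_inv_mx B.
Proof.
apply/row_matrixP => i; rewrite !rowE !mulmxA -gnom_diff_inv_mxE.
set u := _ *m B; have XU := gnom_diff_inv_tangent lam0 frame_oE x u.
rewrite [in RHS](tangent_decomposition XU) dotp_sphere_normal// gnom_diff_invK//.
by rewrite dotp_frame_normal mulr0 scale0r add0r.
Qed.

Lemma gram_gnom_diff_inv_mx : gnom_diff_inv_mx B *m (gnom_diff_inv_mx B)^T =
  sig ^- 2 *: (1%:M - (lam / sig ^+ 2) *: ((x *m B^T)^T *m (x *m B^T))).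
Proof.
have rE i : row i (gnom_diff_inv_mx B) = dgi (row i B).
  by rewrite !rowE -gnom_diff_inv_mxE.
apply/matrixP => i j.
have -> : (gnom_diff_inv_mx B *m (gnom_diff_inv_mx B)^T) i j =
    dotp (row i (gnom_diff_inv_mx B)) (row j (gnom_diff_inv_mx B)).
  by rewrite !mxE; apply: eq_bigr => k _; rewrite !mxE.
have BBij : dotp (row i B) (row j B) = (1%:M : 'M[R]_n) i j.
  by rewrite -BB !mxE; apply: eq_bigr => k _; rewrite !mxE.
rewrite !rE dotp_gnom_diff_inv// BBij !mxE; congr (_ * (_ - _ * _)).
rewrite big_ord1 !mxE /dotp; by congr (_ * _); apply: eq_bigr => k _; rewrite !mxE.
Qed.

(** The Gram determinant is a rank one perturbation of the identity, so G = (nu / sig)^n (1 - lam |x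
    B^T|^2 / sig^2). The first factor lies between sig^-n and 1, the second between sig^-2 and 1,
    and sig <= sig^2 <= 1 + eta. *)
Lemma det_sphere_to_euclidean (eta : R) A : lam * dotp x x <= eta ->
  exists2 G, (1 + eta) ^- n.+2 <= G <= 1 &
    \det ((sig * nu)^-1^-1 *: (gnom_diff_inv_mx B *m B'^T *m A *m (gnom_diff_inv_mx B *m B'^T)^T)) =
    G * \det A.
Proof.
move=> xeta; set L := gnom_diff_inv_mx B *m B'^T.
have LL : L *m L^T = sig ^- 2 *: (1%:M - (lam / sig ^+ 2) *: ((x *m B^T)^T *m (x *m B^T))).
  rewrite -gram_gnom_diff_inv_mx -[X in _ = X *m _]gnom_diff_inv_mx_frame -/L.
  by rewrite {2}/L trmx_mul trmxK mulmxA.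
set bb := dotp (x *m B^T) (x *m B^T).
have bx : bb <= dotp x x by exact: dotp_orthonormal_le.
have b0 : 0 <= bb by exact: dotp_ge0.
have s2 := gsigma_sqr lam0 x.
have s1 := gsigma_ge1 lam0 x.
have nus := gnu_le_gsigma lam0 x NN.
have nu1 := gnu_ge1 lam0 x N.
exists ((nu / sig) ^+ n * (1 - lam / sig ^+ 2 * bb)); last first.
  have -> : \det ((sig * nu)^-1^-1 *: (L *m A *m L^T)) =
      (sig * nu) ^+ n * (\det (L *m L^T) * \det A).
    by rewrite detZ invrK !det_mulmx mulrAC.
  rewrite LL detZ det_rank1 -/bb !(mulrA _ _ (\det A)); congr (_ * _).
  rewrite mulrA -exprMn; congr (_ ^+ _ * _).
  by field; rewrite sigN0.
have t1 : sig ^- 2 <= 1 - lam / sig ^+ 2 * bb.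
  rewrite lerBrDr -[X in X + _](mul1r) mulrAC -mulrDl ler_pdivrMr ?exprn_gt0// mul1r.
  by rewrite s2 lerD2l ler_wpM2l// ltW.
have t2 : 1 - lam / sig ^+ 2 * bb <= 1.
  by rewrite gerBl !mulr_ge0 ?invr_ge0 ?exprn_ge0 ?(ltW sig0) ?(ltW lam0).
have t3 : nu / sig <= 1 by rewrite ler_pdivrMr// mul1r.
have t4 : sig^-1 <= nu / sig by rewrite ler_peMl// invr_ge0 ltW.
have sx : sig <= 1 + eta.
  apply: (@le_trans _ _ (sig ^+ 2)); first by rewrite expr2 ler_peMl// ltW.
  by rewrite s2 lerD2l.
have p0 : 0 <= nu / sig by apply: divr_ge0; exact: ltW.
have pn0 : 0 <= sig^-1 ^+ n by rewrite exprn_ge0// invr_ge0 ltW.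
apply/andP; split.
  apply: (@le_trans _ _ (sig^-1 ^+ n * sig ^- 2)).
    rewrite -!exprVn -exprD addn2.
    rewrite lerXn2r ?nnegrE ?invr_ge0 ?(ltW sig0)//.
      by apply: le_trans (ltW sig0) sx.
    by rewrite lef_pV2// posrE//; apply: lt_le_trans sx.
  have h1 : sig^-1 ^+ n <= (nu / sig) ^+ n.
    by rewrite lerXn2r ?nnegrE ?invr_ge0 ?(ltW sig0).
  have h2 : 0 <= sig ^- 2 by rewrite invr_ge0 exprn_ge0 ?(ltW sig0).
  exact: ler_pM.
rewrite -[leRHS]mulr1; apply: ler_pM => //.
- exact: exprn_ge0.
- by apply: le_trans t1; rewrite invr_ge0 exprn_ge0 ?(ltW sig0).
- exact: exprn_ile1.
Qed.

End frames.
End curvature_transfer.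

(** * Uniqueness and comparison of the curvature *)

Section uniqueness.
Context {R : realType} {n : nat}.
Implicit Types (K : set 'rV[R]_n) (x z u v N : 'rV[R]_n) (S : 'M[R]_n).

Lemma segment_meets_boundary K p0 p1 : closed K -> K p0 -> ~ K p1 ->
  exists2 r : R, 0 <= r <= 1 & boundary (euclidean R n) K (p0 + r *: (p1 - p0)).
Proof.
move=> cK K0 K1; pose g (r : R) := p0 + r *: (p1 - p0).
have cg : continuous g.
  move=> r; apply: (@continuous_addf R R^o _ (fun=> p0) (fun r : R^o => r *: (p1 - p0))).
    exact: cst_continuous.
  by apply: continuous_scalef; [exact: cvg_id|exact: cst_continuous].
have near_g r (U : set 'rV[R]_n) : nbhs (g r) U ->
    exists2 e : R, 0 < e & forall s, `|r - s| < e -> U (g s).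
  by move=> /cg /nbhs_ballP[e /= e0 eU]; exists e.
pose A : set R := [set r | 0 <= r <= 1 /\ K (g r)].
have A0 : A 0 by rewrite /A /= lexx ler01; split => //; rewrite /g scale0r addr0.
have hA : has_sup A by split; [exists 0|exists 1 => r [/andP[]]].
have s0 : 0 <= sup A by apply: ub_le_sup => //; exact: hA.2.
have s1 : sup A <= 1 by apply: ge_sup; [exists 0|move=> r [/andP[]]].
have Ks : K (g (sup A)).
  rewrite ((closure_id K).1 cK) => U /near_g[e e0 eU].
  have [r Ar sr] := sup_adherent e0 hA.
  exists (g r); split; first exact: Ar.2.
  apply: eU; rewrite ger0_norm ?subr_ge0; first by rewrite ltrBlDr -ltrBlDl.
  by apply: ub_le_sup => //; exact: hA.2.
exists (sup A); rewrite ?s0//; split; first exact: subset_closure.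
move=> U /near_g[e e0 eU].
have s1' : sup A < 1.
  rewrite lt_neqAle s1 andbT; apply/eqP => s1E; apply: K1; move: Ks.
  by rewrite s1E /g scale1r addrC subrK.
pose r := Num.min 1 (sup A + e / 2).
have sr : sup A < r by rewrite lt_min s1' ltrDl divr_gt0.
exists (g r); split.
  split => // Kr; have : r <= sup A.
    apply: ub_le_sup; first exact: hA.2.
    by split => //; rewrite (le_trans s0 (ltW sr)) ge_min lexx.
  by rewrite leNgt sr.
apply: eU; rewrite distrC gtr0_norm ?subr_gt0// ltrBlDl.
by rewrite (@le_lt_trans _ _ (sup A + e / 2)) ?ge_min ?lexx ?orbT// ltrD2l; lra.
Qed.

(* The second order expansion of the boundary in terms of v = y - x; S is the *)
(* second fundamental form, extended by 0 on the normal line.                 *)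
Definition normal_expansion K x N S : Prop :=
  forall eps : R, 0 < eps -> exists2 delta : R, 0 < delta & forall v,
    enorm v < delta -> boundary (euclidean R n) K (x + v) ->
    `|dotp N v + dotp (v *m S) v / 2| <= eps * enorm v ^+ 2.

(* Otherwise there is a boundary point of height t^2 |N.(z - x)| over a        *)
(* tangent vector of length O(c t), which is impossible for small c.           *)
Lemma parabola_subset K x z N S u : closed K -> convex_set K -> K x -> K z ->
  normal_expansion K x N S -> dotp N (z - x) < 0 -> dotp N u = 0 ->
  exists2 c : R, 0 < c & exists2 t0 : R, 0 < t0 & forall t, 0 < t < t0 ->
    K (x + (t ^+ 2 *: (z - x) + (c * t) *: u)).
Proof.
move=> cK convK Kx Kz exp_K Nz Nu.
have [b b0 bS] := mulmx_enorm_bound S.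
have [d1 d10 Hd1] := exp_K 1 ltr01.
pose hz := - dotp N (z - x); have hz0 : 0 < hz by rewrite oppr_gt0.
have [W WE] : exists W, W = enorm u + 1 by eexists.
have W1 : 1 <= W by rewrite WE lerDr enorm_ge0.
pose Z := enorm (z - x); have Z0 : 0 <= Z by exact: enorm_ge0.
have [D DE] : exists D, D = 4 * (b + 1) * W ^+ 2 by eexists.
have D0 : 0 < D by rewrite DE !mulr_gt0 ?exprn_gt0//; lra.
(* [hz] is the depth of z below the tangent hyperplane. A crossing point would have depth t^2 hz,
   but the expansion allows at most D c^2 t^2, and D c <= hz / 2. *)
have [c cE] : exists c, c = Num.min 1 (hz / (2 * D)) by eexists.
have c0 : 0 < c by rewrite cE lt_min ltr01 divr_gt0// mulr_gt0.
have c1 : c <= 1 by rewrite cE ge_min lexx.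
have cD : 2 * D * c <= hz by rewrite mulrC -ler_pdivlMr ?mulr_gt0// cE ge_min lexx orbT.
have [t0 t0E] : exists t0, t0 = Num.min 1 (Num.min (c * W / (Z + 1)) (d1 / (2 * c * W))).
  by eexists.
exists c => //; exists t0.
  by rewrite t0E !lt_min ltr01 !divr_gt0 ?mulr_gt0//; lra.
move=> t /andP[tp]; rewrite t0E !lt_min => /andP[t1 /andP[t2 t3]].
have {}t2 : t * Z <= c * W.
  by move: t2; rewrite ltr_pdivlMr; [nra|lra].
have {}t3 : 2 * c * W * t < d1.
  by move: t3; rewrite ltr_pdivlMr ?mulr_gt0//; lra.
have Kp : K (x + t ^+ 2 *: (z - x)).
  have t20 : 0 <= t ^+ 2 by rewrite sqr_ge0.
  have t21 : t ^+ 2 <= 1 by rewrite expr_le1// ltW.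
  have h : K (t ^+ 2 *: z + (1 - t ^+ 2) *: x).
    exact: (set_mem (convK z x (Itv01 t20 t21) (mem_set Kz) (mem_set Kx))).
  rewrite (_ : x + _ = t ^+ 2 *: z + (1 - t ^+ 2) *: x)//.
  by apply/rowP => i; rewrite !mxE; ring.
(* Otherwise the segment from x + t^2 (z - x), which lies in K, to the point on the parabola crosses
   the boundary. *)
apply: contrapT => nK.
rewrite addrA in nK.
have [r /andP[r0 r1] bd] := segment_meets_boundary cK Kp nK.
set v := t ^+ 2 *: (z - x) + (r * (c * t)) *: u.
have vE : x + t ^+ 2 *: (z - x) + r *: (x + t ^+ 2 *: (z - x) + (c * t) *: u - (x + t ^+ 2 *: (z - x))) = x + v.
  by rewrite [X in r *: X]addrAC subrr add0r scalerA -addrA.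
rewrite vE in bd.
have Nv : dotp N v = - (t ^+ 2 * hz).
  by rewrite /v dotpDr !dotpZr Nu mulr0 addr0 /hz mulrN opprK.
have vb : enorm v <= 2 * c * W * t.
  apply: le_trans (enormD _ _) _; rewrite !enormZ !ger0_norm ?sqr_ge0 ?mulr_ge0 ?(ltW c0) ?(ltW tp)//.
  have uW : enorm u <= W by rewrite WE lerDl.
  have h1 : t ^+ 2 * Z <= c * W * t.
    by rewrite expr2 -mulrA mulrC ler_wpM2r// ltW.
  have h2 : r * (c * t) * enorm u <= c * W * t.
    rewrite (_ : c * W * t = 1 * (c * t) * W); last by ring.
    apply: ler_pM; rewrite ?enorm_ge0// ?mulr_ge0 ?(ltW c0) ?(ltW tp)//.
    by rewrite ler_wpM2r// mulr_ge0 ?(ltW c0) ?(ltW tp).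
  by rewrite -/Z; lra.
have := Hd1 v (le_lt_trans vb t3) bd; rewrite Nv mul1r => h.
have q1 : `|dotp (v *m S) v| <= b * enorm v ^+ 2.
  apply: le_trans (normr_dotp_le _ _) _.
  by rewrite expr2 mulrA ler_wpM2r ?enorm_ge0.
have v2 : enorm v ^+ 2 <= (2 * c * W * t) ^+ 2.
  by rewrite ler_sqr ?nnegrE ?enorm_ge0// (le_trans (enorm_ge0 v)).
have {}v2 : enorm v ^+ 2 <= 4 * (c ^+ 2 * W ^+ 2 * t ^+ 2).
  by apply: le_trans v2 _; rewrite le_eqVlt; apply/orP; left; apply/eqP; ring.
have : t ^+ 2 * hz <= (b + 1) * enorm v ^+ 2.
  move: h q1; rewrite !ler_norml mulrDl mul1r => /andP[h1 h2] /andP[q1 q2].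
  have := mulr_ge0 b0 (sqr_ge0 (enorm v)); lra.
apply/negP; rewrite -ltNge.
apply: (@le_lt_trans _ _ ((b + 1) * (4 * (c ^+ 2 * W ^+ 2 * t ^+ 2)))).
  by rewrite ler_wpM2l//; lra.
rewrite [ltLHS](_ : _ = t ^+ 2 * (D * c * c)); last by rewrite DE; ring.
rewrite ltr_pM2l ?exprn_gt0//.
have Dc : 0 < D * c by rewrite mulr_gt0.
apply: (@le_lt_trans _ _ (D * c)); last by lra.
by rewrite ler_piMr// ltW.
Qed.

(* If N' were not parallel to N, the parabola tangent to the projection u of N' *)
(* to the hyperplane orthogonal to N would leave the half-space of N'.         *)
Lemma normal_unique K x z N N' S : closed K -> convex_set K -> K x -> K z ->
  normal_expansion K x N S ->
  dotp N N = 1 -> dotp N' N' = 1 ->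
  dotp N (z - x) < 0 -> dotp N' (z - x) < 0 ->
  (forall y, K y -> dotp N' (y - x) <= 0) -> N = N'.
Proof.
move=> cK convK Kx Kz exp_K NN NN' Nz Nz' N'K.
pose a := dotp N N'; pose u := N' - a *: N.
have Nu : dotp N u = 0 by rewrite /u dotpBr dotpZr NN mulr1 subrr.
have N'u : dotp N' u = dotp u u.
  by rewrite {2}/u dotpBl dotpZl Nu mulr0 subr0.
have [u0|u0] := eqVneq u 0.
  have N'E : N' = a *: N by apply/eqP; rewrite -subr_eq0 -/u u0.
  have a2 : a ^+ 2 = 1 by move: NN'; rewrite N'E dotpZl dotpZr NN mulr1.
  move: Nz'; rewrite N'E dotpZl nmulr_llt0// => a0.
  have : (a - 1) * (a + 1) = 0 by rewrite -subr_sqr_1 a2 subrr.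
  move=> /eqP; rewrite mulf_eq0 => /orP[|] /eqP h; last by exfalso; lra.
  have a1 : a = 1 by lra.
  by rewrite a1 scale1r.
have uu : 0 < dotp u u by rewrite dotp_gt0.
have [c c0 [t0 t00 H]] := parabola_subset cK convK Kx Kz exp_K Nz Nu.
pose m := - dotp N' (z - x); have m0 : 0 < m by rewrite oppr_gt0.
(* For small t the gain c t |u|^2 in the direction N' outweighs the loss t^2 m. *)
have [t tE] : exists t, t = Num.min (t0 / 2) (c * dotp u u / (2 * m)) by eexists.
have cu : 0 < c * dotp u u by rewrite mulr_gt0.
have tp : 0 < t by rewrite tE lt_min !divr_gt0// mulr_gt0.
have t1 : t < t0.
  by apply: (@le_lt_trans _ _ (t0 / 2)); [rewrite tE ge_min lexx|lra].
have t2 : t * (2 * m) <= c * dotp u u.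
  by rewrite -ler_pdivlMr ?mulr_gt0// tE ge_min lexx orbT.
exfalso; have := N'K _ (H t _); rewrite tp t1 => /(_ isT).
rewrite addrC addKr dotpDr !dotpZr N'u -[dotp N' _]opprK -/m.
rewrite expr2 -[X in X + _]mulrA -[X in _ + X]mulrA (mulrCA c) -mulrDr pmulr_rle0//.
have tm : 0 < t * m by rewrite mulr_gt0.
move=> h; lra.
Qed.

(** From a point of the parabola in K, moving outwards along N leaves K and crosses the boundary at
    x + v with v / (c t) close to u. Subtracting the two expansions there shows that the difference
    q of the forms satisfies q(v) = o(|v|^2), hence q(u) = 0 by homogeneity. *)
Lemma quadratic_form_unique K x z N S1 S2 u :
  closed K -> convex_set K -> K x -> K z ->
  (forall y, K y -> dotp N (y - x) <= 0) -> dotp N N = 1 ->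
  normal_expansion K x N S1 -> normal_expansion K x N S2 ->
  dotp N (z - x) < 0 -> dotp N u = 0 ->
  dotp (u *m S1) u = dotp (u *m S2) u.
Proof.
move=> cK convK Kx Kz NK NN e1 e2 Nz Nu.
have [c c0 [t0 t00 H]] := parabola_subset cK convK Kx Kz e1 Nz Nu.
pose S := S1 - S2; pose q v := dotp (v *m S) v.
suff : q u = 0 by rewrite /q /S mulmxBr dotpBl => /eqP; rewrite subr_eq0 => /eqP.
have [b b0 bS] := mulmx_enorm_bound S.
pose M := enorm (z - x) + `|dotp N (z - x)| + 1; have M1 : 1 <= M.
  by rewrite /M lerDr addr_ge0 ?enorm_ge0.
(* boundary points x + v with v / (c t) close to u *)
have main eps : 0 < eps -> exists t v, [/\ 0 < t <= eps,
    `|q v| <= eps * enorm v ^+ 2 & exists2 e, v = (c * t) *: u + t ^+ 2 *: e & enorm e <= M].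
  move=> eps0; have e40 : 0 < eps / 4 by rewrite divr_gt0.
  have [d1 d10 Hd1] := e1 _ e40; have [d2 d20 Hd2] := e2 _ e40.
  have [P PE] : exists P, P = c * enorm u + M by eexists.
  have P0 : 0 < P by rewrite PE ltr_wpDl ?mulr_ge0 ?enorm_ge0 ?(ltW c0)//; lra.
  have [t tE] : exists t, t = Num.min (Num.min 1 eps) (Num.min (t0 / 2)
      (Num.min (d1 / (2 * P)) (d2 / (2 * P)))) by eexists.
  have tp : 0 < t by rewrite tE !lt_min ltr01 eps0 !divr_gt0// mulr_gt0.
  have : t <= t by [].
  rewrite {2}tE !le_min => /andP[/andP[t1 teps] /andP[tt0 /andP[td1 td2]]].
  have tlt0 : t < t0 by lra.
  have Kp := H t; rewrite tp tlt0 in Kp; have {}Kp := Kp isT.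
  set p := x + _ in Kp.
  pose l := 1 - dotp N (z - x); have l0 : 0 < l by rewrite subr_gt0; lra.
  (* [l] is chosen so that this point has height t^2 > 0 over the supporting hyperplane. *)
  have nK : ~ K (p + (t ^+ 2 * l) *: N).
    move=> /NK.
    rewrite (_ : p + _ - x = t ^+ 2 *: (z - x) + (c * t) *: u + (t ^+ 2 * l) *: N); last first.
      by rewrite /p; apply/rowP => i; rewrite !mxE; ring.
    rewrite !dotpDr !dotpZr Nu NN mulr0 addr0 mulr1.
    by rewrite -mulrDr /l addrC subrK mulr1 leNgt exprn_gt0.
  have [r /andP[r0 r1] bd] := segment_meets_boundary cK Kp nK.
  pose e := (z - x) + (r * l) *: N.
  have eM : enorm e <= M.
    apply: le_trans (enormD _ _) _; rewrite /M -addrA lerD2l enormZ.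
    rewrite /enorm NN sqrtr1 mulr1 normrM (ger0_norm r0) (gtr0_norm l0).
    apply: (@le_trans _ _ l); first by rewrite ler_piMl// ltW.
    by have := ler_norm (- dotp N (z - x)); rewrite normrN /l; lra.
  pose v := (c * t) *: u + t ^+ 2 *: e.
  have vE : p + r *: (p + (t ^+ 2 * l) *: N - p) = x + v.
    by rewrite /p /v /e; apply/rowP => i; rewrite !mxE; ring.
  rewrite vE in bd.
  have vb : enorm v <= P * t.
    apply: le_trans (enormD _ _) _; rewrite !enormZ !ger0_norm ?sqr_ge0 ?mulr_ge0 ?(ltW c0) ?(ltW tp)//.
    rewrite PE mulrDl mulrAC lerD2l expr2 -mulrA mulrC ler_wpM2r ?(ltW tp)//.
    by rewrite -[leRHS]mul1r; apply: ler_pM; rewrite ?enorm_ge0 ?(ltW tp).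
  have v1 : enorm v < d1.
    by apply: le_lt_trans vb _; move: td1; rewrite ler_pdivlMr ?mulr_gt0//; lra.
  have v2 : enorm v < d2.
    by apply: le_lt_trans vb _; move: td2; rewrite ler_pdivlMr ?mulr_gt0//; lra.
  exists t, v; split; first by rewrite tp.
    have := Hd1 v v1 bd; have := Hd2 v v2 bd.
    rewrite /q /S mulmxBr dotpBl; move: (enorm v ^+ 2) => V.
    by rewrite !ler_norml => /andP[? ?] /andP[? ?]; apply/andP; split; lra.
  by exists e.
have U0 := enorm_ge0 u.
have [C CE] : exists C, C = (enorm u + M / c) ^+ 2 + 2 * b * enorm u * (M / c) + b * (M / c) ^+ 2.
  by eexists.
have Mc : 0 < M / c by rewrite divr_gt0//; lra.
have C0 : 0 <= C.
  have Mc0 := ltW Mc; rewrite CE; apply: addr_ge0; last by rewrite mulr_ge0 ?sqr_ge0.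
  apply: addr_ge0; first exact: sqr_ge0.
  by apply: mulr_ge0 => //; rewrite !mulr_ge0.
suff qC eps : 0 < eps -> eps <= 1 -> `|q u| <= eps * C.
  apply/eqP; rewrite -normr_eq0 eq_le normr_ge0 andbT.
  apply/ler_addgt0Pr => e e0; rewrite add0r.
  have [E' EE] : exists E', E' = Num.min 1 (e / (C + 1)) by eexists.
  have C10 : 0 < C + 1 by lra.
  apply: (@le_trans _ _ (E' * C)).
    by apply: qC; rewrite EE ?lt_min ?ltr01 ?divr_gt0// ge_min lexx.
  have : E' * (C + 1) <= e by rewrite -ler_pdivlMr// EE ge_min lexx orbT.
  have : 0 < E' by rewrite EE lt_min ltr01 divr_gt0.
  by nra.
move=> eps0 eps1; have [t [v [/andP[tp te] qv [e vE eM]]]] := main eps eps0.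
pose f := (t / c) *: e.
have ct0 : 0 < c * t by rewrite mulr_gt0.
have {}vE : v = (c * t) *: (u + f).
  by rewrite vE scalerDr /f scalerA; congr (_ + _ *: _); field; rewrite gt_eqF.
have qZ a w : q (a *: w) = a ^+ 2 * q w.
  by rewrite /q -scalemxAl dotpZl dotpZr; ring.
have {}qv : `|q (u + f)| <= eps * enorm (u + f) ^+ 2.
  move: qv; rewrite vE qZ enormZ (gtr0_norm ct0) [X in _ <= _ * X]exprMn normrM.
  by rewrite (ger0_norm (sqr_ge0 _)) mulrCA ler_pM2l ?exprn_gt0.
have fM : enorm f <= eps * (M / c).
  rewrite enormZ ger0_norm ?divr_ge0 ?(ltW tp) ?(ltW c0)// mulrAC -mulrA.
  by rewrite mulrCA mulrC -mulrA ler_pM ?mulr_ge0 ?invr_ge0 ?enorm_ge0 ?(ltW tp) ?(ltW c0)// mulrC ler_wpM2r// invr_ge0 ltW.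
have fM1 : enorm f <= M / c by apply: le_trans fM _; rewrite ler_piMl// ltW.
have f0 := enorm_ge0 f.
have qb a w : `|dotp (a *m S) w| <= b * enorm a * enorm w.
  by apply: le_trans (normr_dotp_le _ _) _; rewrite ler_wpM2r ?enorm_ge0.
have quE : q u = q (u + f) - (dotp (u *m S) f + dotp (f *m S) u + dotp (f *m S) f).
  by rewrite /q !mulmxDl !dotp_linE; ring.
rewrite quE; apply: le_trans (ler_normB _ _) _.
have t1 : `|q (u + f)| <= eps * (enorm u + M / c) ^+ 2.
  apply: (le_trans qv); rewrite ler_wpM2l ?(ltW eps0)//.
  rewrite ler_sqr ?nnegrE ?enorm_ge0 ?addr_ge0 ?(ltW Mc)//.
  by apply: le_trans (enormD _ _) _; rewrite lerD2l.
have t2 : `|dotp (u *m S) f| <= eps * (b * enorm u * (M / c)).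
  apply: le_trans (qb _ _) _; rewrite mulrCA ler_wpM2l// mulr_ge0//.
have t3 : `|dotp (f *m S) u| <= eps * (b * enorm u * (M / c)).
  apply: le_trans (qb _ _) _; rewrite mulrAC mulrCA ler_wpM2l// mulr_ge0//.
have t4 : `|dotp (f *m S) f| <= eps * (b * (M / c) ^+ 2).
  apply: le_trans (qb _ _) _; rewrite -mulrA [leRHS]mulrCA ler_wpM2l// expr2 (mulrA eps).
  by apply: ler_pM.
have := ler_normD (dotp (u *m S) f + dotp (f *m S) u) (dotp (f *m S) f).
have := ler_normD (dotp (u *m S) f) (dotp (f *m S) u).
rewrite CE !mulrDr; move: t1 t2 t3 t4.
rewrite (_ : eps * (2 * b * enorm u * (M / c)) = 2 * (eps * (b * enorm u * (M / c)))); last by ring.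
lra.
Qed.

End uniqueness.

Section curvature_unique.
Context {R : realType} {n : nat}.
Local Notation eucl := (euclidean R n.+1).

Lemma tangent_frame_mx m (M : space_model R m) y N (B : 'M[R]_((mdim M).-1, m)) :
  tangent_frame y N B -> B *m B^T = 1%:M /\ B *m N^T = 0.
Proof.
move=> [BB _ BN]; split => //; apply/matrixP => i j; rewrite !ord1 !mxE.
transitivity (dotp N (row i B)); last exact: BN.
by apply: eq_bigr => k _; rewrite !mxE mulrC.
Qed.

Lemma euclidean_normal_expansion (K : set 'rV[R]_n.+1) x N
    (B : 'M[R]_(n, n.+1)) (A : 'M[R]_n) :
  dotp N N = 1 -> B *m B^T = 1%:M -> B *m N^T = 0 ->
  @second_order_expansion R n.+1 eucl K x N B A ->
  normal_expansion K x N (B^T *m A *m B).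
Proof.
move=> NN BB BN [_ exp_A] eps eps0; have [delta d0 H] := exp_A _ eps0.
exists delta => // v vd Kv.
have vE : v = v *m B^T *m B - (- dotp v N) *: N.
  by rewrite scaleNr opprK addrC; exact: orthonormal_decomposition.
have wv : enorm (v *m B^T) <= enorm v.
  by rewrite enorm_le ?enorm_ge0// enorm_sqr dotp_orthonormal_le.
have hv : `|- dotp v N| <= enorm v.
  rewrite normrN (le_trans (normr_dotp_le _ _))//.
  by rewrite [X in _ * X]/enorm NN sqrtr1 mulr1.
have := H (v *m B^T) (- dotp v N) (le_lt_trans wv vd) (le_lt_trans hv vd).
rewrite /= -vE => /(_ Kv); rewrite -dotpE => h.
have -> : dotp N v + dotp (v *m (B^T *m A *m B)) v / 2 =
    - (- dotp v N - dotp (v *m B^T *m A) (v *m B^T) / 2).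
  by rewrite (dotpC N) dotp_mulr trmxK !mulmxA; ring.
rewrite normrN; apply: (le_trans h).
by rewrite ler_wpM2l ?(ltW eps0)// ler_sqr ?nnegrE ?enorm_ge0.
Qed.

(** K contains a point z + r N with r > 0, which still satisfies the weak inequality. *)
Lemma interior_normal_lt0 (K : set 'rV[R]_n.+1) x z N : K° z ->
  dotp N N = 1 -> (forall y, K y -> dotp N (y - x) <= 0) -> dotp N (z - x) < 0.
Proof.
move=> Kz NN NK.
have cg : {for (0 : R), continuous (fun r : R => z + r *: N)}.
  apply: continuous_addf; first exact: cst_continuous.
  by apply: continuous_scalef; [exact: cvg_id|exact: cst_continuous].
have : nbhs ((fun r : R => z + r *: N) 0) K by rewrite /= scale0r addr0.
move=> /cg /nbhs_ballP[e /= e0 eK].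
have e2 : 0 < e / 2 by rewrite divr_gt0.
have Ke : K (z + (e / 2) *: N).
  apply: eK; rewrite /ball /= sub0r normrN gtr0_norm//.
  by rewrite ltr_pdivrMr// ltr_pMr// ltr1n.
have h := NK _ Ke; rewrite -addrA (addrC (_ *: N)) addrA dotpDr dotpZr NN mulr1 in h.
by apply: (@le_lt_trans _ _ (- (e / 2))); [lra|rewrite oppr_lt0 divr_gt0].
Qed.

Lemma symmetric_form_inj m (S1 S2 : 'M[R]_m) : S1^T = S1 -> S2^T = S2 ->
  (forall v, dotp (v *m S1) v = dotp (v *m S2) v) -> S1 = S2.
Proof.
move=> S1T S2T q; apply/matrixP => i j.
have e (S : 'M[R]_m) : S i j = dotp (delta_mx 0 i *m S) (delta_mx 0 j).
  rewrite -rowE /dotp (bigD1 j)//= big1 ?addr0; first by rewrite !mxE !eqxx mulr1.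
  by move=> k kj; rewrite !mxE (negbTE kj) andbF mulr0.
rewrite !e; move: (delta_mx 0 i) (delta_mx 0 j) => u v.
have := q (u + v); rewrite !mulmxDl !dotpDl !dotpDr !q.
have sym S (a b : 'rV[R]_m) : S^T = S -> dotp (a *m S) b = dotp (b *m S) a.
  by move=> ST; rewrite dotp_mull ST dotpC.
by rewrite (sym S1 v u)// (sym S2 v u)//; lra.
Qed.

(** The normals agree, and so do the forms B^T A B: they agree on the tangent hyperplane and ignore
    the normal component. The two matrices A are then conjugate by the orthogonal matrix B2 B1^T, so
    their determinants coincide. *)
Lemma curvature_unique (K : set 'rV[R]_n.+1) x k1 k2 : convex_body K -> K x ->
  is_curvature eucl K x k1 -> is_curvature eucl K x k2 -> k1 = k2.
Proof.
move=> [convK compK [z Kz]] Kx [N1 [B1 [A1 [[_ NN1 NK1] tB1 e1 ->]]]].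
move=> [N2 [B2 [A2 [[_ NN2 NK2] tB2 e2 ->]]]].
move: B1 A1 tB1 e1 B2 A2 tB2 e2 => /= B1 A1 tB1 e1 B2 A2 tB2 e2.
have cK : closed K by apply: compact_closed => //; exact: norm_hausdorff.
have [BB1 BN1] := tangent_frame_mx tB1; have [BB2 BN2] := tangent_frame_mx tB2.
have x1 := euclidean_normal_expansion NN1 BB1 BN1 e1.
have x2 := euclidean_normal_expansion NN2 BB2 BN2 e2.
have Kz' := interior_subset Kz.
have z1 := interior_normal_lt0 Kz NN1 NK1; have z2 := interior_normal_lt0 Kz NN2 NK2.
have N12 := normal_unique cK convK Kx Kz' x1 NN1 NN2 z1 z2 NK2.
rewrite -{}N12 in NN2 NK2 BN2 x2 z2.
have [A1T _] := e1; have [A2T _] := e2.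
have SE : B1^T *m A1 *m B1 = B2^T *m A2 *m B2.
  apply: symmetric_form_inj.
  - by rewrite !trmx_mul trmxK A1T mulmxA.
  - by rewrite !trmx_mul trmxK A2T mulmxA.
  move=> v.
  have proj (B : 'M[R]_(n, n.+1)) (A : 'M[R]_n) : B *m B^T = 1%:M -> B *m N1^T = 0 ->
      dotp (v *m (B^T *m A *m B)) v =
      dotp ((v - dotp v N1 *: N1) *m (B^T *m A *m B)) (v - dotp v N1 *: N1).
    move=> BB BN; have NB : N1 *m B^T = 0 by rewrite -[LHS]trmxK trmx_mul trmxK BN trmx0.
    have pB : (v - dotp v N1 *: N1) *m B^T = v *m B^T.
      by rewrite mulmxBl -scalemxAl NB scaler0 subr0.
    have qE y : dotp (y *m (B^T *m A *m B)) y = dotp (y *m B^T *m A) (y *m B^T).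
      by rewrite !mulmxA dotp_mull.
    by rewrite !qE pB.
  rewrite (proj B1 A1)// (proj B2 A2)//.
  apply: (quadratic_form_unique cK convK Kx Kz' NK1 NN1 x1 x2 z1).
  by rewrite dotpBr dotpZr NN1 mulr1 (dotpC N1) subrr.
have AE : A2 = (B2 *m B1^T) *m A1 *m (B2 *m B1^T)^T.
  have : B2 *m (B2^T *m A2 *m B2) *m B2^T = A2.
    by rewrite !mulmxA BB2 mul1mx -mulmxA BB2 mulmx1.
  by rewrite -SE => <-; rewrite trmx_mul trmxK !mulmxA.
have OO : (B2 *m B1^T) *m (B2 *m B1^T)^T = 1%:M.
  rewrite trmx_mul trmxK mulmxA.
  have : forall v, v *m B2 *m B1^T *m B1 = v *m B2.
    move=> m v; have NB : B2 *m N1^T = 0 by [].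
    apply/row_matrixP => i; rewrite !row_mul.
    have := orthonormal_decomposition (row i v *m B2) NN1 BB1 BN1.
    by rewrite [dotp _ N1]dotpE -mulmxA NB mulmx0 mxE scale0r add0r => {2}->.
  by move=> /(_ _ 1%:M); rewrite !mul1mx => ->.
by rewrite AE !det_mulmx mulrAC -det_mulmx OO det1 mul1r.
Qed.

End curvature_unique.

(** * Comparison of the spherical and the Euclidean curvature *)

Section curvature_comparison.
Context {R : realType} {n : nat} (lam : R) (o : 'rV[R]_n.+2) (E : 'M[R]_(n.+1, n.+2)).
Hypothesis lam0 : 0 < lam.
Hypothesis frame_oE : centered_frame lam o E.
Local Notation eucl := (euclidean R n.+1).
Local Notation sph := (sphere n.+1 lam).
Local Notation gi := (gnom_inv lam o E).

Lemma sphere_tangent_frameP x N (B' : 'M[R]_(n, n.+2)) :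
  @tangent_frame R n.+2 sph (gi x) N B' <->
  [/\ B' *m B'^T = 1%:M, B' *m N^T = 0 & B' *m (gi x)^T = 0].
Proof.
have rowdot (M : 'rV[R]_n.+2) : B' *m M^T = 0 <-> forall i, dotp M (row i B') = 0.
  split=> [BM i|BM]; first by rewrite dotpC rowE dotpE -mulmxA BM mulmx0 mxE.
  by apply/row_matrixP => i; rewrite row_mul row0 [LHS]mx11_scalar -dotpE dotpC BM raddf0.
split=> [tB|[BB /rowdot BN /rowdot BX]]; last by split.
have [BB BN] := tangent_frame_mx tB; split => //.
by case: tB => _ tB _; apply/rowdot.
Qed.

Lemma euclidean_tangent_frameP x N (B : 'M[R]_(n, n.+1)) :
  B *m B^T = 1%:M -> B *m N^T = 0 -> @tangent_frame R n.+1 eucl x N B.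
Proof.
move=> BB BN; split => // i.
by rewrite dotpC rowE dotpE -mulmxA BN mulmx0 mxE.
Qed.

Lemma sphere_frame_exists x N : dotp N N = 1 ->
  exists B' : 'M[R]_(n, n.+2),
    @tangent_frame R n.+2 sph (gi x) (sphere_normal lam o E x N) B'.
Proof.
move=> NN; set N' := sphere_normal _ _ _ _ _.
have NN' : dotp N' N' = 1 by exact: sphere_normal_unit.
have XN : dotp (gi x) N' = 0 by exact: dotp_X_normal.
have XX : dotp (gi x) (gi x) = lam^-1 by exact: gnom_inv_carrier.
pose X1 := Num.sqrt lam *: gi x.
have X11 : dotp X1 X1 = 1.
  rewrite dotpZl dotpZr mulrA -expr2 sqr_sqrtr ?(ltW lam0)// XX.
  by rewrite mulfV// gt_eqF.
have [B1 [BB1 BX1]] := orthonormal_complement X11.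
have {}BX1 : B1 *m (gi x)^T = 0.
  move: BX1; rewrite /X1 linearZ/= -scalemxAr => /eqP.
  by rewrite scaler_eq0 gt_eqF ?sqrtr_gt0// => /eqP.
have N1E : N' = N' *m B1^T *m B1.
  have := orthonormal_decomposition N' X11 BB1.
  rewrite /X1 linearZ/= -scalemxAr BX1 scaler0 => /(_ erefl).
  by rewrite dotpZr dotpC XN mulr0 scale0r add0r.
pose n1 := N' *m B1^T.
have n11 : dotp n1 n1 = 1 by rewrite /n1 dotp_mulr trmxK -N1E.
have [B2 [BB2 Bn2]] := orthonormal_complement n11.
exists (B2 *m B1); apply/sphere_tangent_frameP; split.
- by rewrite trmx_mul mulmxA -(mulmxA B2) BB1 mulmx1 BB2.
- by rewrite -mulmxA (_ : B1 *m N'^T = n1^T) ?Bn2// /n1 trmx_mul trmxK.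
- by rewrite -mulmxA BX1 mulmx0.
Qed.

(** [back] converts the selected spherical value into an admissible Euclidean one, which is the
    selected one by uniqueness. *)
Lemma curvature_comparison (K : set 'rV[R]_n.+1) x (eta : R) :
  convex_body K -> K x -> lam * dotp x x <= eta ->
  exists2 G : R, (1 + eta) ^- n.+2 <= G <= 1 &
    curvature eucl K x = G * curvature sph (gi @` K) (gi x).
Proof.
move=> convK Kx xeta; have [_ compK _] := convK.
have eta0 : 0 <= eta by apply: le_trans xeta; rewrite mulr_ge0 ?dotp_ge0 ?ltW.
have back k : is_curvature sph (gi @` K) (gi x) k ->
    exists2 G : R, (1 + eta) ^- n.+2 <= G <= 1 & is_curvature eucl K x (G * k).
  move=> [N' [B' [A' [nN' tB' [A'T e'] ->]]]].
  move: B' A' tB' A'T e' => /= B' A' tB' A'T e'.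
  have [N N'E nN] := (sphere_normalP lam0 frame_oE x K N').1 nN'.
  rewrite {}N'E in nN' tB' e'.
  have [_ NN _] := nN.
  have [B [BB BN]] := orthonormal_complement NN.
  have [BB' BN' BX'] := (sphere_tangent_frameP _ _ _).1 tB'.
  have e := expansion_sphere_to_euclidean lam0 frame_oE compK NN BB BN BB' BN' BX' e'.
  have [G G1 GE] := det_sphere_to_euclidean lam0 frame_oE NN BB BN BB' BN' BX' A' xeta.
  exists G => //; rewrite -GE; exists N, B; eexists; split; [exact: nN| | |reflexivity].
    exact: euclidean_tangent_frameP.
  split; last exact: e.
  by rewrite linearZ/= !trmx_mul !trmxK A'T !mulmxA.
have forth k : is_curvature eucl K x k -> is_curvature sph (gi @` K) (gi x) !=set0.
  move=> [N [B [A [nN tB [AT e] _]]]].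
  move: B A tB AT e => /= B A tB AT e.
  have [_ NN _] := nN.
  have [BB BN] := tangent_frame_mx tB.
  have [B' tB'] := sphere_frame_exists x NN.
  have [BB' BN' BX'] := (sphere_tangent_frameP _ _ _).1 tB'.
  have e' := expansion_euclidean_to_sphere lam0 frame_oE compK NN BB BN BB' BN' BX' e.
  eexists; exists (sphere_normal lam o E x N), B'; eexists; split; [|exact: tB'| |reflexivity].
    by apply/(sphere_normalP lam0 frame_oE); exists N.
  split; last exact: e'.
  by rewrite linearZ/= !trmx_mul !trmxK AT !mulmxA.
have [[k Sk]|S0] := pselect (is_curvature sph (gi @` K) (gi x) !=set0).
  have Sc : is_curvature sph (gi @` K) (gi x) (curvature sph (gi @` K) (gi x)).
    exact: xgetI Sk.
  have [G G1 EG] := back _ Sc; exists G => //.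
  apply: (curvature_unique convK Kx _ EG); exact: xgetI EG.
(* Without a spherical value there is no Euclidean one by [forth]; both curvatures are the default
   0. *)
exists 1.
  by rewrite lexx andbT invf_le1 ?exprn_gt0 ?exprn_ege1//; lra.
rewrite /curvature !xgetPN ?mulr0// => k Sk; first by apply: S0; exists k.
by apply: S0; exact: forth Sk.
Qed.

End curvature_comparison.

(** For k > 0, ln G lies between -ln a and 0, so q ln G has absolute value at most |q| ln a, for
    either sign of q. *)
Lemma powR_comparison (R : realType) (a k G q : R) : 1 <= a -> a^-1 <= G <= 1 ->
  (G * k) `^ q <= a `^ `|q| * k `^ q /\ k `^ q <= a `^ `|q| * (G * k) `^ q.
Proof.
move=> a1 /andP[Ga G1]; have a0 : 0 < a by exact: lt_le_trans a1.
have G0 : 0 < G by apply: lt_le_trans Ga; rewrite invr_gt0.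
have aq : 1 <= a `^ `|q| by rewrite -(powRr0 a) ler_powR.
have [k0|k0|->] := ltgtP k 0; last 1 first.
- by rewrite mulr0; split; rewrite ler_peMl ?powR_ge0.
- (* junk value: ln vanishes on negative numbers *)
  have neg b : b < 0 -> b `^ q = 1.
    by move=> b0; rewrite /powR lt_eqF// ln0 ?(ltW b0)// mulr0 expR0.
  by rewrite !neg ?nmulr_llt0// ?mulr1 ?pmulr_rlt0.
have Gq : G `^ q <= a `^ `|q| /\ 1 <= a `^ `|q| * G `^ q.
  rewrite /powR !gt_eqF//.
  have lnG : - ln a <= ln G by rewrite -lnV ?posrE// ler_ln ?posrE ?invr_gt0.
  have lnG0 : ln G <= 0 by rewrite ln_le0.
  have lna : 0 <= ln a by rewrite ln_ge0.
  rewrite -expRD -[1]expR0 !ler_expR.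
  case: (ger0P q) => q0; split; nra.
rewrite (powRM _ (ltW G0) (ltW k0)) mulrA.
have kq : 0 <= k `^ q by exact: powR_ge0.
by case: Gq => g1 g2; rewrite ler_wpM2r// ler_peMl.
Qed.

(** * The limit *)

(** If the limit is infinite, the second bound forces f to be infinite near F. If it is finite, C =
    1 + m with m <= 1 gives |f - l| <= 2 m l. *)
Lemma cvge_ratio (R : realType) (T : Type) (F : set_system T) (FF : Filter F)
    (f : T -> \bar R) (l : \bar R) :
  (0 <= l)%E -> (forall t, 0 <= f t)%E ->
  (forall C : R, 1 < C -> \forall t \near F, (f t <= C%:E * l /\ l <= C%:E * f t)%E) ->
  f t @[t --> F] --> l.
Proof.
case: l => [l| |] // l0 f0 H; last first.
  have H2 := H 2 (ltr1n _ 2 : is_true (1 < 2)).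
  apply: cvg_near_cst; apply: filterS H2 => t [_].
  rewrite leye_eq; have := f0 t; case: (f t) => [r| |]//.
have {}l0 : 0 <= l by rewrite -lee_fin.
have fE t (C : R) : (f t <= C%:E * l%:E)%E -> f t = (fine (f t))%:E.
  move=> h; rewrite fineK// ge0_fin_numE//; exact: le_lt_trans h (ltry _).
apply/fine_cvgP; split.
  apply: filterS (H 2 _); last by rewrite ltr1n.
  by move=> t [/fE -> _].
apply/cvgrPdist_le => e e0.
have [m [m0 m1 me]] : exists m, [/\ 0 < m, m <= 1 & 2 * m * l <= e].
  exists (Num.min 1 (e / (2 * (l + 1)))).
  have l1 : 0 < 2 * (l + 1) by rewrite mulr_gt0//; lra.
  have p0 : 0 < Num.min 1 (e / (2 * (l + 1))) by rewrite lt_min ltr01 divr_gt0.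
  split => //; first by rewrite ge_min lexx.
  have : Num.min 1 (e / (2 * (l + 1))) * (2 * (l + 1)) <= e.
    by rewrite -ler_pdivlMr// ge_min lexx orbT.
  by nra.
apply: filterS (H (1 + m) _); last by rewrite ltrDl.
move=> t [h1 h2] /=; have ft := fE _ _ h1; rewrite ft in h1 h2.
have := f0 t; rewrite {}ft lee_fin; move: (fine (f t)) h1 h2 => r.
rewrite -!EFinM !lee_fin => h1 h2 r0.
have ml : 0 <= m * l by rewrite mulr_ge0// ltW.
have mr : m * r <= m * ((1 + m) * l) by rewrite ler_wpM2l// ltW.
have mml : m * (m * l) <= m * l by rewrite ler_piMl.
by rewrite /= ler_norml; apply/andP; split; lra.
Qed.

(** For eta <= 1/2 the expression is at most (1 + 2 eta)^N with N independent of eta; conclude by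
    continuity of the power at 1. *)
Lemma cst_ratio_near1 (R : realType) (C q : R) (n : nat) : 1 < C ->
  exists eta : R, [/\ 0 < eta, eta < 1 &
    ((1 + eta) ^+ n.+2) `^ `|q| * ((1 + eta) / (1 - eta)) ^+ n <= C].
Proof.
move=> C1; pose m := (Num.truncn `|q|).+1.
pose N := (n.+2 * m + 2 * n)%N.
have /cvgrPdist_lt/(_ (C - 1)) : {for 1, continuous (fun x : R => x ^+ N)}.
  exact: exprn_continuous.
rewrite subr_gt0 => /(_ C1) /nbhs_ballP[e /= e0 He].
pose eta := Num.min (1 / 2) (e / 4).
have eta0 : 0 < eta by rewrite lt_min !divr_gt0.
have eta1 : eta <= 1 / 2 by rewrite ge_min lexx.
have eta2 : eta <= e / 4 by rewrite ge_min lexx orbT.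
exists eta; split => //; first by lra.
have b1 : 1 <= 1 + eta by lra.
have b2 : 1 <= 1 + 2 * eta by lra.
have ratio : (1 + eta) / (1 - eta) <= (1 + 2 * eta) ^+ 2.
  by rewrite ler_pdivrMr; [rewrite expr2; nra|lra].
have p1 : ((1 + eta) ^+ n.+2) `^ `|q| <= (1 + 2 * eta) ^+ (n.+2 * m).
  apply: (@le_trans _ _ (((1 + eta) ^+ n.+2) `^ m%:R)).
    apply: ler_powR; first exact: exprn_ege1.
    by rewrite ltW// Num.Theory.truncnS_gt.
  rewrite powR_mulrn ?exprn_ge0//; last by lra.
  by rewrite -exprM lerXn2r ?nnegrE//; lra.
have p2 : ((1 + eta) / (1 - eta)) ^+ n <= (1 + 2 * eta) ^+ (2 * n).
  by rewrite exprM lerXn2r// nnegrE ?exprn_ge0 ?divr_ge0//; lra.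
apply: (@le_trans _ _ ((1 + 2 * eta) ^+ N)).
  rewrite exprD; apply: ler_pM => //; first exact: powR_ge0.
  by rewrite exprn_ge0// divr_ge0//; lra.
have := He (1 + 2 * eta); rewrite /ball /= opprD addrA subrr add0r normrN gtr0_norm ?mulr_gt0//.
have -> : 2 * eta < e by lra.
move=> /(_ isT); rewrite expr1n ltr_norml => /andP[h _]; lra.
Qed.

(** [le_integral_charts] over the boundary D of K, applied twice with the roles of the identity and
    of [gnom_inv] exchanged. *)
Lemma Omega_comparison (R : realType) (n : nat) (lam eta q : R)
    (o : 'rV[R]_n.+2) (E : 'M[R]_(n.+1, n.+2)) (K : set 'rV[R]_n.+1) :
  0 < lam -> centered_frame lam o E -> 0 < eta < 1 -> convex_body K ->
  (forall x, K x -> lam * dotp x x <= eta) ->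
  let c := ((1 + eta) ^+ n.+2) `^ `|q| * ((1 + eta) / (1 - eta)) ^+ n in
  let I1 := (\int[vol (euclidean R n.+1) :
          set (caratheodory_type (vol (euclidean R n.+1))) -> \bar R
        ]_(x in boundary (euclidean R n.+1) K)
     (curvature (euclidean R n.+1) K x `^ q)%:E)%E in
  let K' := gnomonic_preimage lam o E K in
  let I2 := (\int[vol (sphere n.+1 lam) :
          set (caratheodory_type (vol (sphere n.+1 lam))) -> \bar R
        ]_(x in boundary (sphere n.+1 lam) K')
     (curvature (sphere n.+1 lam) K' x `^ q)%:E)%E in
  (I2 <= c%:E * I1 /\ I1 <= c%:E * I2)%E.
Proof.
move=> lam0 fr /andP[eta0 eta1] convK Keta c I1 K' I2.
have [_ compK _] := convK.
have cK : closed K by apply: compact_closed => //; exact: norm_hausdorff.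
rewrite /I2 /K' gnomonic_preimageE// gnom_inv_boundary//.
set D := boundary (euclidean R n.+1) K in I1 *.
have cD : closed D by apply: closedI; exact: closed_closure.
have DK x : D x -> K x by move=> [+ _]; rewrite -((closure_id K).1 cK).
have compD : compact D by apply: subclosed_compact cD compK DK.
pose gi := gnom_inv lam o E.
have L0 : 0 < (1 + eta) / (1 - eta) by rewrite divr_gt0//; lra.
have e01 : 0 <= eta < 1 by rewrite (ltW eta0).
have bil x y (Dx : D x) (Dy : D y) :=
  gnom_inv_bilipschitz lam0 fr e01 (Keta x (DK x Dx)) (Keta y (DK y Dy)).
have tE : tame_metric D (fun x y => geodist (euclidean R n.+1) x y).
  exact: enorm_tame.
have tS : tame_metric D (fun x y => geodist (sphere n.+1 lam) (gi x) (gi y)).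
  apply: (sphere_tame lam0 cD _ _ L0).
  - exact: gnom_inv_continuous.
  - by move=> x _; exact: gnom_inv_carrier.
  - by move=> x y Dx Dy; have [] := bil x y Dx Dy.
have mE : (hausdorff_measure (carrier (euclidean R n.+1))
    (geodist (euclidean R n.+1)) n).-caratheodory (id @` D).
  rewrite image_id; apply: hausdorff_closed_caratheodory cD.
  exact: (enorm_tame closedT).
have carrier_closed : closed (carrier (sphere n.+1 lam)).
  rewrite /=; apply: (@closed_comp _ _ (fun x : 'rV[R]_n.+2 => dotp x x) [set lam^-1]).
    by move=> x _; apply: dotp_continuous; exact: cvg_id.
  exact: closed_eq.
have mS : (hausdorff_measure (carrier (sphere n.+1 lam))
    (geodist (sphere n.+1 lam)) n).-caratheodory (gi @` D).
  apply: hausdorff_closed_caratheodory.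
    (* The whole sphere is tame because chords are at most arcs, so the compact image of D is
       measurable. *)
    apply: (@sphere_tame _ _ _ _ _ id 1 lam0 carrier_closed);
      [by move=> x; exact: cvg_id|by []|exact: ltr01|].
    by move=> x y Sx Sy; rewrite mul1r; exact: enorm_le_sphere_dist.
  apply: compact_closed; first exact: norm_hausdorff.
  apply: continuous_compact => //; apply: continuous_subspaceT.
  exact: gnom_inv_continuous.
have curv x (Dx : D x) : let a := (1 + eta) ^+ n.+2 in
    let k1 := curvature (euclidean R n.+1) K x in
    let k2 := curvature (sphere n.+1 lam) (gi @` K) (gi x) in
    k1 `^ q <= a `^ `|q| * k2 `^ q /\ k2 `^ q <= a `^ `|q| * k1 `^ q.
  have [G G1 ->] := curvature_comparison lam0 fr convK (DK x Dx) (Keta x (DK x Dx)).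
  by apply: powR_comparison => //; rewrite exprn_ege1//; lra.
have a0 : 0 < ((1 + eta) ^+ n.+2) `^ `|q|.
  by rewrite powR_gt0// exprn_gt0//; lra.
split.
  have := @le_integral_charts R 'rV[R]_n.+1 'rV[R]_n.+1 'rV[R]_n.+2
    (carrier (euclidean R n.+1)) (carrier (sphere n.+1 lam))
    (geodist (euclidean R n.+1)) (geodist (sphere n.+1 lam)) D id id gi
    (gnom lam o E) n ((1 + eta) / (1 - eta)) (((1 + eta) ^+ n.+2) `^ `|q|)
    (fun x => curvature (euclidean R n.+1) K x `^ q)
    (fun x => curvature (sphere n.+1 lam) (gi @` K) x `^ q).
  rewrite image_id in mE *; apply => //.
  - by move=> x _; exact: gnom_inv_carrier.
  - by move=> x _; exact: gnom_invK.
  - by move=> x y Dx Dy; have [] := bil x y Dx Dy.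
  - by move=> x y Dx Dy; have [] := bil x y Dx Dy.
  - by move=> x; exact: powR_ge0.
  - by move=> x; exact: powR_ge0.
  - by move=> x Dx; have [] := curv x Dx.
have := @le_integral_charts R 'rV[R]_n.+1 'rV[R]_n.+2 'rV[R]_n.+1
    (carrier (sphere n.+1 lam)) (carrier (euclidean R n.+1))
    (geodist (sphere n.+1 lam)) (geodist (euclidean R n.+1)) D gi
    (gnom lam o E) id id n ((1 + eta) / (1 - eta)) (((1 + eta) ^+ n.+2) `^ `|q|)
    (fun x => curvature (sphere n.+1 lam) (gi @` K) x `^ q)
    (fun x => curvature (euclidean R n.+1) K x `^ q).
rewrite image_id; apply => //.
- by move=> x _; exact: gnom_inv_carrier.
- by move=> x _; exact: gnom_invK.
- by move=> x y Dx Dy; have [] := bil x y Dx Dy.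
- by move=> x y Dx Dy; have [] := bil x y Dx Dy.
- by move=> x; exact: powR_ge0.
- by move=> x; exact: powR_ge0.
- by move=> x Dx; have [] := curv x Dx.
Qed.

Lemma compact_dotp_bound (R : realType) n (K : set 'rV[R]_n) : compact K ->
  exists2 M : R, 0 <= M & forall x, K x -> dotp x x <= M.
Proof.
move=> cK.
have /compact_bounded[M [_ HM]] : compact ((fun x : 'rV[R]_n => dotp x x) @` K).
  apply: continuous_compact => //; apply: continuous_subspaceT => x.
  by apply: dotp_continuous; exact: cvg_id.
exists (`|M| + 1) => [|x Kx]; first by rewrite addr_ge0.
apply: le_trans (ler_norm _) _; apply: (HM (`|M| + 1)); last by exists x.
by rewrite ltr_pwDr// ler_norm.
Qed.

Lemma caratheodory_integral_ge0 (R : realType) (T : pointedType)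
    (mu : {outer_measure set T -> \bar R}) (D : set T) (f : T -> R) :
  (forall x, 0 <= f x) ->
  (0 <= \int[mu : set (caratheodory_type mu) -> \bar R]_(x in D) (f x)%:E)%E.
Proof. by move=> f0; apply: integral_ge0 => x _; rewrite lee_fin. Qed.

Theorem theorem9p14 (R : realType) (d : nat) (p : R) (Kb : set 'rV[R]_d)
    (o : R -> 'rV[R]_d.+1) (E : R -> 'M[R]_(d, d.+1)) :
  (2 <= d)%N -> p != - d%:R -> convex_body Kb -> (p < 0 -> class_C2_plus Kb) ->
  (forall lambda : R, 0 < lambda ->
     centered_frame lambda (o lambda) (E lambda)) ->
  Omega (sphere d lambda) p (gnomonic_preimage lambda (o lambda) (E lambda) Kb)
    @[lambda --> 0^'+] -->
  (\int[vol (euclidean R d) :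
          set (caratheodory_type (vol (euclidean R d))) -> \bar R
        ]_(x in boundary (euclidean R d) Kb)
     (curvature (euclidean R d) Kb x `^ (p / (d%:R + p)))%:E)%E.
Proof.
case: d Kb o E => [//|n] Kb o E _ _ convK _ frames.
have [_ compK _] := convK.
have [M M0 KM] := compact_dotp_bound compK.
apply: cvge_ratio.
- exact: (@caratheodory_integral_ge0 _ _ (hausdorff_measure _ _ _) _ _ (fun x => powR_ge0 _ _)).
- move=> lambda; exact: (@caratheodory_integral_ge0 _ _ (hausdorff_measure _ _ _) _ _ (fun x => powR_ge0 _ _)).
move=> C C1.
have [eta [eta0 eta1 etaC]] := cst_ratio_near1 (p / (n.+1%:R + p)) n C1.
have M10 : 0 < M + 1 by lra.
near=> lambda.
have lambda0 : 0 < lambda by [].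
(* [M] bounds the squared norm on the body and may be 0, hence M + 1. *)
have lambdaM : lambda < eta / (M + 1) by near: lambda; apply: nbhs_right_lt; rewrite divr_gt0.
have Keta x : Kb x -> lambda * dotp x x <= eta.
  move=> Kx; move: lambdaM; rewrite ltr_pdivlMr// => /ltW; apply: le_trans.
  by rewrite ler_wpM2l ?(ltW lambda0)// (le_trans (KM x Kx))// lerDl.
have e01 : 0 < eta < 1 by rewrite eta0.
have [h1 h2] := Omega_comparison (p / (n.+1%:R + p)) lambda0 (frames _ lambda0) e01 convK Keta.
split.
  apply: (le_trans h1); apply: lee_wpmul2r; last by rewrite lee_fin.
  exact: (@caratheodory_integral_ge0 _ _ (hausdorff_measure _ _ _) _ _ (fun x => powR_ge0 _ _)).
apply: (le_trans h2); apply: lee_wpmul2r; last by rewrite lee_fin.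
exact: (@caratheodory_integral_ge0 _ _ (hausdorff_measure _ _ _) _ _ (fun x => powR_ge0 _ _)).
Unshelve. all: by end_near.
Qed.
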